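(* Let $M$ be a manifold, let $\mathcal A$ be a prefactorization algebra on $M$, and suppose given, for every open subset $U\subseteq M$, a deformation retraction of cochain complexes $(i_U,p_U,h_U)$ of $\mathcal A(U)$ onto a cochain complex $\mathcal B(U)$. Then the collection $\{\mathcal B(U)\}_{U\subseteq M\text{ open}}$ has a $\mathrm{hoDisj}_M$-algebra structure, and the maps $i_U$ can be extended into an $\infty$-morphism of $\mathrm{hoDisj}_M$-algebras $\mathcal B\rightsquigarrow\mathcal A$.
   Context: Ground field $\mathbb R$; operads are coloured by the open subsets of $M$. A deformation retraction of $\mathcal A(U)$ onto $\mathcal B(U)$ consists of cochain maps $i_U:\mathcal B(U)\to\mathcal A(U)$, $p_U:\mathcal A(U)\to\mathcal B(U)$ and a degree $-1$ map $h_U:\mathcal A(U)\to\mathcal A(U)$ with $p_Ui_U=\mathrm{id}$ and $\mathrm{id}-i_Up_U=dh_U+h_Ud$. The operad $\mathrm{Disj}_M$: for $k\ge1$, $\mathrm{Disj}_M\binom{V}{U_1,\dots,U_k}=\mathbb R\{m^V_{U_1,\dots,U_k}\}$ if the open sets $U_i\subseteq V$ are pairwise disjoint, and $0$ otherwise; generators compose to generators and are permuted by the symmetric groups. A prefactorization algebra on $M$ is an algebra over $\mathrm{Disj}_M$ in cochain complexes. $\mathrm{Disj}_M$ has the quadratic-linear presentation $\mathcal T(E,R)$ with degree $0$ generators $\iota_U^V=m_U^V$ for $U\subsetneq V$ and $\mu_{U,V}=m_{U,V}^{U\sqcup V}$ for disjoint $U,V$ (the transposition exchanging $\mu_{U,V}$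 and $\mu_{V,U}$), and relations $R$: $\iota_V^W\circ\iota_U^V-\iota_U^W$ ($U\subsetneq V\subsetneq W$); for pairwise disjoint $U,V,W$, the differences of the three composites $\mu_{U\sqcup V,W}\circ_1\mu_{U,V}$, $(\mu_{U\sqcup W,V}\circ_1\mu_{U,W})\cdot(23)$, $\mu_{U,V\sqcup W}\circ_2\mu_{V,W}$; and $\mu_{V,W}\circ_1\iota_U^V-\iota_{U\sqcup W}^{V\sqcup W}\circ\mu_{U,W}$ ($U\subsetneq V$, $V\cap W=\emptyset$), $\mu_{U,V}\circ_2\iota_W^V-\iota_{U\sqcup W}^{U\sqcup V}\circ\mu_{U,W}$ ($W\subsetneq V$, $U\cap V=\emptyset$). Let $qR$ be the projection of $R$ to the weight-two part of the free operad, and $\varphi:qR\to E$ the map with $R=\{r-\varphi(r)\}$. $\mathrm{Disj}_M^{\text{¡}}$ is the Koszul dual dg cooperad: the sub-cooperad of the cofree cooperad $\mathcal T^c(E[1])$ with corelations $qR[2]$, with the coderivation induced by $\varphi$. $\mathrm{hoDisj}_M:=\Omega(\mathrm{Disj}_M^{\text{¡}})$ is its cobar construction; prefactorization algebras are $\mathrm{hoDisj}_M$-algebras via the canonical map $\Omega(\mathrm{Disj}_M^{\text{¡}})\to\mathrm{Disj}_M$. A $\mathrm{hoDisj}_M$-algebra structure on $\mathcal A$ is equivalent to a codifferential $D_{\mathcal A}$ on the cofree $\mathrm{Disj}_M^{\text{¡}}$-coalgebra $\mathrm{Disj}_M^{\text{¡}}(\mathcal A)$. An $\infty$-morphism $\mathcal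 B\rightsquigarrow\mathcal A$ is a morphism of dg $\mathrm{Disj}_M^{\text{¡}}$-coalgebras $(\mathrm{Disj}_M^{\text{¡}}(\mathcal B),D_{\mathcal B})\to(\mathrm{Disj}_M^{\text{¡}}(\mathcal A),D_{\mathcal A})$; it extends the maps $i_U$ if its components $\mathcal B(U)\to\mathcal A(U)$ (associated with the identity cooperations) are the $i_U$. *)

(* Defs.v *)
From HB Require Import structures.
From mathcomp Require Import all_boot all_order all_algebra.
From mathcomp Require Import all_classical all_reals all_analysis.

Set Implicit Arguments.
Unset Strict Implicit.
Unset Printing Implicit Defensive.

Import Order.TTheory GRing.Theory Num.Theory.
Import numFieldNormedType.Exports.
Local Open Scope classical_set_scope.
Local Open Scope quotient_scope.
Local Open Scope ring_scope.

(** * Modules presented by generators and relations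

    A formal sum is a list of pairs (coefficient, generator).  [pmod rel] is
    the R-module generated by [S] subject to the formal sums in [rel]: two
    formal sums are identified when they take the same value under every map
    from [S] to a module that kills all the relations. *)

Section Presented.
Variables (R : realType) (S : Type).

Definition comb (Y : lmodType R) (g : S -> Y) (s : seq (R * S)) : Y :=
  \sum_(p <- s) p.1 *: g p.2.

Variable rel : seq (R * S) -> Prop.

Definition compat (Y : lmodType R) (g : S -> Y) : Prop :=
  forall r, rel r -> comb g r = 0.

Definition peq (s s' : {classic seq (R * S)}) : bool :=
  `[< forall (Y : lmodType R) (g : S -> Y), compat g -> comb g s = comb g s' >].

Lemma peq_refl : reflexive peq.
Proof. by move=> s; apply/asboolP. Qed.

Lemma peq_sym : symmetric peq.
Proof.
by move=> s s'; apply/asboolP/asboolP => h Y g hg; rewrite (h Y g hg).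
Qed.

Lemma peq_trans : transitive peq.
Proof.
move=> s s' s'' /asboolP h /asboolP h'; apply/asboolP => Y g hg.
by rewrite (h Y g hg) (h' Y g hg).
Qed.

Canonical peq_equiv := EquivRel peq peq_refl peq_sym peq_trans.

Definition pmod := {eq_quot peq_equiv}.
HB.instance Definition _ := Choice.on pmod.
HB.instance Definition _ := EqQuotient.on pmod.

Definition pclass (s : seq (R * S)) : pmod := \pi_pmod (s : {classic seq (R * S)}).
Definition prepr (x : pmod) : seq (R * S) := repr x.
Definition pscale (a : R) (s : seq (R * S)) := [seq (a * p.1, p.2) | p <- s].

Lemma preprK x : pclass (prepr x) = x.
Proof. exact: reprK. Qed.

Lemma pclassP s s' :
  (forall (Y : lmodType R) (g : S -> Y), compat g -> comb g s = comb g s') <->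
  pclass s = pclass s'.
Proof.
split=> [h | /eqmodP/asboolP //].
by apply/eqmodP/asboolP.
Qed.

Lemma comb_prepr (Y : lmodType R) (g : S -> Y) s :
  compat g -> comb g (prepr (pclass s)) = comb g s.
Proof.
by move=> hg; have /pclassP/(_ Y g hg) := preprK (pclass s).
Qed.

Lemma comb_cat (Y : lmodType R) (g : S -> Y) s s' :
  comb g (s ++ s') = comb g s + comb g s'.
Proof. by rewrite /comb big_cat. Qed.

Lemma comb_pscale (Y : lmodType R) (g : S -> Y) a s :
  comb g (pscale a s) = a *: comb g s.
Proof.
rewrite /comb big_map scaler_sumr; apply: eq_bigr => p _ /=.
by rewrite scalerA.
Qed.

Definition padd (x y : pmod) := pclass (prepr x ++ prepr y).
Definition popp (x : pmod) := pclass (pscale (-1) (prepr x)).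
Definition pscal (a : R) (x : pmod) := pclass (pscale a (prepr x)).
Definition pzero := pclass [::].

Lemma pmod_ext (x y : pmod) :
  (forall (Y : lmodType R) (g : S -> Y), compat g ->
     comb g (prepr x) = comb g (prepr y)) -> x = y.
Proof. by move=> /pclassP; rewrite !preprK. Qed.

Let simp := (comb_cat, comb_pscale).

Lemma paddA : associative padd.
Proof.
move=> x y z; apply/pclassP => Y g hg.
by rewrite !simp !comb_prepr // !simp addrA.
Qed.

Lemma paddC : commutative padd.
Proof. by move=> x y; apply/pclassP => Y g hg; rewrite !simp addrC. Qed.

Lemma padd0 : left_id pzero padd.
Proof.
move=> x; apply: pmod_ext => Y g hg.
by rewrite !comb_prepr // !simp comb_prepr // /comb big_nil add0r.
Qed.

Lemma paddN : left_inverse pzero popp padd.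
Proof.
move=> x; apply/pclassP => Y g hg.
by rewrite !simp comb_prepr // simp scaleN1r addNr /comb big_nil.
Qed.

HB.instance Definition _ := GRing.isZmodule.Build pmod paddA paddC padd0 paddN.

Lemma pscalA a b x : pscal a (pscal b x) = pscal (a * b) x.
Proof.
apply/pclassP => Y g hg.
by rewrite !simp comb_prepr // simp scalerA.
Qed.

Lemma pscal1 : left_id 1 pscal.
Proof.
move=> x; apply: pmod_ext => Y g hg.
by rewrite !comb_prepr // simp scale1r.
Qed.

Lemma pscalDr : right_distributive pscal +%R.
Proof.
move=> a x y; apply/pclassP => Y g hg.
by rewrite !simp !comb_prepr // !simp scalerDr.
Qed.

Lemma pscalDl x : {morph pscal^~ x : a b / a + b}.
Proof.
move=> a b; apply/pclassP => Y g hg.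
by rewrite !simp !comb_prepr // !simp scalerDl.
Qed.

HB.instance Definition _ :=
  GRing.Zmodule_isLmodule.Build R pmod pscalA pscal1 pscalDr pscalDl.

Definition pgen (t : S) : pmod := pclass [:: (1, t)].

Definition plift (Y : lmodType R) (g : S -> Y) (x : pmod) : Y :=
  comb g (prepr x).

Lemma plift_is_linear (Y : lmodType R) (g : S -> Y) :
  compat g -> linear (plift g).
Proof.
move=> hg a x y.
by rewrite /plift !comb_prepr // simp comb_prepr // simp.
Qed.

Lemma plift_gen (Y : lmodType R) (g : S -> Y) t :
  compat g -> plift g (pgen t) = g t.
Proof.
by move=> hg; rewrite /plift comb_prepr // /comb big_seq1 scale1r.
Qed.

Lemma pclass_comb s : pclass s = comb pgen s.
Proof.
elim: s => [|[a t] s IHs]; first by rewrite /comb big_nil.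
rewrite /comb big_cons /= -[\sum_(_ <- _) _]/(comb pgen s) -IHs.
apply/pclassP => Y g hg.
rewrite !simp !comb_prepr // simp comb_prepr //.
by rewrite /comb big_cons big_seq1 /= scale1r.
Qed.

Lemma pgen_compat : compat pgen.
Proof.
move=> r hr; rewrite -pclass_comb; apply/pclassP => Y g hg.
by rewrite hg // /comb big_nil.
Qed.

Lemma comb_linear (Y Z : lmodType R) (f : {linear Y -> Z}) (g : S -> Y) s :
  comb (f \o g) s = f (comb g s).
Proof.
by rewrite /comb linear_sum; apply: eq_bigr => p _; rewrite linearZ.
Qed.

End Presented.

Arguments pgen {R S rel}.

Section PresentedLift.
Variables (R : realType) (S : Type) (rel : seq (R * S) -> Prop).
Variables (Y : lmodType R) (g : S -> Y) (hg : compat rel g).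

Definition plin of compat rel g : pmod rel -> Y := plift g.
HB.instance Definition _ :=
  GRing.isLinear.Build R (pmod rel) Y *:%R (plin hg) (plift_is_linear hg).

Lemma plinE t : plin hg (pgen t) = g t.
Proof. exact: plift_gen. Qed.

End PresentedLift.

(** * Kernels as modules *)

Section Kernel.
Variables (R : realType) (V W : lmodType R) (f : {linear V -> W}).

Definition in_kernel : {pred V} := [pred x | f x == 0].

Lemma in_kernel_submod : submod_closed in_kernel.
Proof.
split=> [|a x y]; rewrite !inE ?linear0 // => /eqP hx /eqP hy.
by rewrite linearP hx hy scaler0 addr0.
Qed.

HB.instance Definition _ :=
  GRing.isSubmodClosed.Build R V in_kernel in_kernel_submod.

Record kernel := Kernel { kval : V; kvalP : kval \in in_kernel }.
HB.instance Definition _ := [isSub for kval].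
HB.instance Definition _ := [Choice of kernel by <:].
HB.instance Definition _ := [SubChoice_isSubLmodule of kernel by <:].

Lemma kval_is_linear : linear kval.
Proof. by move=> a x y; rewrite -[kval]/val linearP. Qed.

HB.instance Definition _ :=
  GRing.isLinear.Build R kernel V *:%R kval kval_is_linear.

End Kernel.

Record opens (M : topologicalType) := Opens {
  oset :> set M;
  oset_open : open oset
}.

(** Graded modules coloured by the open sets; [n] is the cohomological degree. *)
Definition coll (R : realType) (M : topologicalType) :=
  opens M -> int -> lmodType R.

Definition hom0 (R : realType) (M : topologicalType) (X Y : coll R M) :=
  forall V n, {linear X V n -> Y V n}.

(** Maps of degree [k].  The target degree is a separate index, so that no
    transport along equalities of degrees is needed. *)
Definition homd (R : realType) (M : topologicalType) (k : int) (X Y : coll R M) :=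
  forall V n m, m = n + k -> {linear X V n -> Y V m}.

Definition homd_of_hom0 (R : realType) (M : topologicalType) (X Y : coll R M)
    (f : hom0 X Y) : homd 0 X Y :=
  fun V n m e => ecast i {linear X V n -> Y V i} (esym (etrans e (addr0 n))) (f V n).

(** * Trees on the generators of E[1]

    [tree L V m]: planar trees with output colour [V] whose vertices are the
    generators [iota_U^V] and [mu_(U,V)], each of degree -1 in E[1], and whose
    leaves of colour [U] and degree [n] are decorated by [L U n]; [m] is the
    total degree.  A tree is read depth first, from the root and from left to
    right, as a tensor of its vertices and leaves; this fixes Koszul signs. *)

Section Trees.
Variables (M : topologicalType).

Inductive tree (L : opens M -> int -> Type) : opens M -> int -> Type :=
| Leaf (V : opens M) (n : int) of L V n : tree L V n
| Iota (U V : opens M) (n m : int) of U `<` V & m = n - 1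
    & tree L U n : tree L V m
| Mu (U V W : opens M) (n1 n2 m : int) of U `&` V = set0
    & W = U `|` V :> set M & m = n1 + n2 - 1
    & tree L U n1 & tree L V n2 : tree L W m.

Fixpoint weight L V n (t : tree L V n) : nat :=
  match t with
  | Leaf _ _ _ => 0
  | Iota _ _ _ _ _ _ t => (weight t).+1
  | Mu _ _ _ _ _ _ _ _ _ t1 t2 => (weight t1 + weight t2).+1
  end.

End Trees.

(** Koszul sign (-1)^z *)
Definition sg (R : realType) (z : int) : R := (-1) ^ z.

(** * The comonad X |-> T^c(E[1])(X)

    A coloured cooperad C is handled through the comonad
    X |-> C(X) = (+)_k (C(k) (x) X^(x)k)_(S_k) on graded collections, whose value
    at X is the cofree C-coalgebra on X; C(V; U_1, ..., U_k) is recovered as the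
    part of C(X)(V) that is multilinear in free generators of X(U_1), ...,
    X(U_k).  The coinvariants of T^c(E[1])(k) (x) X^(x)k are the trees decorated by X,
    modulo linearity in each leaf and the identification of a vertex
    [mu_(U,V)] with its transpose [mu_(V,U)]. *)

Section Cofree.
Variables (R : realType) (M : topologicalType).
Implicit Types (X Y : coll R M) (U V W Z UV UW VW : opens M).
Implicit Types (n m i j k ij jk ik : int).

Definition smap (S S' : Type) (f : S -> S') (s : seq (R * S)) : seq (R * S') :=
  [seq (p.1, f p.2) | p <- s].

Inductive treerel X : forall V n, seq (R * tree X V n) -> Prop :=
| rel_leaf V n a (x y : X V n) :
    treerel [:: (1, Leaf (a *: x + y)); (- a, Leaf x); (- 1, Leaf y)]
| rel_flip U V W n1 n2 m (hd : U `&` V = set0) (hd' : V `&` U = set0)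
    (hu : W = U `|` V :> set M) (hu' : W = V `|` U :> set M)
    (e : m = n1 + n2 - 1) (e' : m = n2 + n1 - 1) t1 t2 :
    treerel [:: (1, Mu hd hu e t1 t2); (- sg R (n1 * n2), Mu hd' hu' e' t2 t1)]
| rel_iota U V n m (h : U `<` V) (e : m = n - 1) r :
    treerel r -> treerel (smap (Iota h e) r)
| rel_mul U V W n1 n2 m (hd : U `&` V = set0)
    (hu : W = U `|` V :> set M) (e : m = n1 + n2 - 1) r t2 :
    treerel r -> treerel (smap (fun t1 => Mu hd hu e t1 t2) r)
| rel_mur U V W n1 n2 m (hd : U `&` V = set0)
    (hu : W = U `|` V :> set M) (e : m = n1 + n2 - 1) t1 r :
    treerel r -> treerel (smap (Mu hd hu e t1) r).

Definition Tc X : coll R M := fun V n => pmod (@treerel X V n).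

Lemma comb_smap (S S' : Type) (Y : lmodType R) (f : S -> S') (g : S' -> Y) s :
  comb g (smap f s) = comb (g \o f) s.
Proof. by rewrite /comb big_map. Qed.

Lemma pgen_iota_compat X U V n m (h : U `<` V) (e : m = n - 1) :
  compat (@treerel X U n) (fun t => pgen (Iota h e t) : Tc X V m).
Proof.
move=> r hr; rewrite -(comb_smap (Iota h e)).
exact/pgen_compat/rel_iota.
Qed.

Definition TIota X U V n m (h : U `<` V) (e : m = n - 1) :
    {linear Tc X U n -> Tc X V m} :=
  plin (@pgen_iota_compat X U V n m h e).

Arguments TIota {X U V n m} h e.

Lemma pgen_mur_compat X U V W n1 n2 m (hd : U `&` V = set0)
    (hu : W = U `|` V :> set M) (e : m = n1 + n2 - 1) t1 :
  compat (@treerel X V n2) (fun t2 => pgen (Mu hd hu e t1 t2) : Tc X W m).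
Proof.
move=> r hr; rewrite -(comb_smap (Mu hd hu e t1)).
exact/pgen_compat/rel_mur.
Qed.

Definition TMu X U V W n1 n2 m (hd : U `&` V = set0)
    (hu : W = U `|` V :> set M) (e : m = n1 + n2 - 1)
    (x : Tc X U n1) (y : Tc X V n2) : Tc X W m :=
  plift (fun t1 => plin (@pgen_mur_compat X U V W n1 n2 m hd hu e t1) y) x.

Lemma TMu_compat X U V W n1 n2 m (hd : U `&` V = set0)
    (hu : W = U `|` V :> set M) (e : m = n1 + n2 - 1) (y : Tc X V n2) :
  compat (@treerel X U n1)
    (fun t1 => plin (@pgen_mur_compat X U V W n1 n2 m hd hu e t1) y).
Proof.
move=> r hr; rewrite /comb /plin /= /plift /comb.
under eq_bigr do rewrite scaler_sumr.
rewrite exchange_big /= big1 // => q _.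
under eq_bigr do rewrite scalerA mulrC -scalerA.
rewrite -scaler_sumr.
have := pgen_compat (rel_mul hd hu e q.2 hr).
by rewrite comb_smap /comb /= => ->; rewrite scaler0.
Qed.

Lemma TMu_linearl X U V W n1 n2 m (hd : U `&` V = set0)
    (hu : W = U `|` V :> set M) (e : m = n1 + n2 - 1) (y : Tc X V n2) :
  linear (fun x : Tc X U n1 => TMu hd hu e x y).
Proof. exact/plift_is_linear/TMu_compat. Qed.

Lemma TMu_linearr X U V W n1 n2 m (hd : U `&` V = set0)
    (hu : W = U `|` V :> set M) (e : m = n1 + n2 - 1) (x : Tc X U n1) :
  linear (TMu hd hu e x).
Proof.
move=> a y z; rewrite /TMu /plift /comb scaler_sumr -big_split /=.
apply: eq_bigr => p _.
by rewrite linearP scalerDr !scalerA mulrC.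
Qed.

HB.instance Definition _ X U V W n1 n2 m hd hu e (x : Tc X U n1) :=
  GRing.isLinear.Build R (Tc X V n2) (Tc X W m) *:%R
    (@TMu X U V W n1 n2 m hd hu e x) (TMu_linearr hd hu e x).

Lemma TMu_combl X U V W n1 n2 m (hd : U `&` V = set0)
    (hu : W = U `|` V :> set M) (e : m = n1 + n2 - 1) (y : Tc X V n2)
    (S : Type) (g : S -> Tc X U n1) s :
  TMu hd hu e (comb g s) y = \sum_(p <- s) p.1 *: TMu hd hu e (g p.2) y.
Proof. exact: (esym (comb_linear (plin (TMu_compat hd hu e y)) g s)). Qed.

Lemma TMu_combr X U V W n1 n2 m (hd : U `&` V = set0)
    (hu : W = U `|` V :> set M) (e : m = n1 + n2 - 1) (x : Tc X U n1)
    (S : Type) (g : S -> Tc X V n2) s :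
  TMu hd hu e x (comb g s) = \sum_(p <- s) p.1 *: TMu hd hu e x (g p.2).
Proof. exact: (esym (comb_linear (TMu hd hu e x) g s)). Qed.

Lemma TMu_gen X U V W n1 n2 m (hd : U `&` V = set0)
    (hu : W = U `|` V :> set M) (e : m = n1 + n2 - 1) t1 t2 :
  TMu hd hu e (pgen t1 : Tc X U n1) (pgen t2 : Tc X V n2)
  = pgen (Mu hd hu e t1 t2).
Proof. by rewrite /TMu plift_gen ?plinE //; exact: TMu_compat. Qed.

Lemma comb2 (S : Type) (Y : lmodType R) (g : S -> Y) a b s t :
  comb g [:: (a, s); (b, t)] = a *: g s + b *: g t.
Proof. by rewrite /comb big_cons big_seq1. Qed.

Lemma comb3 (S : Type) (Y : lmodType R) (g : S -> Y) a b c s t u :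
  comb g [:: (a, s); (b, t); (c, u)] = a *: g s + (b *: g t + c *: g u).
Proof. by rewrite /comb !big_cons big_nil /= addr0. Qed.

Lemma pgen_leaf_linear X V n : linear (fun x : X V n => pgen (Leaf x) : Tc X V n).
Proof.
move=> a x y.
have := pgen_compat (rel_leaf a x y); rewrite comb3 scale1r !scaleNr scale1r.
by rewrite -opprD => /eqP; rewrite subr_eq0 => /eqP.
Qed.

Definition tleaf X V n (x : X V n) : Tc X V n := pgen (Leaf x).
HB.instance Definition _ X V n :=
  GRing.isLinear.Build R (X V n) (Tc X V n) *:%R
    (@tleaf X V n) (@pgen_leaf_linear X V n).

Lemma TMu_flip X U V W n1 n2 m (hd : U `&` V = set0) (hd' : V `&` U = set0)
    (hu : W = U `|` V :> set M) (hu' : W = V `|` U :> set M)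
    (e : m = n1 + n2 - 1) (e' : m = n2 + n1 - 1)
    (x : Tc X U n1) (y : Tc X V n2) :
  TMu hd hu e x y = sg R (n1 * n2) *: TMu hd' hu' e' y x.
Proof.
rewrite -(preprK x) -(preprK y) !pclass_comb.
rewrite !TMu_combl scaler_sumr.
under eq_bigr do rewrite TMu_combr scaler_sumr.
rewrite exchange_big /=; apply: eq_bigr => q _.
rewrite TMu_combr !scaler_sumr; apply: eq_bigr => p _.
rewrite !TMu_gen !scalerA.
have := pgen_compat (rel_flip hd hd' hu hu' e e' p.2 q.2).
rewrite comb2 scale1r scaleNr => /eqP; rewrite subr_eq0 => /eqP ->.
by rewrite scalerA; congr (_ *: _); rewrite [in RHS]mulrC mulrA mulrAC.
Qed.


Lemma combD (S : Type) (Y : lmodType R) (g g' : S -> Y) s :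
  comb (fun t => g t + g' t) s = comb g s + comb g' s.
Proof. by rewrite /comb -big_split; apply: eq_bigr => p _; rewrite scalerDr. Qed.

Lemma combZ (S : Type) (Y : lmodType R) a (g : S -> Y) s :
  comb (fun t => a *: g t) s = a *: comb g s.
Proof.
by rewrite /comb scaler_sumr; apply: eq_bigr => p _; rewrite !scalerA mulrC.
Qed.

Lemma sgD p q : sg R (p + q) = sg R p * sg R q.
Proof. by rewrite /sg expfzDr // oppr_eq0 oner_eq0. Qed.

Lemma sgK p : sg R p * sg R p = 1.
Proof. by rewrite /sg expN1r -expr2 sqrr_sign. Qed.

Lemma sg_flipl k n1 n2 : sg R ((n1 + k) * n2) = sg R (n1 * n2) * sg R (k * n2).
Proof. by rewrite mulrDl sgD. Qed.

Lemma sg_flipr k n1 n2 : sg R (k * n1) * sg R (n1 * (n2 + k)) = sg R (n1 * n2).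
Proof. by rewrite mulrDr sgD (mulrC k) mulrCA sgK mulr1. Qed.

Lemma TMu0l X U V W n1 n2 m (hd : U `&` V = set0)
    (hu : W = U `|` V :> set M) (e : m = n1 + n2 - 1) (y : Tc X V n2) :
  TMu hd hu e 0 y = 0.
Proof. exact: (linear0 (plin (TMu_compat hd hu e y))). Qed.

Lemma comb_TMul X (S : Type) U V W n1 n2 m (hd : U `&` V = set0)
    (hu : W = U `|` V :> set M) (e : m = n1 + n2 - 1) (y : Tc X V n2)
    (g : S -> Tc X U n1) s :
  comb (fun t => TMu hd hu e (g t) y) s = TMu hd hu e (comb g s) y.
Proof. by rewrite TMu_combl. Qed.

Lemma comb_TMur X (S : Type) U V W n1 n2 m (hd : U `&` V = set0)
    (hu : W = U `|` V :> set M) (e : m = n1 + n2 - 1) (x : Tc X U n1)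
    (g : S -> Tc X V n2) s :
  comb (fun t => TMu hd hu e x (g t)) s = TMu hd hu e x (comb g s).
Proof. by rewrite TMu_combr. Qed.

(** The comultiplication T^c(E[1])(X) -> T^c(E[1])(T^c(E[1])(X)): the sum over
    all two-level cuts of a tree. *)
Fixpoint cutt X V n (t : tree X V n) : Tc (Tc X) V n :=
  match t in tree _ V n return Tc (Tc X) V n with
  | Leaf _ _ x => tleaf (tleaf x)
  | Iota _ _ _ _ h e t => tleaf (pgen (Iota h e t) : Tc X _ _) + TIota h e (cutt t)
  | Mu _ _ _ _ _ _ hd hu e t1 t2 =>
      tleaf (pgen (Mu hd hu e t1 t2) : Tc X _ _) + TMu hd hu e (cutt t1) (cutt t2)
  end.

Lemma cutt_compat X V n : compat (@treerel X V n) (@cutt X V n).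
Proof.
move=> r; elim=> {V n r}.
- move=> V n a x y; rewrite comb3 scale1r !scaleNr scale1r /= !linearP.
  by rewrite -opprD subrr.
- move=> U V W n1 n2 m hd hd' hu hu' e e' t1 t2.
  rewrite comb2 scale1r scaleNr /= (TMu_flip hd hd' hu hu' e e') scalerDr.
  rewrite opprD addrACA subrr addr0 -linearZ -linearB.
  have := pgen_compat (rel_flip hd hd' hu hu' e e' t1 t2).
  by rewrite comb2 scale1r scaleNr => ->; rewrite linear0.
- move=> U V n m h e r hr IH; rewrite comb_smap.
  rewrite (combD (fun t => tleaf (pgen (Iota h e t))) (fun t => TIota h e (cutt t))).
  rewrite (comb_linear (@tleaf (Tc X) V m)) pgen_iota_compat // linear0 add0r.
  by rewrite (comb_linear (TIota h e)) IH linear0.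
- move=> U V W n1 n2 m hd hu e r t2 hr IH; rewrite comb_smap.
  rewrite (combD (fun t => tleaf (pgen (Mu hd hu e t t2)))
    (fun t => TMu hd hu e (cutt t) (cutt t2))).
  rewrite (comb_linear (@tleaf (Tc X) W m)) -(comb_smap (fun t => Mu hd hu e t t2)).
  rewrite pgen_compat ?linear0 ?add0r; last exact: rel_mul.
  by rewrite (comb_TMul _ _ _ _ (@cutt X U n1)) IH TMu0l.
- move=> U V W n1 n2 m hd hu e t1 r hr IH; rewrite comb_smap.
  rewrite (combD (fun t => tleaf (pgen (Mu hd hu e t1 t)))
    (fun t => TMu hd hu e (cutt t1) (cutt t))).
  rewrite (comb_linear (@tleaf (Tc X) W m)) -(comb_smap (Mu hd hu e t1)).
  rewrite pgen_compat ?linear0 ?add0r; last exact: rel_mur.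
  by rewrite (comb_linear (TMu hd hu e (cutt t1))) IH linear0.
Qed.

Definition Delta X : hom0 (Tc X) (Tc (Tc X)) :=
  fun V n => plin (@cutt_compat X V n).
Arguments Delta {X} V n.

(** The functor T^c(E[1])(-) on maps of degree 0. *)
Fixpoint tmapt X Y (f : hom0 X Y) V n (t : tree X V n) : Tc Y V n :=
  match t in tree _ V n return Tc Y V n with
  | Leaf V n x => tleaf (f V n x)
  | Iota _ _ _ _ h e t => TIota h e (tmapt f t)
  | Mu _ _ _ _ _ _ hd hu e t1 t2 => TMu hd hu e (tmapt f t1) (tmapt f t2)
  end.

Lemma tmapt_compat X Y (f : hom0 X Y) V n : compat (@treerel X V n) (@tmapt X Y f V n).
Proof.
move=> r; elim=> {V n r}.
- move=> V n a x y; rewrite comb3 scale1r !scaleNr scale1r /= !linearP.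
  by rewrite -opprD subrr.
- move=> U V W n1 n2 m hd hd' hu hu' e e' t1 t2.
  by rewrite comb2 scale1r scaleNr /= (TMu_flip hd hd' hu hu' e e') subrr.
- move=> U V n m h e r hr IH; rewrite comb_smap.
  by rewrite (comb_linear (TIota h e)) IH linear0.
- move=> U V W n1 n2 m hd hu e r t2 hr IH; rewrite comb_smap.
  by rewrite comb_TMul IH TMu0l.
- move=> U V W n1 n2 m hd hu e t1 r hr IH; rewrite comb_smap.
  by rewrite comb_TMur IH linear0.
Qed.

Definition Tmap X Y (f : hom0 X Y) : hom0 (Tc X) (Tc Y) :=
  fun V n => plin (@tmapt_compat X Y f V n).
Arguments Tmap {X Y} f V n.

Lemma deg_iota (n m m' k : int) : m = n - 1 -> m' = m + k -> m' = n + k - 1.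
Proof. by move=> -> ->; rewrite addrAC. Qed.

Lemma deg_mul (n1 n2 m m' k : int) :
  m = n1 + n2 - 1 -> m' = m + k -> m' = n1 + k + n2 - 1.
Proof. by move=> -> ->; rewrite addrAC (addrAC n1 n2 k). Qed.

Lemma deg_mur (n1 n2 m m' k : int) :
  m = n1 + n2 - 1 -> m' = m + k -> m' = n1 + (n2 + k) - 1.
Proof. by move=> -> ->; rewrite addrAC addrA. Qed.

(** The infinitesimal composite T^c(E[1])(f0; f1): [f1], of degree [k], is
    applied to one leaf and [f0] to the other ones, with the Koszul sign of
    moving [f1] past what stands to the left of that leaf. *)
Fixpoint infmapt X Y (k : int) (f0 : hom0 X Y) (f1 : homd k X Y) V n
    (t : tree X V n) : forall m, m = n + k -> Tc Y V m :=
  match t in tree _ V n return forall m, m = n + k -> Tc Y V m with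
  | Leaf V n x => fun m e => tleaf (f1 V n m e x)
  | Iota _ _ _ _ h e0 t => fun m e =>
      sg R k *: TIota h (deg_iota e0 e) (infmapt f0 f1 t erefl)
  | Mu _ _ _ n1 _ _ hd hu e0 t1 t2 => fun m e =>
      sg R k *: (TMu hd hu (deg_mul e0 e) (infmapt f0 f1 t1 erefl) (tmapt f0 t2)
       + sg R (k * n1) *:
           TMu hd hu (deg_mur e0 e) (tmapt f0 t1) (infmapt f0 f1 t2 erefl))
  end.

Lemma infmapt_compat X Y k (f0 : hom0 X Y) (f1 : homd k X Y) V n m (e : m = n + k) :
  compat (@treerel X V n) (fun t => infmapt f0 f1 t e).
Proof.
move=> r hr; elim: hr m e => {V n r}.
- move=> V n a x y m e; rewrite comb3 scale1r !scaleNr scale1r /= !linearP.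
  by rewrite -opprD subrr.
- move=> U V W n1 n2 m hd hd' hu hu' e e' t1 t2 m' e''.
  rewrite comb2 scale1r scaleNr /=.
  rewrite (TMu_flip hd hd' hu hu' _ (deg_mur e' e'')).
  rewrite (TMu_flip hd hd' hu hu' _ (deg_mul e' e'')).
  rewrite [sg R (k * n1) *: _]scalerA sg_flipr sg_flipl -scalerA -scalerDr.
  by rewrite [_ + TMu _ _ _ _ _]addrC !scalerA [sg R k * _]mulrC subrr.
- move=> U V n m h e r hr IH m' e'; rewrite comb_smap.
  rewrite (combZ _ (fun t => TIota h _ (infmapt f0 f1 t erefl))).
  by rewrite (comb_linear (TIota h (deg_iota e e'))) IH linear0 scaler0.
- move=> U V W n1 n2 m hd hu e r t2 hr IH m' e'; rewrite comb_smap.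
  rewrite (combZ _ (fun t => TMu hd hu (deg_mul e e') _ _ + _)) combD combZ.
  rewrite (comb_TMul _ _ _ _ (fun t => infmapt f0 f1 t erefl)) IH.
  by rewrite (comb_TMul _ _ _ _ (@tmapt X Y f0 U n1)) tmapt_compat // !TMu0l scaler0 addr0 scaler0.
- move=> U V W n1 n2 m hd hu e t1 r hr IH m' e'; rewrite comb_smap.
  rewrite (combZ _ (fun t => TMu hd hu (deg_mul e e') _ _ + _)) combD combZ.
  rewrite (comb_TMur _ _ _ _ (fun t => infmapt f0 f1 t erefl)) IH.
  by rewrite (comb_TMur _ _ _ _ (@tmapt X Y f0 V n2)) tmapt_compat // !linear0 addr0 linear0.
Qed.

Definition infmap X Y k (f0 : hom0 X Y) (f1 : homd k X Y) : homd k (Tc X) (Tc Y) :=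
  fun V n m e => plin (@infmapt_compat X Y k f0 f1 V n m e).
Arguments infmap {X Y k} f0 f1 V {n m} e.


(** * The Koszul dual cooperad *)

(** The corelations [qR[2]], evaluated on leaves.  A composite [x o_i y] of
    generators corresponds to the composite [sx o_i sy] in T^c(E[1]); signs
    appear when [sy] is moved past the leaves to its left, and when leaves are
    permuted. *)
Inductive qR Y : forall V n, seq (R * tree Y V n) -> Prop :=
| qR_iota_iota U V W n n' m (hUV : U `<` V) (hVW : V `<` W)
    (e1 : n' = n - 1) (e2 : m = n' - 1) (x : Y U n) :
    qR [:: (1, Iota hVW e2 (Iota hUV e1 (Leaf x)))]
| qR_mu1_mu2 U V W UV VW Z i j k ij jk m
    (hUV : U `&` V = set0) (hVW : V `&` W = set0)
    (hUVW : UV `&` W = set0) (hUVW' : U `&` VW = set0)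
    (eUV : UV = U `|` V :> set M) (eVW : VW = V `|` W :> set M)
    (eT : Z = UV `|` W :> set M) (eT' : Z = U `|` VW :> set M)
    (e1 : ij = i + j - 1) (e2 : m = ij + k - 1)
    (e3 : jk = j + k - 1) (e4 : m = i + jk - 1)
    (x : Y U i) (y : Y V j) (z : Y W k) :
    qR [:: (1, Mu hUVW eT e2 (Mu hUV eUV e1 (Leaf x) (Leaf y)) (Leaf z));
           (- sg R i, Mu hUVW' eT' e4 (Leaf x) (Mu hVW eVW e3 (Leaf y) (Leaf z)))]
| qR_mu1_mu1 U V W UV UW Z i j k ij ik m
    (hUV : U `&` V = set0) (hUW : U `&` W = set0)
    (hUVW : UV `&` W = set0) (hUWV : UW `&` V = set0)
    (eUV : UV = U `|` V :> set M) (eUW : UW = U `|` W :> set M)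
    (eT : Z = UV `|` W :> set M) (eT' : Z = UW `|` V :> set M)
    (e1 : ij = i + j - 1) (e2 : m = ij + k - 1)
    (e3 : ik = i + k - 1) (e4 : m = ik + j - 1)
    (x : Y U i) (y : Y V j) (z : Y W k) :
    qR [:: (1, Mu hUVW eT e2 (Mu hUV eUV e1 (Leaf x) (Leaf y)) (Leaf z));
           (- sg R (j * k),
            Mu hUWV eT' e4 (Mu hUW eUW e3 (Leaf x) (Leaf z)) (Leaf y))]
| qR_mu1_iota U V W UW VW i j i' ij m
    (hUV : U `<` V) (hVW : V `&` W = set0) (hUW : U `&` W = set0)
    (hUWVW : UW `<` VW) (eUW : UW = U `|` W :> set M)
    (eVW : VW = V `|` W :> set M)
    (e1 : i' = i - 1) (e2 : m = i' + j - 1)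
    (e3 : ij = i + j - 1) (e4 : m = ij - 1)
    (x : Y U i) (y : Y W j) :
    qR [:: (1, Mu hVW eVW e2 (Iota hUV e1 (Leaf x)) (Leaf y));
           (- 1, Iota hUWVW e4 (Mu hUW eUW e3 (Leaf x) (Leaf y)))]
| qR_mu2_iota U V W UW UV i j j' ij m
    (hWV : W `<` V) (hUV : U `&` V = set0) (hUW : U `&` W = set0)
    (hUWUV : UW `<` UV) (eUW : UW = U `|` W :> set M)
    (eUV : UV = U `|` V :> set M)
    (e1 : j' = j - 1) (e2 : m = i + j' - 1)
    (e3 : ij = i + j - 1) (e4 : m = ij - 1)
    (x : Y U i) (y : Y W j) :
    qR [:: (sg R i, Mu hUV eUV e2 (Leaf x) (Iota hWV e1 (Leaf y)));
           (- 1, Iota hUWUV e4 (Mu hUW eUW e3 (Leaf x) (Leaf y)))].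

Inductive quotrel Y V n (r : seq (R * tree Y V n)) : Prop :=
| quot_tree of treerel r
| quot_weight t of weight t <> 2%N & r = [:: (1, t)]
| quot_qR of qR r.

(** T^c(E[1])^(2) / qR[2], applied to Y. *)
Definition Qc Y : coll R M := fun V n => pmod (@quotrel Y V n).

Lemma toQ_compat Y V n :
  compat (@treerel Y V n) (fun t => pgen t : Qc Y V n).
Proof. by move=> r hr; apply/pgen_compat/quot_tree. Qed.

Definition toQ Y : hom0 (Tc Y) (Qc Y) := fun V n => plin (@toQ_compat Y V n).
Arguments toQ {Y} V n.

(** T^c(E[1])(X) -> (T^c(E[1])^(2) / qR[2])(T^c(E[1])(X)): the two-vertex
    pieces at the root, modulo the corelations. *)
Definition rootQ X : hom0 (Tc X) (Qc (Tc X)) :=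
  fun V n => toQ V n \o Delta V n.
Arguments rootQ {X} V n.

Definition sumc X Y : coll R M := fun V n => (X V n * Y V n)%type : lmodType R.

Definition inlc X Y V n (x : X V n) : sumc X Y V n := (x, 0).
Definition inrc X Y V n (y : Y V n) : sumc X Y V n := (0, y).

Lemma inlc_linear X Y V n : linear (@inlc X Y V n).
Proof. by move=> a x y; congr (_, _); rewrite /= scaler0 addr0. Qed.

Lemma inrc_linear X Y V n : linear (@inrc X Y V n).
Proof. by move=> a x y; congr (_, _); rewrite /= scaler0 addr0. Qed.

HB.instance Definition _ X Y V n :=
  GRing.isLinear.Build R (X V n) (sumc X Y V n) *:%R (@inlc X Y V n)
    (@inlc_linear X Y V n).
HB.instance Definition _ X Y V n :=
  GRing.isLinear.Build R (Y V n) (sumc X Y V n) *:%R (@inrc X Y V n)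
    (@inrc_linear X Y V n).

Definition inl0 X Y : hom0 X (sumc X Y) := fun V n => @inlc X Y V n.
Definition inr_rootQ X : hom0 (Tc X) (sumc (Tc X) (Qc (Tc X))) :=
  fun V n => @inrc (Tc X) (Qc (Tc X)) V n \o rootQ V n.
Arguments inr_rootQ {X} V n.
Arguments inl0 {X Y} V n.

(** All ways of projecting one two-vertex piece of a tree to
    T^c(E[1])^(2) / qR[2], the remaining vertices being kept. *)
Definition corelmap X : hom0 (Tc X) (Tc (sumc (Tc X) (Qc (Tc X)))) :=
  fun V n => infmap inl0 (homd_of_hom0 inr_rootQ) V (esym (addr0 n)) \o Delta V n.
Arguments corelmap {X} V n.

(** The cofree coalgebra on X over the Koszul dual cooperad Disj_M^!, the
    sub-cooperad of T^c(E[1]) with corelations qR[2]: the elements all of whose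
    two-vertex pieces lie in qR[2]. *)
Definition Disj_koszul X : coll R M := fun V n => kernel (corelmap (X := X) V n).

Definition incl X : hom0 (Disj_koszul X) (Tc X) := fun V n => @kval _ _ _ _.
Arguments incl {X} V n.


Lemma homd_of_hom0E X Y (f : hom0 X Y) V n (e : n = n + 0) :
  homd_of_hom0 f V e = f V n.
Proof.
by rewrite /homd_of_hom0 (eq_irrelevance (esym (etrans e (addr0 n))) erefl).
Qed.

Lemma corelmap_leaf X V n (x : X V n) : corelmap V n (tleaf x) = 0.
Proof.
have toQ0 : toQ V n (tleaf (tleaf x)) = 0 :> Qc (Tc X) V n.
  rewrite [LHS]plinE.
  have := @pgen_compat _ _ (@quotrel (Tc X) V n) [:: (1, Leaf (tleaf x))].
  by rewrite /comb big_seq1 scale1r; apply; apply: quot_weight erefl.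
have DE : Delta V n (tleaf x) = tleaf (tleaf x) by exact: plinE.
rewrite /corelmap /comp /= DE [LHS]plinE /= homd_of_hom0E /= DE toQ0.
rewrite (_ : inrc _ 0 = 0); first exact: linear0.
exact: linear0.
Qed.

Lemma tleaf_corel X V n (x : X V n) :
  tleaf x \in in_kernel (corelmap V n).
Proof. by apply/eqP; exact: corelmap_leaf. Qed.

(** The inclusion of X, given by the identity cooperations. *)
Definition kleaf X V n (x : X V n) : Disj_koszul X V n := Kernel (tleaf_corel x).

(** The projection onto the cogenerators. *)
Definition epst X V n (t : tree X V n) : X V n :=
  match t in tree _ V n return X V n with Leaf _ _ x => x | _ => 0 end.

Lemma epst_compat X V n : compat (@treerel X V n) (@epst X V n).
Proof.
move=> r; case=> {V n r}.
- move=> V n a x y; rewrite comb3 scale1r !scaleNr scale1r /=.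
  by rewrite -opprD subrr.
- by move=> *; rewrite comb2 /= !scaler0 addr0.
- by move=> *; rewrite comb_smap /comb big1 // => p _; rewrite scaler0.
- by move=> *; rewrite comb_smap /comb big1 // => p _; rewrite scaler0.
- by move=> *; rewrite comb_smap /comb big1 // => p _; rewrite scaler0.
Qed.

Definition eps X : hom0 (Tc X) X := fun V n => plin (@epst_compat X V n).
Arguments eps {X} V n.

Lemma subset_proper_trans (A B C : set M) : A `<` B -> B `<` C -> A `<` C.
Proof.
move=> [AB nBA] [BC nCB]; split; first exact: subset_trans BC.
by move=> CA; apply: nCB; apply: subset_trans AB.
Qed.

Definition contract X U n (t : tree X U n) :
    forall V m, U `<` V -> m = n -> Tc X V m :=
  match t in tree _ U n return forall V m, U `<` V -> m = n -> Tc X V m with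
  | Iota _ _ _ _ h0 e0 t0 => fun V m h e =>
      pgen (Iota (subset_proper_trans h0 h) (etrans e e0) t0)
  | _ => fun _ _ _ _ => 0
  end.

Lemma deg_contract (n m m' : int) : m = n - 1 -> m' = m + 1 -> m' = n.
Proof. by move=> -> ->; rewrite subrK. Qed.

(** The differential of Disj_M^!, induced by [phi : qR -> E].  On composites of two
    generators, [phi] sends [iota_V^W o iota_U^V] to [iota_U^W] and the other
    elements of [qR] to 0, so that the coderivation contracts the consecutive
    pairs of [iota]'s one at a time. *)
Fixpoint dphit X V n (t : tree X V n) : forall m, m = n + 1 -> Tc X V m :=
  match t in tree _ V n return forall m, m = n + 1 -> Tc X V m with
  | Leaf _ _ _ => fun _ _ => 0
  | Iota _ _ _ _ h e0 t => fun m e =>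
      contract t h (deg_contract e0 e)
      + sg R 1 *: TIota h (deg_iota e0 e) (dphit t erefl)
  | Mu _ _ _ n1 _ _ hd hu e0 t1 t2 => fun m e =>
      sg R 1 *: (TMu hd hu (deg_mul e0 e) (dphit t1 erefl) (pgen t2)
       + sg R (1 * n1) *:
           TMu hd hu (deg_mur e0 e) (pgen t1) (dphit t2 erefl))
  end.

Lemma contract_compat X U n V m (h : U `<` V) (e : m = n) :
  compat (@treerel X U n) (fun t => contract t h e).
Proof.
move=> r hr; case: hr V m h e => {U n r}.
- by move=> U n a x y V m h e; rewrite comb3 /= !scaler0 !addr0.
- by move=> *; rewrite comb2 /= !scaler0 addr0.
- move=> U V n m h e r hr V' m' h' e'.
  rewrite comb_smap.
  exact: (pgen_iota_compat (subset_proper_trans h h') (etrans e' e) hr).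
- by move=> *; rewrite comb_smap /comb big1 // => p _; rewrite scaler0.
- by move=> *; rewrite comb_smap /comb big1 // => p _; rewrite scaler0.
Qed.

Lemma dphit_compat X V n m (e : m = n + 1) :
  compat (@treerel X V n) (fun t => dphit t e).
Proof.
move=> r hr; elim: hr m e => {V n r}.
- by move=> V n a x y m e; rewrite comb3 /= !scaler0 !addr0.
- move=> U V W n1 n2 m hd hd' hu hu' e e' t1 t2 m' e''.
  rewrite comb2 scale1r /=; move: (sg R 1) => s; rewrite scaleNr.
  rewrite (TMu_flip hd hd' hu hu' _ (deg_mur e' e'')).
  rewrite (TMu_flip hd hd' hu hu' _ (deg_mul e' e'')).
  rewrite [sg R (1 * n1) *: _]scalerA sg_flipr sg_flipl -scalerA -scalerDr.
  by rewrite [_ + TMu _ _ _ _ _]addrC !scalerA [s * _]mulrC subrr.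
- move=> U V n m h e r hr IH m' e'; rewrite comb_smap combD.
  rewrite (contract_compat h (deg_contract e e')) // add0r.
  rewrite (combZ _ (fun t => TIota h _ (dphit t erefl))).
  by rewrite (comb_linear (TIota h (deg_iota e e'))) IH linear0 scaler0.
- move=> U V W n1 n2 m hd hu e r t2 hr IH m' e'; rewrite comb_smap.
  rewrite (combZ _ (fun t => TMu hd hu (deg_mul e e') _ _ + _)) combD combZ.
  rewrite (comb_TMul _ _ _ _ (fun t => dphit t erefl)) IH.
  by rewrite (comb_TMul _ _ _ _ pgen) pgen_compat // !TMu0l scaler0 addr0 scaler0.
- move=> U V W n1 n2 m hd hu e t1 r hr IH m' e'; rewrite comb_smap.
  rewrite (combZ _ (fun t => TMu hd hu (deg_mul e e') _ _ + _)) combD combZ.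
  rewrite (comb_TMur _ _ _ _ (fun t => dphit t erefl)) IH.
  by rewrite (comb_TMur _ _ _ _ pgen) pgen_compat // !linear0 addr0 linear0.
Qed.

Definition dphi X : homd 1 (Tc X) (Tc X) :=
  fun V n m e => plin (@dphit_compat X V n m e).
Arguments dphi {X} V {n m} e.

End Cofree.

Arguments TIota {R M X U V n m} h e.
Arguments Delta {R M X} V n.
Arguments Tmap {R M X Y} f V n.
Arguments infmap {R M X Y k} f0 f1 V {n m} e.
Arguments toQ {R M Y} V n.
Arguments rootQ {R M X} V n.
Arguments corelmap {R M X} V n.
Arguments incl {R M X} V n.
Arguments eps {R M X} V n.
Arguments dphi {R M X} V {n m} e.

(** * Cochain complexes and deformation retractions *)

Record complex (R : realType) := Complex {
  cobj :> int -> lmodType R;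
  cdiff : forall n m, m = n + 1 -> {linear cobj n -> cobj m};
  cdiffK : forall n m p (e : m = n + 1) (e' : p = m + 1) x,
    cdiff e' (cdiff e x) = 0
}.

Record retraction (R : realType) (A B : complex R) := Retraction {
  ret_i : forall n, {linear B n -> A n};
  ret_p : forall n, {linear A n -> B n};
  ret_h : forall n m, m = n - 1 -> {linear A n -> A m};
  ret_id : forall n m (e : m = n + 1) x,
    ret_i m (cdiff B e x) = cdiff A e (ret_i n x);
  ret_pd : forall n m (e : m = n + 1) x,
    ret_p m (cdiff A e x) = cdiff B e (ret_p n x);
  ret_pi : forall n x, ret_p n (ret_i n x) = x;
  ret_ip : forall n m m' (e1 : m = n - 1) (e2 : n = m + 1)
      (e3 : m' = n + 1) (e4 : n = m' - 1) (x : A n),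
    x - ret_i n (ret_p n x) = cdiff A e2 (ret_h e1 x) + ret_h e4 (cdiff A e3 x)
}.

Section Algebras.
Variables (R : realType) (M : topologicalType).
Implicit Types (X Y : coll R M) (A B : opens M -> complex R).
Implicit Types (U V W : opens M) (n m : int).

Definition underlying A : coll R M := fun U n => A U n.

(** * Prefactorization algebras *)

Record elt A := Elt { ecol : opens M; edeg : int; eval : A ecol edeg }.

Definition totdeg A (s : seq (elt A)) : int := \sum_(x <- s) edeg x.

(** The operation m^V_(U_1,...,U_k) is defined on a list of homogeneous elements
    of the A(U_i) when k >= 1 and the U_i are pairwise disjoint subsets of V. *)
Definition operable A V n (s : seq (elt A)) : Prop :=
  [/\ s <> [::],
      all (fun x => `[< ecol x `<=` V >]) s,
      pairwise (fun x y => `[< ecol x `&` ecol y = set0 >]) s &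
      n = totdeg s].

Definition delt A (x : elt A) : elt A :=
  Elt (cdiff (A (ecol x)) (erefl (edeg x + 1)) (eval x)).

(** [\sum_i (-1)^(|x_1|+...+|x_(i-1)|) f(x_1, ..., d x_i, ..., x_k)] *)
Fixpoint leibniz A (Y : lmodType R) (f : seq (elt A) -> Y)
    (s1 s2 : seq (elt A)) : Y :=
  if s2 is x :: s2' then
    sg R (totdeg s1) *: f (s1 ++ delt x :: s2') + leibniz f (rcons s1 x) s2'
  else 0.

(** Algebras over Disj_M.  The values of [pf_m V n s] are only meaningful when
    [operable V n s] holds. *)
Record prefact_alg := PrefactAlg {
  pf_cpx :> opens M -> complex R;
  pf_m : forall V n, seq (elt pf_cpx) -> pf_cpx V n;
  pf_linear : forall V n U k (s1 s2 : seq (elt pf_cpx)) a (x y : pf_cpx U k),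
    operable V n (s1 ++ Elt x :: s2) ->
    pf_m V n (s1 ++ Elt (a *: x + y) :: s2) =
    a *: pf_m V n (s1 ++ Elt x :: s2) + pf_m V n (s1 ++ Elt y :: s2);
  pf_cochain : forall V n m (e : m = n + 1) s, operable V n s ->
    cdiff (pf_cpx V) e (pf_m V n s) = leibniz (pf_m V m) [::] s;
  pf_sym : forall V n s1 x y s2, operable V n (s1 ++ x :: y :: s2) ->
    pf_m V n (s1 ++ x :: y :: s2) =
    sg R (edeg x * edeg y) *: pf_m V n (s1 ++ y :: x :: s2);
  pf_unit : forall V n (x : pf_cpx V n), pf_m V n [:: Elt x] = x;
  pf_comp : forall V n U k s1 s s2, operable U k s ->
    operable V n (s1 ++ Elt (pf_m U k s) :: s2) ->
    pf_m V n (s1 ++ Elt (pf_m U k s) :: s2) = pf_m V n (s1 ++ s ++ s2)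
}.

(** * hoDisj_M-algebras and infinity-morphisms *)

(** [y] is the image of [x] under the comultiplication of the cofree coalgebra;
    [Tmap incl] is injective because R is a field, so that [y] is unique. *)
Definition coproduct X V n (x : Disj_koszul X V n)
    (y : Disj_koszul (Disj_koszul X) V n) : Prop :=
  Tmap incl V n (incl V n y) = Delta V n (incl V n x).

(** A structure of algebra over the cobar construction Omega(Disj_M^!) on the
    complexes A(U) is a codifferential on the cofree coalgebra Disj_M^!(A) that
    extends the differentials of the A(U).  [ho_coder] is the coderivation
    property for the dg cooperad Disj_M^!, so that [ho_D] includes the part
    coming from the differential [dphi] of Disj_M^!. *)
Record hoDisj_alg A := HoDisjAlg {
  ho_D : homd 1 (Disj_koszul (underlying A)) (Disj_koszul (underlying A));
  ho_DD : forall V n m p (e : m = n + 1) (e' : p = m + 1) x,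
    ho_D V e' (ho_D V e x) = 0;
  ho_coder : forall V n m (e : m = n + 1) x, exists2 y, coproduct x y &
    Delta V m (incl V m (ho_D V e x)) =
    Tmap incl V m (dphi V e (incl V n y)
                   + infmap (fun _ _ => idfun) ho_D V e (incl V n y));
  ho_lin : forall V n m (e : m = n + 1) (x : A V n),
    ho_D V e (kleaf (x : underlying A V n)) =
    kleaf (cdiff (A V) e x : underlying A V m)
}.

Record infty_morphism B A (DB : hoDisj_alg B) (DA : hoDisj_alg A) := InftyMorphism {
  inf_F : hom0 (Disj_koszul (underlying B)) (Disj_koszul (underlying A));
  inf_D : forall V n m (e : m = n + 1) x,
    inf_F V m (ho_D DB V e x) = ho_D DA V e (inf_F V n x);
  inf_coprod : forall V n x, exists2 y, coproduct x y &
    exists2 z, coproduct (inf_F V n x) z &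
      incl V n z = Tmap inf_F V n (incl V n y)
}.


(** The infinity-morphism [F] extends [f] if its components associated with the
    identity cooperations are [f]. *)
Definition inf_extends B A (DB : hoDisj_alg B) (DA : hoDisj_alg A)
    (F : infty_morphism DB DA) (f : forall V n, {linear B V n -> A V n}) : Prop :=
  forall V n (b : B V n),
    eps V n (incl V n (inf_F F V n (kleaf (b : underlying B V n)))) = f V n b.

Definition leaf_elt A V n (t : tree (underlying A) V n) : option (elt A) :=
  if t is Leaf _ _ x then Some (Elt (x : A _ _)) else None.

(** The differential of A on [A], the operations [iota_U^V] and [mu_(U,V)] on
    trees with one vertex, and 0 on larger trees: the composite of
    T^c(E[1]) -> E[1] -> Disj_M with the action of Disj_M on A. *)
Definition twistt (A : prefact_alg) V n m (e : m = n + 1)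
    (t : tree (underlying A) V n) : underlying A V m :=
  match t in tree _ V n return m = n + 1 -> A V m with
  | Leaf V _ x => fun e => cdiff (A V) e x
  | Iota _ V _ _ _ _ t1 => fun _ =>
      if leaf_elt t1 is Some x then pf_m V m [:: x] else 0
  | Mu _ _ W _ _ _ _ _ _ t1 t2 => fun _ =>
      match leaf_elt t1, leaf_elt t2 with
      | Some x, Some y => pf_m W m [:: x; y]
      | _, _ => 0
      end
  end e.

Lemma leaf_eltP A V n (t : tree (underlying A) V n) x :
  leaf_elt t = Some x -> ecol x = V /\ edeg x = n.
Proof. by case: t => // {}V {}n y [<-]. Qed.

Lemma operable1 A U V n m (h : U `<` V) (e : m = n - 1) p (e' : p = m + 1)
    (x : elt A) : ecol x = U /\ edeg x = n -> operable V p [:: x].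
Proof.
move=> [xU xn]; split=> //=.
- by rewrite andbT xU; apply/asboolP; case: h.
- by rewrite /totdeg big_seq1 xn e' e subrK.
Qed.

Lemma operable2 A U V W n1 n2 m (hd : U `&` V = set0)
    (hu : W = U `|` V :> set M) (e : m = n1 + n2 - 1) p (e' : p = m + 1)
    (x y : elt A) :
  ecol x = U /\ edeg x = n1 -> ecol y = V /\ edeg y = n2 ->
  operable W p [:: x; y].
Proof.
move=> [xU xn] [yV yn]; split=> //=.
- by rewrite andbT xU yV hu; apply/andP; split; apply/asboolP => z; [left|right].
- by rewrite !andbT xU yV; apply/asboolP.
- by rewrite /totdeg big_cons big_seq1 xn yn e' e subrK.
Qed.

Lemma leaf_compat (A : prefact_alg) U V n m (s1 s2 : seq (elt A)) :
  (forall x : A U n, operable V m (s1 ++ Elt x :: s2)) ->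
  compat (@treerel R M (underlying A) U n)
    (fun t => if leaf_elt t is Some x then pf_m V m (s1 ++ x :: s2) else 0).
Proof.
move=> H r hr; case: hr H => {U n r}.
- move=> U n a x y H; rewrite comb3 /= scale1r !scaleNr scale1r.
  by rewrite pf_linear // -opprD subrr.
- by move=> *; rewrite comb2 /= !scaler0 addr0.
- by move=> *; rewrite comb_smap /comb big1 // => p _; rewrite scaler0.
- by move=> *; rewrite comb_smap /comb big1 // => p _; rewrite scaler0.
- by move=> *; rewrite comb_smap /comb big1 // => p _; rewrite scaler0.
Qed.

Lemma twistt_compat (A : prefact_alg) V n m (e : m = n + 1) :
  compat (@treerel R M (underlying A) V n) (twistt e).
Proof.
move=> r hr; case: hr m e => {V n r}.
- move=> V n a x y m e; rewrite comb3 scale1r !scaleNr scale1r /= linearP.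
  by rewrite -opprD subrr.
- move=> U V W n1 n2 m hd hd' hu hu' e e' t1 t2 p e''.
  rewrite comb2 scale1r /=.
  case E1: (leaf_elt t1) => [x|]; case E2: (leaf_elt t2) => [y|];
    rewrite ?scaler0 ?addr0 //.
  have [hx hy] := (leaf_eltP E1, leaf_eltP E2).
  have op := operable2 hd hu e e'' hx hy.
  rewrite scaleNr (@pf_sym A W p [::] x y [::] op) /=.
  by case: hx hy => _ -> [_ ->]; rewrite subrr.
- move=> U V n m h e r hr p e'; rewrite comb_smap.
  apply: (@leaf_compat A U V n p [::] [::]) => // x.
  exact: (operable1 h e e').
- move=> U V W n1 n2 m hd hu e r t2 hr p e'; rewrite comb_smap.
  case E2: (leaf_elt t2) => [y|]; last first.
    rewrite /comb big1 // => q _ /=; rewrite E2.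
    by case: leaf_elt => [?|]; rewrite scaler0.
  rewrite -[RHS](@leaf_compat A U W n1 p [::] [:: y] _ r hr).
    by apply: eq_bigr => q _ /=; rewrite E2.
  by move=> x; apply: (operable2 hd hu e e') => //; exact: leaf_eltP E2.
- move=> U V W n1 n2 m hd hu e t1 r hr p e'; rewrite comb_smap.
  case E1: (leaf_elt t1) => [x|]; last first.
    by rewrite /comb big1 // => q _ /=; rewrite E1 scaler0.
  rewrite -[RHS](@leaf_compat A V W n2 p [:: x] [::] _ r hr).
    by apply: eq_bigr => q _ /=; rewrite E1.
  by move=> y; apply: (operable2 hd hu e e') => //; exact: leaf_eltP E1.
Qed.

Definition twist (A : prefact_alg) : homd 1 (Tc (underlying A)) (underlying A) :=
  fun V n m e => plin (@twistt_compat A V n m e).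

(** The hoDisj_M-algebra structure of a prefactorization algebra, obtained by
    pulling back along Omega(Disj_M^!) -> Disj_M.  A codifferential is determined
    by its projection onto the cogenerators. *)
Definition pf_induced (A : prefact_alg) (DA : hoDisj_alg A) : Prop :=
  forall V n m (e : m = n + 1) x,
    eps V m (incl V m (ho_D DA V e x)) = twist A V e (incl V n x).

End Algebras.

(** Topological manifolds of dimension d. *)
Definition manifold (R : realType) (d : nat) (M : topologicalType) : Prop :=
  [/\ hausdorff_space M, @second_countable M &
    forall x : M, exists (U : set M) (f : M -> 'rV[R]_d) (g : 'rV[R]_d -> M),
      [/\ open U, U x, open (f @` U), {within U, continuous f} &
          {within f @` U, continuous g} /\ {in U, cancel f g}]].

(* Main.v *)
(** Write T for the comonad [Tc] of trees and C for the sub-comonad [Disj_koszul].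
    Everything is done on T and then restricted to C.  A map [d : T(X) -> X] of
    degree 1 has a unique extension [D = coder d] to a coderivation of T(X), and
    [D^2] is the extension of [d D]; so it preserves C and squares to zero there as
    soon as [d D] vanishes on C, provided that the differential [dphi] of T
    preserves C.

    For an algebra over the presentation of Disj_M, the action [theta] of the
    one-vertex trees satisfies [curv = theta D = 0] on C: this is the
    Maurer-Cartan equation, and it amounts to the relations of Disj_M.  Comparing
    [D D^2] with [D^2 D] gives the Bianchi identity, hence [curv o dphi = 0] on C.
    For a truncated free algebra [curv] detects the relevant part of T^(2)/qR,
    which shows that [dphi] preserves C.

    The homotopy transfer is given by the usual sums over trees, since the
    twisting morphism vanishes on the trees with at least two vertices.  If
    [trans] is the component of the infinity-morphism and [root_act] is the action
    of the root vertex on the values of [trans], then [trans = i - h root_act] and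
    the transferred structure is [d + p root_act].  The failure of [root_act] to
    commute with the differentials is obtained by applying [curv] to one two-vertex
    piece of the tree, so that it vanishes on C; the retraction identities then
    yield both the codifferential and the infinity-morphism.

    That C is a sub-comonad uses that R is a field of characteristic 0: kernels
    split, and the number of leaves in a complement is the eigenvalue of a
    derivation of T(X). *)
From HB Require Import structures.
Require Import Defs.
From mathcomp Require Import all_boot all_order all_algebra.
From mathcomp Require Import all_classical all_reals all_analysis.
From mathcomp Require Import ring.
Set Implicit Arguments.
Unset Strict Implicit.
Unset Printing Implicit Defensive.
Import Order.TTheory GRing.Theory Num.Theory.
Local Open Scope classical_set_scope.
Local Open Scope ring_scope.

(** * The comonad of trees *)

(** The Koszul dual C is the kernel of one map, [corelmap], which is a sum over all two-vertex
    pieces of a tree. The first obstacle lies there: the arguments need each upper piece of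
    [Delta z] to be in C, while [corelmap z = 0] only controls a sum over pieces. [inf0_corel],
    generalized inverses and the leaf-counting operator pass from the sum to the single leaves.

    The second obstacle is that stability of C under [dphi] concerns trees with three vertices,
    where a direct check would run through all their shapes. The algebra [Palg] replaces this check.
    Its products of three elements vanish, so its curvature only sees the part of the quotient by
    the corelations spanned by trees with an [iota]; this suffices, since every tree in the image of
    [dphi] contains an [iota].

    Maps are compared pointwise, and degrees are separate variables tied by equations, because
    linear maps into equal but not convertible degrees have different types. The structure on A is
    itself obtained by transfer, along the identity retraction, so that A and B are two instances of
    one construction. *)

Section Comonad.
Variables (R : realType) (M : topologicalType).
Implicit Types (X Y Z : coll R M) (U V W : opens M) (n m k : int).

(** Leaves generate all classes under the vertex operations and linear combinations. Identities on
    [Tc] are thus proved on classes, without tree representatives and without checking the relations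
    again. *)
Lemma Tc_ind X (P : forall V n, Tc X V n -> Prop) :
  (forall V n, P V n 0) ->
  (forall V n a (x y : Tc X V n), P V n x -> P V n y -> P V n (a *: x + y)) ->
  (forall V n (x : X V n), P V n (tleaf x)) ->
  (forall U V n m (h : U `<` V) (e : m = n - 1) z,
     P U n z -> P V m (TIota h e z)) ->
  (forall U V W n1 n2 m (hd : U `&` V = set0) (hu : W = U `|` V :> set M)
     (e : m = n1 + n2 - 1) z w, P U n1 z -> P V n2 w ->
     P W m (TMu hd hu e z w)) ->
  forall V n z, P V n z.
Proof.
move=> P0 PD PL PI PM V n z; rewrite -[z]preprK pclass_comb.
elim: (prepr z) => [|[a t] s IH]; first by rewrite /comb big_nil.
rewrite /comb big_cons; apply: PD => //= {IH z s a}.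
elim: t => {V n} [V n x|U V n m h e t IH|U V W n1 n2 m hd hu e t1 IH1 t2 IH2].
- exact: PL.
- by have := PI _ _ _ _ h e _ IH; rewrite [TIota _ _ _]plinE.
- by rewrite -TMu_gen; apply: PM.
Qed.

Lemma TMuDl X U V W n1 n2 m (hd : U `&` V = set0) (hu : W = U `|` V :> set M)
    (e : m = n1 + n2 - 1) (x x' : Tc X U n1) (y : Tc X V n2) :
  TMu hd hu e (x + x') y = TMu hd hu e x y + TMu hd hu e x' y.
Proof. by have := TMu_linearl hd hu e y 1 x x'; rewrite !scale1r. Qed.

Lemma TMuZl X U V W n1 n2 m (hd : U `&` V = set0) (hu : W = U `|` V :> set M)
    (e : m = n1 + n2 - 1) a (x : Tc X U n1) (y : Tc X V n2) :
  TMu hd hu e (a *: x) y = a *: TMu hd hu e x y.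
Proof.
by have := TMu_linearl hd hu e y a x 0; rewrite !addr0 TMu0l addr0.
Qed.

Lemma TMuDr X U V W n1 n2 m (hd : U `&` V = set0) (hu : W = U `|` V :> set M)
    (e : m = n1 + n2 - 1) (x : Tc X U n1) (y y' : Tc X V n2) :
  TMu hd hu e x (y + y') = TMu hd hu e x y + TMu hd hu e x y'.
Proof. exact: linearD. Qed.

Lemma TMuZr X U V W n1 n2 m (hd : U `&` V = set0) (hu : W = U `|` V :> set M)
    (e : m = n1 + n2 - 1) a (x : Tc X U n1) (y : Tc X V n2) :
  TMu hd hu e x (a *: y) = a *: TMu hd hu e x y.
Proof. exact: linearZ. Qed.

(** Both sides are bilinear in the two branches, so agreement on pairs of trees suffices; this is
    the source of the formulas for [TMu] below. *)
Lemma plin_TMu X (Y : lmodType R) U V W n1 n2 m (hd : U `&` V = set0)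
    (hu : W = U `|` V :> set M) (e : m = n1 + n2 - 1)
    (f : {linear Tc X W m -> Y}) (g : Tc X U n1 -> Tc X V n2 -> Y) :
  (forall y, linear (g^~ y)) -> (forall x, linear (g x)) ->
  (forall t1 t2, f (pgen (Mu hd hu e t1 t2)) = g (pgen t1) (pgen t2)) ->
  forall z w, f (TMu hd hu e z w) = g z w.
Proof.
move=> gl gr H z w.
rewrite -[z]preprK -[w]preprK !pclass_comb TMu_combl linear_sum.
pose L y : {linear Tc X U n1 -> Y} :=
  HB.pack (g^~ y) (GRing.isLinear.Build R _ _ _ (g^~ y) (gl y)).
pose Rr x : {linear Tc X V n2 -> Y} :=
  HB.pack (g x) (GRing.isLinear.Build R _ _ _ (g x) (gr x)).
rewrite -[RHS]/(L _ _) -(comb_linear (L _)); apply: eq_bigr => p _.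
rewrite linearZ /=; congr (_ *: _).
rewrite -[RHS]/(Rr _ _) -(comb_linear (Rr _)) TMu_combr linear_sum.
by apply: eq_bigr => q _; rewrite linearZ /= TMu_gen H.
Qed.

Lemma lin_ext (S : Type) (rel : seq (R * S) -> Prop) (Y : lmodType R)
    (f g : {linear pmod rel -> Y}) :
  (forall t, f (pgen t) = g (pgen t)) -> f =1 g.
Proof.
move=> H z; rewrite -[z]preprK pclass_comb -!comb_linear.
by apply: eq_bigr => p _ /=; rewrite H.
Qed.

Lemma plin_TIota X (Y : lmodType R) U V n m (h : U `<` V) (e : m = n - 1)
    (f : {linear Tc X V m -> Y}) (g : {linear Tc X U n -> Y}) :
  (forall t, f (pgen (Iota h e t)) = g (pgen t)) ->
  forall z, f (TIota h e z) = g z.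
Proof.
move=> H; apply: (lin_ext (f := f \o TIota h e)) => t /=.
by rewrite [TIota _ _ _]plinE H.
Qed.

Lemma TIota_gen X U V n m (h : U `<` V) (e : m = n - 1) (t : tree X U n) :
  TIota h e (pgen t) = pgen (Iota h e t).
Proof. exact: plinE. Qed.

Lemma Delta_gen X V n (t : tree X V n) : Delta V n (pgen t) = cutt t.
Proof. exact: plinE. Qed.

Lemma Tmap_gen X Y (f : hom0 X Y) V n (t : tree X V n) :
  Tmap f V n (pgen t) = tmapt f t.
Proof. exact: plinE. Qed.

Lemma infmap_gen X Y k (a : hom0 X Y) (b : homd k X Y) V n m (e : m = n + k)
    (t : tree X V n) :
  infmap a b V e (pgen t) = infmapt a b t e.
Proof. exact: plinE. Qed.

Lemma eps_gen X V n (t : tree X V n) : eps V n (pgen t) = epst t.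
Proof. exact: plinE. Qed.

Lemma dphi_gen X V n m (e : m = n + 1) (t : tree X V n) :
  dphi V e (pgen t) = dphit t e.
Proof. exact: plinE. Qed.

Definition genE := (TIota_gen, TMu_gen, Delta_gen, Tmap_gen, infmap_gen, eps_gen, dphi_gen).

Lemma tleafD X V n (x y : X V n) : tleaf (x + y) = tleaf x + tleaf y.
Proof. exact: linearD. Qed.

Lemma tleafZ X V n a (x : X V n) : tleaf (a *: x) = a *: tleaf x.
Proof. exact: linearZ. Qed.

Lemma tleaf0 X V n : tleaf (0 : X V n) = 0.
Proof. exact: linear0. Qed.

Lemma TIotaD X U V n m (h : U `<` V) (e : m = n - 1) (x y : Tc X U n) :
  TIota h e (x + y) = TIota h e x + TIota h e y.
Proof. exact: linearD. Qed.

Lemma TIotaZ X U V n m (h : U `<` V) (e : m = n - 1) a (x : Tc X U n) :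
  TIota h e (a *: x) = a *: TIota h e x.
Proof. exact: linearZ. Qed.

Section Deltas.
Variable X : coll R M.

Lemma Delta_leaf V n (x : X V n) : Delta V n (tleaf x) = tleaf (tleaf x).
Proof. exact: plinE. Qed.

Lemma Delta_iota U V n m (h : U `<` V) (e : m = n - 1) (z : Tc X U n) :
  Delta V m (TIota h e z) = tleaf (TIota h e z) + TIota h e (Delta U n z).
Proof.
move: z; apply: (plin_TIota (f := Delta V m)
  (g := (@tleaf R M (Tc X) V m \o TIota h e) \+ (TIota h e \o Delta U n))) => t /=.
by rewrite !genE.
Qed.

Lemma Delta_mu U V W n1 n2 m (hd : U `&` V = set0) (hu : W = U `|` V :> set M)
    (e : m = n1 + n2 - 1) (z : Tc X U n1) (w : Tc X V n2) :
  Delta W m (TMu hd hu e z w)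
  = tleaf (TMu hd hu e z w) + TMu hd hu e (Delta U n1 z) (Delta V n2 w).
Proof.
move: z w; apply: (plin_TMu (f := Delta W m)
  (g := fun z w => tleaf (TMu hd hu e z w) + TMu hd hu e (Delta U n1 z) (Delta V n2 w))).
- move=> y a z w; rewrite linearP !TMuDl !TMuZl [X in X + _]linearP scalerDr.
  by rewrite addrACA.
- by move=> y a z w; rewrite !linearP scalerDr addrACA.
- by move=> t1 t2; rewrite TMu_gen !Delta_gen.
Qed.

End Deltas.

Section Tmaps.
Variables (X Y : coll R M) (f : hom0 X Y).

Lemma Tmap_leaf V n (x : X V n) : Tmap f V n (tleaf x) = tleaf (f V n x).
Proof. exact: plinE. Qed.

Lemma Tmap_iota U V n m (h : U `<` V) (e : m = n - 1) (z : Tc X U n) :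
  Tmap f V m (TIota h e z) = TIota h e (Tmap f U n z).
Proof.
move: z; apply: (plin_TIota (f := Tmap f V m) (g := TIota h e \o Tmap f U n)) => t.
by rewrite /= !genE.
Qed.

Lemma Tmap_mu U V W n1 n2 m (hd : U `&` V = set0) (hu : W = U `|` V :> set M)
    (e : m = n1 + n2 - 1) (z : Tc X U n1) (w : Tc X V n2) :
  Tmap f W m (TMu hd hu e z w) = TMu hd hu e (Tmap f U n1 z) (Tmap f V n2 w).
Proof.
move: z w; apply: (plin_TMu (f := Tmap f W m)
  (g := fun z w => TMu hd hu e (Tmap f U n1 z) (Tmap f V n2 w))).
- by move=> y a z w; rewrite linearP TMuDl TMuZl.
- by move=> y a z w; rewrite !linearP.
- by move=> t1 t2; rewrite !genE.
Qed.

End Tmaps.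

Section Infmaps.
Variables (X Y : coll R M) (k : int) (a : hom0 X Y) (b : homd k X Y).

Lemma inf_leaf V n m (e : m = n + k) (x : X V n) :
  infmap a b V e (tleaf x) = tleaf (b V e x).
Proof. exact: plinE. Qed.

(** The shifted degrees are free variables, so that the formula can be used with whichever degree
    proofs a goal requires. After substitution two such proofs agree, since [int] has decidable
    equality. *)
Lemma inf_iota U V n m n' m' (h : U `<` V) (e : m = n - 1) (e1 : m' = m + k)
    (e2 : n' = n + k) (e3 : m' = n' - 1) (z : Tc X U n) :
  infmap a b V e1 (TIota h e z) = sg R k *: TIota h e3 (infmap a b U e2 z).
Proof.
subst n'; move: z; apply: (plin_TIota (f := infmap a b V e1)
  (g := sg R k \*: (TIota h e3 \o infmap a b U erefl))) => t /=.
by rewrite !genE /=; congr (_ *: TIota h _ _); exact: eq_irrelevance.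
Qed.

Lemma inf_mu U V W n1 n2 m n1' n2' m' (hd : U `&` V = set0)
    (hu : W = U `|` V :> set M) (e : m = n1 + n2 - 1) (e0 : m' = m + k)
    (e1 : n1' = n1 + k) (e2 : n2' = n2 + k)
    (e3 : m' = n1' + n2 - 1) (e4 : m' = n1 + n2' - 1) (z : Tc X U n1) (w : Tc X V n2) :
  infmap a b W e0 (TMu hd hu e z w)
  = sg R k *: (TMu hd hu e3 (infmap a b U e1 z) (Tmap a V n2 w)
     + sg R (k * n1) *: TMu hd hu e4 (Tmap a U n1 z) (infmap a b V e2 w)).
Proof.
subst n1' n2'; move: z w; apply: (plin_TMu (f := infmap a b W e0)
  (g := fun z w => sg R k *: (TMu hd hu e3 (infmap a b U erefl z) (Tmap a V n2 w)
     + sg R (k * n1) *: TMu hd hu e4 (Tmap a U n1 z) (infmap a b V erefl w)))).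
- move=> y c z w; rewrite [infmap _ _ _ _ (_ + _)]linearP.
  rewrite [Tmap _ _ _ (_ + _)]linearP !(TMuDl, TMuZl).
  by rewrite !scalerDr !scalerA ?(mulrC c) ?mulrA ?(mulrAC _ c) addrACA.
- move=> y c z w; rewrite [infmap _ _ _ _ (_ + _)]linearP.
  rewrite [Tmap _ _ _ (_ + _)]linearP !(TMuDr, TMuZr).
  by rewrite !scalerDr !scalerA ?(mulrC c) ?mulrA ?(mulrAC _ c) addrACA.
- move=> t1 t2; rewrite !genE /=.
  by rewrite (eq_irrelevance (deg_mul e e0) e3) (eq_irrelevance (deg_mur e e0) e4).
Qed.

End Infmaps.

Section Epss.
Variable X : coll R M.

Lemma eps_leaf V n (x : X V n) : eps V n (tleaf x) = x.
Proof. exact: plinE. Qed.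

Lemma eps_iota U V n m (h : U `<` V) (e : m = n - 1) (z : Tc X U n) :
  eps V m (TIota h e z) = 0.
Proof.
move: z; apply: (plin_TIota (f := eps V m) (g := \0)) => t.
by rewrite !genE.
Qed.

Lemma eps_mu U V W n1 n2 m (hd : U `&` V = set0) (hu : W = U `|` V :> set M)
    (e : m = n1 + n2 - 1) (z : Tc X U n1) (w : Tc X V n2) :
  eps W m (TMu hd hu e z w) = 0.
Proof.
move: z w; apply: (plin_TMu (f := eps W m) (g := fun z w => 0)).
- by move=> y a z w; rewrite scaler0 addr0.
- by move=> y a z w; rewrite scaler0 addr0.
- by move=> t1 t2; rewrite !genE.
Qed.

End Epss.

Section Dphis.
Variable X : coll R M.

Definition contr U V n m (h : U `<` V) (e : m = n) : {linear Tc X U n -> Tc X V m} :=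
  plin (@contract_compat R M X U n V m h e).

Lemma contr_gen U V n m (h : U `<` V) (e : m = n) (t : tree X U n) :
  contr h e (pgen t) = Defs.contract t h e.
Proof. exact: plinE. Qed.

Lemma contr_leaf U V n m (h : U `<` V) (e : m = n) (x : X U n) :
  contr h e (tleaf x) = 0.
Proof. exact: plinE. Qed.

Lemma contr_iota U V W n m m' (h : U `<` V) (e : m = n - 1) (h' : V `<` W)
    (e' : m' = m) (h'' : U `<` W) (e'' : m' = n - 1) (z : Tc X U n) :
  contr h' e' (TIota h e z) = TIota h'' e'' z.
Proof.
move: z; apply: (plin_TIota (f := contr h' e') (g := TIota h'' e'')) => t.
rewrite ?genE ?contr_gen /=; congr (pgen (Iota _ _ _)); first exact: Prop_irrelevance.
exact: eq_irrelevance.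
Qed.

Lemma contr_mu U V W n1 n2 m (hd : U `&` V = set0) (hu : W = U `|` V :> set M)
    (e : m = n1 + n2 - 1) W' m' (h' : W `<` W') (e' : m' = m) (z : Tc X U n1) (w : Tc X V n2) :
  contr h' e' (TMu hd hu e z w) = 0.
Proof.
move: z w; apply: (plin_TMu (f := contr h' e') (g := fun z w => 0)).
- by move=> y a z w; rewrite scaler0 addr0.
- by move=> y a z w; rewrite scaler0 addr0.
- by move=> t1 t2; rewrite ?genE ?contr_gen.
Qed.

Lemma dphi_leaf V n m (e : m = n + 1) (x : X V n) : dphi V e (tleaf x) = 0.
Proof. exact: plinE. Qed.

Lemma dphi_iota U V n m n' m' (h : U `<` V) (e : m = n - 1) (e1 : m' = m + 1)
    (e2 : n' = n + 1) (e3 : m' = n' - 1) (e4 : m' = n) (z : Tc X U n) :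
  dphi V e1 (TIota h e z) = contr h e4 z - TIota h e3 (dphi U e2 z).
Proof.
subst n'; move: z; apply: (plin_TIota (f := dphi V e1)
  (g := contr h e4 \- (TIota h e3 \o dphi U erefl))) => t /=.
rewrite ?genE ?contr_gen /= /sg expr1z scaleN1r.
by rewrite (eq_irrelevance (deg_contract e e1) e4) (eq_irrelevance (deg_iota e e1) e3).
Qed.

Lemma dphi_mu U V W n1 n2 m n1' n2' m' (hd : U `&` V = set0)
    (hu : W = U `|` V :> set M) (e : m = n1 + n2 - 1) (e0 : m' = m + 1)
    (e1 : n1' = n1 + 1) (e2 : n2' = n2 + 1)
    (e3 : m' = n1' + n2 - 1) (e4 : m' = n1 + n2' - 1) (z : Tc X U n1) (w : Tc X V n2) :
  dphi W e0 (TMu hd hu e z w)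
  = - (TMu hd hu e3 (dphi U e1 z) w + sg R n1 *: TMu hd hu e4 z (dphi V e2 w)).
Proof.
subst n1' n2'; move: z w; apply: (plin_TMu (f := dphi W e0)
  (g := fun z w => - (TMu hd hu e3 (dphi U erefl z) w
                      + sg R n1 *: TMu hd hu e4 z (dphi V erefl w)))).
- move=> y c z w; rewrite [dphi _ _ (_ + _)]linearP !(TMuDl, TMuZl).
  by rewrite scalerDr scalerA (mulrC _ c) -scalerA addrACA -scalerDr opprD scalerN.
- move=> y c z w; rewrite [dphi _ _ (_ + _)]linearP !(TMuDr, TMuZr).
  by rewrite scalerDr scalerA (mulrC _ c) -scalerA addrACA -scalerDr opprD scalerN.
- move=> t1 t2; rewrite ?genE ?contr_gen /= mul1r {1}/sg expr1z scaleN1r.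
  by rewrite (eq_irrelevance (deg_mul e e0) e3) (eq_irrelevance (deg_mur e e0) e4).
Qed.

End Dphis.

End Comonad.

Arguments contr {R M X U V n m} h e.

(** * Comonad laws and the calculus of maps acting on one leaf *)

Section InfmapAlgebra.
Variables (R : realType) (M : topologicalType).
Implicit Types (X Y Z : coll R M) (U V W : opens M) (n m k : int).

Definition hid X : hom0 X X := fun V n => idfun.
Definition hcomp X Y Z (g : hom0 Y Z) (f : hom0 X Y) : hom0 X Z :=
  fun V n => g V n \o f V n.
Definition hcompl X Y Z k (g : hom0 Y Z) (b : homd k X Y) : homd k X Z :=
  fun V n m e => g V m \o b V n m e.
Definition hcompr X Y Z k (b : homd k Y Z) (f : hom0 X Y) : homd k X Z :=
  fun V n m e => b V n m e \o f V n.
Definition hzero X Y k : homd k X Y := fun V n m e => \0.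
Arguments hzero {X Y k}.

Lemma inf_iotaE X Y k (a : hom0 X Y) (b : homd k X Y) U V n m m' (h : U `<` V)
    (e : m = n - 1) (e1 : m' = m + k) (z : Tc X U n) :
  infmap a b V e1 (TIota h e z)
  = sg R k *: TIota h (deg_iota e e1) (infmap a b U erefl z).
Proof. exact: inf_iota. Qed.

Lemma inf_muE X Y k (a : hom0 X Y) (b : homd k X Y) U V W n1 n2 m m'
    (hd : U `&` V = set0) (hu : W = U `|` V :> set M) (e : m = n1 + n2 - 1)
    (e0 : m' = m + k) (z : Tc X U n1) (w : Tc X V n2) :
  infmap a b W e0 (TMu hd hu e z w)
  = sg R k *: (TMu hd hu (deg_mul e e0) (infmap a b U erefl z) (Tmap a V n2 w)
     + sg R (k * n1) *: TMu hd hu (deg_mur e e0) (Tmap a U n1 z) (infmap a b V erefl w)).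
Proof. exact: inf_mu. Qed.

(** The degree-zero infinitesimal composite, hence free of Koszul signs. Its body is the one used
    inside [corelmap], so that [corelE] holds by conversion. *)
Definition inf0 X Y (a b : hom0 X Y) : hom0 (Tc X) (Tc Y) :=
  fun V n => infmap a (homd_of_hom0 b) V (esym (addr0 n)).
Arguments inf0 {X Y} a b V n.

Lemma inf0_leaf X Y (a b : hom0 X Y) V n (x : X V n) :
  inf0 a b V n (tleaf x) = tleaf (b V n x).
Proof. by rewrite /inf0 inf_leaf homd_of_hom0E. Qed.

Lemma inf0_iota X Y (a b : hom0 X Y) U V n m (h : U `<` V) (e : m = n - 1) z :
  inf0 a b V m (TIota h e z) = TIota h e (inf0 a b U n z).
Proof.
by rewrite /inf0 (inf_iota _ _ _ _ _ (esym (addr0 n)) e) [sg R 0]expr0z scale1r.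
Qed.

Lemma inf0_mu X Y (a b : hom0 X Y) U V W n1 n2 m (hd : U `&` V = set0)
    (hu : W = U `|` V :> set M) (e : m = n1 + n2 - 1) z w :
  inf0 a b W m (TMu hd hu e z w)
  = TMu hd hu e (inf0 a b U n1 z) (Tmap a V n2 w)
    + TMu hd hu e (Tmap a U n1 z) (inf0 a b V n2 w).
Proof.
rewrite /inf0 (inf_mu _ _ _ _ _ _ (esym (addr0 n1)) (esym (addr0 n2)) e e).
by rewrite mul0r [sg R 0]expr0z !scale1r.
Qed.

(** The composite is a separate argument specified by its values: packaged linear maps with the same
    values need not be convertible. Several lemmas below have this form for the same reason. *)
Lemma Tmap_comp X Y Z (c : hom0 Y Z) (a : hom0 X Y) (ca : hom0 X Z) :
  (forall V n x, ca V n x = c V n (a V n x)) ->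
  forall V n z, Tmap c V n (Tmap a V n z) = Tmap ca V n z.
Proof.
move=> H; apply: Tc_ind => [V n|V n s x y hx hy|V n x|U V n m h e z IH|U V W n1 n2 m hd hu e z w IH1 IH2].
- by rewrite !linear0.
- by rewrite !linearP hx hy.
- by rewrite !Tmap_leaf H.
- by rewrite !Tmap_iota IH.
- by rewrite !Tmap_mu IH1 IH2.
Qed.

Lemma Tmap_ext X Y (a b : hom0 X Y) :
  (forall V n x, a V n x = b V n x) -> forall V n z, Tmap a V n z = Tmap b V n z.
Proof.
move=> H; apply: Tc_ind => [V n|V n s x y hx hy|V n x|U V n m h e z IH|U V W n1 n2 m hd hu e z w IH1 IH2].
- by rewrite !linear0.
- by rewrite !linearP hx hy.
- by rewrite !Tmap_leaf H.
- by rewrite !Tmap_iota IH.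
- by rewrite !Tmap_mu IH1 IH2.
Qed.

Lemma Tmap_id X (a : hom0 X X) :
  (forall V n x, a V n x = x) -> forall V n z, Tmap a V n z = z.
Proof.
move=> H; apply: Tc_ind => [V n|V n s x y hx hy|V n x|U V n m h e z IH|U V W n1 n2 m hd hu e z w IH1 IH2].
- by rewrite !linear0.
- by rewrite !linearP hx hy.
- by rewrite !Tmap_leaf H.
- by rewrite !Tmap_iota IH.
- by rewrite !Tmap_mu IH1 IH2.
Qed.

Lemma Delta_nat X Y (a : hom0 X Y) V n z :
  Delta V n (Tmap a V n z) = Tmap (Tmap a) V n (Delta V n z).
Proof.
move: V n z; apply: Tc_ind => [V n|V n s x y hx hy|V n x|U V n m h e z IH|U V W n1 n2 m hd hu e z w IH1 IH2].
- by rewrite !linear0.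
- by rewrite !linearP hx hy.
- by rewrite !(Delta_leaf, Tmap_leaf).
- by rewrite !(Delta_iota, Tmap_iota, linearD) /= Tmap_leaf !Tmap_iota IH.
- by rewrite !(Delta_mu, Tmap_mu, linearD) /= Tmap_leaf !Tmap_mu IH1 IH2.
Qed.

Lemma Delta_coassoc X V n (z : Tc X V n) :
  Delta V n (Delta V n z) = Tmap (@Delta R M X) V n (Delta V n z).
Proof.
move: V n z; apply: Tc_ind => [V n|V n s x y hx hy|V n x|U V n m h e z IH|U V W n1 n2 m hd hu e z w IH1 IH2].
- by rewrite !linear0.
- by rewrite !linearP hx hy.
- by rewrite !(Delta_leaf, Tmap_leaf).
- rewrite Delta_iota !linearD /= Delta_leaf Delta_iota Tmap_leaf Tmap_iota Delta_iota.
  by rewrite linearD IH addrA.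
- rewrite Delta_mu !linearD /= Delta_leaf Delta_mu Tmap_leaf Tmap_mu Delta_mu.
  by rewrite linearD IH1 IH2 addrA.
Qed.

Lemma eps_Delta X V n (z : Tc X V n) : eps V n (Delta V n z) = z.
Proof.
move: V n z; apply: Tc_ind => [V n|V n s x y hx hy|V n x|U V n m h e z IH|U V W n1 n2 m hd hu e z w IH1 IH2].
- by rewrite !linear0.
- by rewrite !linearP hx hy.
- by rewrite Delta_leaf eps_leaf.
- by rewrite Delta_iota linearD /= eps_leaf eps_iota addr0.
- by rewrite Delta_mu linearD /= eps_leaf eps_mu addr0.
Qed.

Lemma Teps_Delta X V n (z : Tc X V n) : Tmap (@eps R M X) V n (Delta V n z) = z.
Proof.
move: V n z; apply: Tc_ind => [V n|V n s x y hx hy|V n x|U V n m h e z IH|U V W n1 n2 m hd hu e z w IH1 IH2].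
- by rewrite !linear0.
- by rewrite !linearP hx hy.
- by rewrite Delta_leaf Tmap_leaf eps_leaf.
- by rewrite Delta_iota linearD /= Tmap_leaf Tmap_iota IH eps_iota linear0 add0r.
- by rewrite Delta_mu linearD /= Tmap_leaf Tmap_mu IH1 IH2 eps_mu linear0 add0r.
Qed.

Lemma eps_Tmap X Y (a : hom0 X Y) V n z :
  eps V n (Tmap a V n z) = a V n (eps V n z).
Proof.
move: V n z; apply: Tc_ind => [V n|V n s x y hx hy|V n x|U V n m h e z IH|U V W n1 n2 m hd hu e z w IH1 IH2].
- by rewrite !linear0.
- by rewrite !linearP hx hy.
- by rewrite Tmap_leaf !eps_leaf.
- by rewrite Tmap_iota !eps_iota linear0.
- by rewrite Tmap_mu !eps_mu linear0.
Qed.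

Lemma eps_inf X Y k (a : hom0 X Y) (b : homd k X Y) V n m (e : m = n + k) z :
  eps V m (infmap a b V e z) = b V n m e (eps V n z).
Proof.
move: V n z m e; apply: Tc_ind => [V n|V n s x y hx hy|V n x|U V n p h e0 z IH|U V W n1 n2 p hd hu e0 z w IH1 IH2] m e.
- by rewrite !linear0.
- by rewrite !linearP hx hy.
- by rewrite inf_leaf !eps_leaf.
- by rewrite inf_iotaE linearZ /= !eps_iota !(linear0, scaler0).
- by rewrite inf_muE linearZ /= linearD linearZ /= !eps_mu !(linear0, scaler0, addr0).
Qed.

Lemma inf_Tmap X Y Z k (a : hom0 Y Z) (b : homd k Y Z) (c : hom0 X Y)
    (ac : hom0 X Z) (bc : homd k X Z) :
  (forall V n x, ac V n x = a V n (c V n x)) ->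
  (forall V n m e x, bc V n m e x = b V n m e (c V n x)) ->
  forall V n m (e : m = n + k) z,
  infmap a b V e (Tmap c V n z) = infmap ac bc V e z.
Proof.
move=> Ha Hb V n m e z; move: V n z m e.
apply: Tc_ind => [V n|V n s x y hx hy|V n x|U V n p h e0 z IH|U V W n1 n2 p hd hu e0 z w IH1 IH2] m e.
- by rewrite !linear0.
- by rewrite !linearP hx hy.
- by rewrite Tmap_leaf !inf_leaf Hb.
- by rewrite Tmap_iota !inf_iotaE IH.
- by rewrite Tmap_mu !inf_muE IH1 IH2 !(Tmap_comp Ha).
Qed.

Lemma Tmap_inf X Y Z k (c : hom0 Y Z) (a : hom0 X Y) (b : homd k X Y)
    (ca : hom0 X Z) (cb : homd k X Z) :
  (forall V n x, ca V n x = c V n (a V n x)) ->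
  (forall V n m e x, cb V n m e x = c V m (b V n m e x)) ->
  forall V n m (e : m = n + k) z,
  Tmap c V m (infmap a b V e z) = infmap ca cb V e z.
Proof.
move=> Ha Hb V n m e z; move: V n z m e.
apply: Tc_ind => [V n|V n s x y hx hy|V n x|U V n p h e0 z IH|U V W n1 n2 p hd hu e0 z w IH1 IH2] m e.
- by rewrite !linear0.
- by rewrite !linearP hx hy.
- by rewrite !inf_leaf Tmap_leaf Hb.
- by rewrite !inf_iotaE linearZ /= Tmap_iota IH.
- rewrite !inf_muE linearZ /= linearD linearZ /= !Tmap_mu IH1 IH2.
  by rewrite !(Tmap_comp Ha).
Qed.

Lemma inf_ext X Y k (a a' : hom0 X Y) (b b' : homd k X Y) :
  (forall V n x, a V n x = a' V n x) ->
  (forall V n m e x, b V n m e x = b' V n m e x) ->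
  forall V n m (e : m = n + k) z, infmap a b V e z = infmap a' b' V e z.
Proof.
move=> Ha Hb V n m e z.
rewrite -[LHS](Tmap_id (a := hid Y)) //.
by apply: Tmap_inf => *; rewrite ?Ha ?Hb.
Qed.

Lemma inf_lin X Y k (a : hom0 X Y) (b b' b'' : homd k X Y) (s : R) :
  (forall V n m e x, b'' V n m e x = s *: b V n m e x + b' V n m e x) ->
  forall V n m (e : m = n + k) z,
  infmap a b'' V e z = s *: infmap a b V e z + infmap a b' V e z.
Proof.
move=> H V n m e z; move: V n z m e.
apply: Tc_ind => [V n|V n t x y hx hy|V n x|U V n p h e0 z IH|U V W n1 n2 p hd hu e0 z w IH1 IH2] m e.
- by rewrite !linear0 ?scaler0 addr0.
- by rewrite !linearP hx hy !scalerDr !scalerA mulrC addrACA.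
- by rewrite !inf_leaf H linearP.
- by rewrite !inf_iotaE IH linearP scalerDr !scalerA mulrC.
- rewrite !inf_muE IH1 IH2 !(TMuDl, TMuDr, TMuZl, TMuZr).
  rewrite !scalerDr !scalerA ?(mulrC s) ?mulrA ?(mulrAC _ s) -!addrA.
  by congr (_ + _); rewrite addrCA.
Qed.

Lemma inf_zero X Y k (a : hom0 X Y) (b : homd k X Y) :
  (forall V n m e x, b V n m e x = 0) ->
  forall V n m (e : m = n + k) z, infmap a b V e z = 0.
Proof.
move=> H V n m e z.
rewrite (inf_lin a (b := b) (b' := b) (s := -1)) ?scaleN1r ?addNr //.
by move=> *; rewrite !H scaler0 addr0.
Qed.

(** The leaf on which [b] acts belongs to exactly one upper piece of each cut, so acting before the
    cut amounts to acting inside that piece. *)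
Lemma Delta_inf X Y k (a : hom0 X Y) (b : homd k X Y) V n m (e : m = n + k) z :
  Delta V m (infmap a b V e z)
  = infmap (Tmap a) (infmap a b) V e (Delta V n z).
Proof.
move: V n z m e.
apply: Tc_ind => [V n|V n t x y hx hy|V n x|U V n p h e0 z IH|U V W n1 n2 p hd hu e0 z w IH1 IH2] m e.
- by rewrite !linear0.
- by rewrite !linearP hx hy.
- by rewrite inf_leaf !Delta_leaf !inf_leaf.
- rewrite Delta_iota linearD /= inf_leaf !inf_iotaE [tleaf _]linearZ.
  by rewrite [Delta _ _ _]linearZ /= Delta_iota scalerDr IH.
- rewrite Delta_mu linearD /= inf_leaf !inf_muE !(tleafZ, tleafD).
  rewrite [Delta _ _ (_ *: _)]linearZ /= [Delta _ _ (_ + _)]linearD /=.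
  rewrite [Delta _ _ (_ *: _)]linearZ /= !Delta_mu IH1 IH2 -!Delta_nat.
  by rewrite -[RHS]scalerDr; congr (_ *: _); rewrite scalerDr addrACA.
Qed.

Section Inf0.
Variables (X Y Z : coll R M) (c d : hom0 X Y).

Lemma inf0_Tmap X' (f : hom0 X' X) (cf df : hom0 X' Y) :
  (forall V n x, cf V n x = c V n (f V n x)) ->
  (forall V n x, df V n x = d V n (f V n x)) ->
  forall V n z, inf0 c d V n (Tmap f V n z) = inf0 cf df V n z.
Proof.
move=> Hc Hd V n z; apply: inf_Tmap => // V' n' m e x.
(* Substituting [n'] for [m], and not [n' + 0], is what allows [homd_of_hom0E] to remove the
   transport. *)
by move: e (etrans e (addr0 _)) => /[swap] E; subst m => e; rewrite !homd_of_hom0E.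
Qed.

Lemma Tmap_inf0 (f : hom0 Y Z) (fc fd : hom0 X Z) :
  (forall V n x, fc V n x = f V n (c V n x)) ->
  (forall V n x, fd V n x = f V n (d V n x)) ->
  forall V n z, Tmap f V n (inf0 c d V n z) = inf0 fc fd V n z.
Proof.
move=> Hc Hd V n z; apply: Tmap_inf => // V' n' m e x.
by move: e (etrans e (addr0 _)) => /[swap] E; subst m => e; rewrite !homd_of_hom0E.
Qed.

Lemma Delta_inf0 V n z :
  Delta V n (inf0 c d V n z) = inf0 (Tmap c) (inf0 c d) V n (Delta V n z).
Proof.
rewrite Delta_inf; apply: inf_ext => // V' n' m e x.
move: e (etrans e (addr0 _)) => /[swap] E; subst m => e; rewrite homd_of_hom0E /inf0.
by rewrite (eq_irrelevance e (esym (addr0 n'))).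
Qed.

Lemma eps_inf0 V n z : eps V n (inf0 c d V n z) = d V n (eps V n z).
Proof. by rewrite /inf0 eps_inf homd_of_hom0E. Qed.

(** Since [a] kills the image of [d], there is no term where [b] and [d] act on
    different leaves. *)
Lemma inf_inf0 k (a : hom0 Y Z) (b : homd k Y Z) (ac : hom0 X Z) (bd : homd k X Z) :
  (forall V n x, ac V n x = a V n (c V n x)) ->
  (forall V n m e x, bd V n m e x = b V n m e (d V n x)) ->
  (forall V n x, a V n (d V n x) = 0) ->
  forall V n m (e : m = n + k) z,
  infmap a b V e (inf0 c d V n z) = infmap ac bd V e z.
Proof.
move=> Ha Hb H0 V n m e z.
have T0 V' n' z' : Tmap a V' n' (inf0 c d V' n' z') = 0.
  rewrite /inf0 (Tmap_inf (ca := ac) (cb := hzero)) ?inf_zero // => V1 n1 m1 e1 x.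
  by move: e1 (etrans e1 (addr0 _)) => /[swap] E; subst m1 => e1; rewrite homd_of_hom0E H0.
move: V n z m e.
apply: Tc_ind => [V n|V n t x y hx hy|V n x|U V n p h e0 z IH|U V W n1 n2 p hd hu e0 z w IH1 IH2] m e.
- by rewrite !linear0.
- by rewrite !linearP hx hy.
- by rewrite inf0_leaf !inf_leaf Hb.
- by rewrite inf0_iota !inf_iotaE IH.
- rewrite inf0_mu linearD /= !inf_muE IH1 IH2 !T0 !(Tmap_comp Ha) !linear0 !TMu0l.
  by rewrite scaler0 addr0 add0r -scalerDr.
Qed.

End Inf0.

(** Terms where the two maps act on different leaves agree by the first hypothesis. What remains are
    the leaves on which both act, and there the second hypothesis yields [f]. The lemma will measure
    how far marking a corelation is from commuting with a coderivation. *)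
Lemma inf0_inf X Y k (a b : hom0 X Y) (c : homd k X X) (c' : homd k Y Y)
    (f : homd k X Y) :
  (forall V n m e x, a V m (c V n m e x) = c' V n m e (a V n x)) ->
  (forall V n m e x, f V n m e x = b V m (c V n m e x) - c' V n m e (b V n x)) ->
  forall V n m (e : m = n + k) z,
  inf0 a b V m (infmap (hid X) c V e z)
  = infmap (hid Y) c' V e (inf0 a b V n z) + infmap a f V e z.
Proof.
move=> Ha Hf V n m e z; move: V n z m e.
have C V n m e z : Tmap a V m (infmap (hid X) c V e z)
                 = infmap (hid Y) c' V e (Tmap a V n z) :> Tc Y V m.
  rewrite (Tmap_inf (ca := a) (cb := hcompl a c)) //.
  by rewrite (inf_Tmap (ac := a) (bc := hcompl a c)).
have idX V n z : Tmap (hid X) V n z = z by apply: Tmap_id.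
have idY V n z : Tmap (hid Y) V n z = z by apply: Tmap_id.
apply: Tc_ind => [V n|V n t x y hx hy|V n x|U V n p h e0 z IH|U V W n1 n2 p hd hu e0 z w IH1 IH2] m e.
- by rewrite !linear0 addr0.
- by rewrite !linearP hx hy scalerDr addrACA.
- by rewrite !(inf0_leaf, inf_leaf) Hf -tleafD addrC subrK.
- by rewrite inf0_iota !inf_iotaE linearZ /= inf0_iota IH linearD scalerDr.
- rewrite inf0_mu linearD /= !inf_muE !idX !idY linearZ linearD linearZ /=.
  rewrite !inf0_mu !C IH1 IH2 !(TMuDl, TMuDr) !scalerDr !scalerA !addrA.
  by rewrite [LHS](ACl (1*4*3*5*2*6)).
Qed.

End InfmapAlgebra.

Arguments hzero {R M X Y k}.
Arguments inf0 {R M X Y} a b V n.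

(** * Coderivations *)

Section Coderivations.
Variables (R : realType) (M : topologicalType).
Implicit Types (X Y Z : coll R M) (U V W : opens M) (n m k : int).

Lemma sg1 : sg R 1 = -1.
Proof. by rewrite /sg expr1z. Qed.

Lemma sg2 : sg R (1 + 1) = 1.
Proof. by rewrite sgD sgK. Qed.

Lemma sgS p : sg R (p + 1) = - sg R p.
Proof. by rewrite sgD sg1 mulrN1. Qed.

Lemma linNDZ (A B : lmodType R) (f : {linear A -> B}) x y s :
  f (- (x + s *: y)) = - (f x + s *: f y).
Proof. by rewrite linearN linearD linearZ. Qed.

Lemma linBDZ (A B : lmodType R) (f : {linear A -> B}) x y s z :
  f (z - (x + s *: y)) = f z - (f x + s *: f y).
Proof. by rewrite linearB linearD linearZ. Qed.

Lemma infmapD X Y k (a : hom0 X Y) (b : homd k X Y) V n m (e : m = n + k) x y :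
  infmap a b V e (x + y) = infmap a b V e x + infmap a b V e y.
Proof. exact: linearD. Qed.

Lemma dphi_iotaE X U V n m m' (h : U `<` V) (e : m = n - 1) (e1 : m' = m + 1)
    (z : Tc X U n) :
  dphi V e1 (TIota h e z)
  = contr h (deg_contract e e1) z - TIota h (deg_iota e e1) (dphi U erefl z).
Proof. exact: dphi_iota. Qed.

Lemma dphi_muE X U V W n1 n2 m m' (hd : U `&` V = set0)
    (hu : W = U `|` V :> set M) (e : m = n1 + n2 - 1) (e0 : m' = m + 1)
    (z : Tc X U n1) (w : Tc X V n2) :
  dphi W e0 (TMu hd hu e z w)
  = - (TMu hd hu (deg_mul e e0) (dphi U erefl z) w
       + sg R n1 *: TMu hd hu (deg_mur e e0) z (dphi V erefl w)).
Proof. exact: dphi_mu. Qed.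

Lemma contr_iotaE X U V W n m m' (h : U `<` V) (e : m = n - 1) (h' : V `<` W)
    (e' : m' = m) (z : Tc X U n) :
  contr h' e' (TIota h e z) = TIota (subset_proper_trans h h') (etrans e' e) z.
Proof. exact: contr_iota. Qed.

Lemma contr_contr X U V W n m p (h : U `<` V) (h' : V `<` W) (h'' : U `<` W)
    (e : m = n) (e' : p = m) (e'' : p = n) (z : Tc X U n) :
  contr h' e' (contr h e z) = contr h'' e'' z.
Proof.
move: U n z h e h'' e''.
apply: Tc_ind => [U n|U n s x y hx hy|U n x|U0 U n0 n h0 e0 z _|U1 U2 U n1 n2 n hd hu e0 z w _ _] h e h'' e''.
- by rewrite !linear0.
- by rewrite !linearP (hx h e h'' e'') (hy h e h'' e'').
- by rewrite !contr_leaf linear0.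
- rewrite !contr_iotaE; congr (TIota _ _ _); first exact: Prop_irrelevance.
  exact: eq_irrelevance.
- by rewrite !contr_mu linear0.
Qed.

Lemma contr_Tmap X Y (a : hom0 X Y) U V n m (h : U `<` V) (e : m = n) z :
  contr h e (Tmap a U n z) = Tmap a V m (contr h e z).
Proof.
move: U n z h e.
apply: Tc_ind => [U n|U n s x y hx hy|U n x|U0 U n0 n h0 e0 z _|U1 U2 U n1 n2 n hd hu e0 z w _ _] h e.
- by rewrite !linear0.
- by rewrite !linearP hx hy.
- by rewrite Tmap_leaf !contr_leaf linear0.
- by rewrite Tmap_iota !contr_iotaE Tmap_iota.
- by rewrite Tmap_mu !contr_mu linear0.
Qed.

Lemma dphi_Tmap X Y (a : hom0 X Y) V n m (e : m = n + 1) z :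
  dphi V e (Tmap a V n z) = Tmap a V m (dphi V e z).
Proof.
move: V n z m e.
apply: Tc_ind => [V n|V n s x y hx hy|V n x|U V n p h e0 z IH|U V W n1 n2 p hd hu e0 z w IH1 IH2] m e.
- by rewrite !linear0.
- by rewrite !linearP hx hy.
- by rewrite Tmap_leaf !dphi_leaf linear0.
- by rewrite Tmap_iota !dphi_iotaE linearB /= Tmap_iota IH contr_Tmap.
- by rewrite Tmap_mu !dphi_muE linNDZ /= !Tmap_mu IH1 IH2.
Qed.

Lemma contr_inf0 X Y (a b : hom0 X Y) U V n m (h : U `<` V) (e : m = n) z :
  contr h e (inf0 a b U n z) = inf0 a b V m (contr h e z).
Proof.
move: U n z h e.
apply: Tc_ind => [U n|U n s x y hx hy|U n x|U0 U n0 n h0 e0 z _|U1 U2 U n1 n2 n hd hu e0 z w _ _] h e.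
- by rewrite !linear0.
- by rewrite !linearP hx hy.
- by rewrite inf0_leaf !contr_leaf linear0.
- by rewrite inf0_iota !contr_iotaE inf0_iota.
- by rewrite inf0_mu linearD /= !contr_mu linear0 addr0.
Qed.

Lemma dphi_inf0 X Y (a b : hom0 X Y) V n m (e : m = n + 1) z :
  dphi V e (inf0 a b V n z) = inf0 a b V m (dphi V e z).
Proof.
move: V n z m e.
apply: Tc_ind => [V n|V n s x y hx hy|V n x|U V n p h e0 z IH|U V W n1 n2 p hd hu e0 z w IH1 IH2] m e.
- by rewrite !linear0.
- by rewrite !linearP hx hy.
- by rewrite inf0_leaf !dphi_leaf linear0.
- by rewrite inf0_iota !dphi_iotaE linearB /= inf0_iota IH contr_inf0.
- rewrite inf0_mu linearD /= !dphi_muE linNDZ /= !inf0_mu IH1 IH2.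
  by rewrite !dphi_Tmap -opprD scalerDr addrACA.
Qed.

Lemma Delta_contr X U V n m (h : U `<` V) (e : m = n) (z : Tc X U n) :
  Delta V m (contr h e z) = tleaf (contr h e z) + contr h e (Delta U n z).
Proof.
move: U n z h e.
apply: Tc_ind => [U n|U n s x y hx hy|U n x|U0 U n0 n h0 e0 z _|U1 U2 U n1 n2 n hd hu e0 z w _ _] h e.
- by rewrite !linear0 ?tleaf0 addr0.
- by rewrite !linearP hx hy /= ?tleafD ?tleafZ scalerDr addrACA.
- by rewrite Delta_leaf !contr_leaf linear0 ?tleaf0 addr0.
- by rewrite Delta_iota linearD /= contr_leaf !contr_iotaE Delta_iota add0r.
- by rewrite Delta_mu linearD /= contr_leaf !contr_mu linear0 ?tleaf0 !addr0.
Qed.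

(** A contracted pair of [iota] lies either in the root piece of a cut or in one upper piece, whence
    the two terms. A cut between the two vertices has no counterpart after the contraction. *)
Lemma Delta_dphi X V n m (e : m = n + 1) (z : Tc X V n) :
  Delta V m (dphi V e z)
  = dphi V e (Delta V n z) + infmap (hid (Tc X)) (@dphi R M X) V e (Delta V n z).
Proof.
have idX V' n' z' : Tmap (hid (Tc X)) V' n' z' = z' by apply: Tmap_id.
move: V n z m e.
apply: Tc_ind => [V n|V n s x y hx hy|V n x|U V n p h e0 z IH|U V W n1 n2 p hd hu e0 z w IH1 IH2] m e.
- by rewrite !linear0 addr0.
- by rewrite !linearP hx hy scalerDr addrACA.
- by rewrite Delta_leaf inf_leaf !dphi_leaf linear0 ?tleaf0 addr0.
- rewrite Delta_iota !linearD /= !(dphi_leaf, inf_leaf) inf_iotaE !dphi_iotaE.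
  rewrite linearB /= Delta_contr Delta_iota IH sg1 scaleN1r !TIotaD add0r.
  rewrite (linearB (@tleaf R M _ _ _)) /= !opprD !addrA.
  by rewrite [LHS](ACl (2*4*1*3*5)).
- rewrite Delta_mu !linearD /= !(dphi_leaf, inf_leaf) inf_muE !dphi_muE.
  rewrite linNDZ /= !Delta_mu IH1 IH2 !idX sg1 mul1r scaleN1r add0r.
  rewrite (linNDZ (@tleaf R M _ _ _)) /= [in RHS]addrCA -!opprD.
  congr (- _); rewrite !(TMuDl, TMuDr) !scalerDr !addrA.
  by rewrite [LHS](ACl (1*4*2*5*3*6)).
Qed.

Lemma eps_contr X U V n m (h : U `<` V) (e : m = n) (z : Tc X U n) :
  eps V m (contr h e z) = 0.
Proof.
move: U n z h e.
apply: Tc_ind => [U n|U n s x y hx hy|U n x|U0 U n0 n h0 e0 z _|U1 U2 U n1 n2 n hd hu e0 z w _ _] h e.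
- by rewrite !linear0.
- by rewrite !linearP hx hy /= scaler0 addr0.
- by rewrite contr_leaf linear0.
- by rewrite contr_iotaE eps_iota.
- by rewrite contr_mu linear0.
Qed.

Lemma eps_dphi X V n m (e : m = n + 1) (z : Tc X V n) : eps V m (dphi V e z) = 0.
Proof.
move: V n z m e.
apply: Tc_ind => [V n|V n s x y hx hy|V n x|U V n p h e0 z IH|U V W n1 n2 p hd hu e0 z w IH1 IH2] m e.
- by rewrite !linear0.
- by rewrite !linearP hx hy /= scaler0 addr0.
- by rewrite dphi_leaf linear0.
- by rewrite dphi_iotaE linearB /= eps_contr eps_iota subr0.
- by rewrite dphi_muE linNDZ /= !eps_mu scaler0 addr0 oppr0.
Qed.

(** The coderivation with corestriction [d], including the differential of the cooperad. *)
Definition coder X (d : homd 1 (Tc X) X) : homd 1 (Tc X) (Tc X) :=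
  fun V n m e => dphi V e \+ (infmap (@eps R M X) d V e \o Delta V n).

Section Coder.
Variables (X : coll R M) (d : homd 1 (Tc X) X).

Lemma coder_leaf V n m (e : m = n + 1) (x : X V n) :
  coder d V e (tleaf x) = tleaf (d V e (tleaf x)).
Proof. by rewrite /coder /= dphi_leaf add0r Delta_leaf inf_leaf. Qed.

Lemma coder_iota U V n m m' (h : U `<` V) (e : m = n - 1) (e1 : m' = m + 1)
    (z : Tc X U n) :
  coder d V e1 (TIota h e z)
  = tleaf (d V e1 (TIota h e z)) + contr h (deg_contract e e1) z
    - TIota h (deg_iota e e1) (coder d U erefl z).
Proof.
rewrite /coder /= dphi_iotaE Delta_iota infmapD inf_leaf inf_iotaE TIotaD.
by rewrite sg1 scaleN1r opprD !addrA [LHS](ACl (3*1*2*4)).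
Qed.

Lemma coder_mu U V W n1 n2 m m' (hd : U `&` V = set0)
    (hu : W = U `|` V :> set M) (e : m = n1 + n2 - 1) (e0 : m' = m + 1)
    (z : Tc X U n1) (w : Tc X V n2) :
  coder d W e0 (TMu hd hu e z w)
  = tleaf (d W e0 (TMu hd hu e z w))
    - (TMu hd hu (deg_mul e e0) (coder d U erefl z) w
       + sg R n1 *: TMu hd hu (deg_mur e e0) z (coder d V erefl w)).
Proof.
rewrite /coder /= dphi_muE Delta_mu infmapD inf_leaf inf_muE !(TMuDl, TMuDr).
rewrite !Teps_Delta sg1 mul1r scaleN1r scalerDr !opprD !addrA.
by rewrite [LHS](ACl (3*1*4*2*5)).
Qed.

Lemma eps_coder V n m (e : m = n + 1) z : eps V m (coder d V e z) = d V e z.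
Proof. by rewrite /coder /= linearD /= eps_dphi add0r eps_inf eps_Delta. Qed.

Lemma Delta_coder V n m (e : m = n + 1) z :
  Delta V m (coder d V e z)
  = dphi V e (Delta V n z) + infmap (hid (Tc X)) (coder d) V e (Delta V n z).
Proof.
rewrite {1}/coder /= linearD /= Delta_dphi Delta_inf Delta_coassoc -addrA.
congr (_ + _).
rewrite (inf_Tmap (ac := hid (Tc X)) (bc := hcompr (infmap (@eps R M X) d) (@Delta R M X))) //.
  by rewrite -[X in X + _]scale1r -(inf_lin _ (b'' := coder d)) // => *; rewrite scale1r.
by move=> *; rewrite Teps_Delta.
Qed.

Lemma coder_contr U V n m p q (h : U `<` V) (e : m = n) (e' : p = m + 1)
    (e1 : q = n + 1) (e2 : p = q) (z : Tc X U n) :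
  coder d V e' (contr h e z)
  = tleaf (d V e' (contr h e z)) + contr h e2 (coder d U e1 z).
Proof.
move: U n z h e q e1 e2.
apply: Tc_ind => [U n|U n s x y hx hy|U n x|U0 U n0 n h0 e0 z _|U1 U2 U n1 n2 n hd hu e0 z w _ _] h e q e1 e2.
- by rewrite !linear0 ?tleaf0 addr0.
- by rewrite !linearP (hx h e q e1 e2) (hy h e q e1 e2) /= ?tleafD ?tleafZ scalerDr addrACA.
- by rewrite coder_leaf !contr_leaf !linear0 ?tleaf0 addr0.
- rewrite !contr_iotaE !coder_iota (linearB (contr h e2)) (linearD (contr h e2)) /= contr_leaf add0r -!addrA.
  congr (_ + (_ - _)).
    by apply/esym/contr_contr.
  rewrite contr_iotaE; congr (TIota _ _ _); exact: eq_irrelevance.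
- rewrite contr_mu coder_mu !linear0 ?tleaf0 (linBDZ (contr h e2)).
  by rewrite contr_leaf !contr_mu scaler0 !addr0 subr0 ?addr0.
Qed.

(** Terms acting in the two branches of a [mu] cancel by the Koszul signs, and the contractions by
    [coder_contr]; only [d] after [coder d] survives. This holds on all of [Tc]; for [d = 0] it says
    that [dphi] squares to zero. *)
Lemma coder_coder (g : homd (1 + 1) (Tc X) X) :
  (forall V n m p (e : m = n + 1) (e' : p = m + 1) (e'' : p = n + (1 + 1)) z,
     g V n p e'' z = d V e' (coder d V e z)) ->
  forall V n m p (e : m = n + 1) (e' : p = m + 1) (e'' : p = n + (1 + 1)) z,
  coder d V e' (coder d V e z) = infmap (@eps R M X) g V e'' (Delta V n z).
Proof.
move=> H V n m p e e' e'' z; move: V n z m p e e' e''.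
apply: Tc_ind => [V n|V n s x y hx hy|V n x|U V n q h e0 z IH|U V W n1 n2 q hd hu e0 z w IH1 IH2] m p e e' e''.
- by rewrite !linear0.
- by rewrite !linearP (hx _ _ e e' e'') (hy _ _ e e' e'').
- by rewrite Delta_leaf inf_leaf (H _ _ _ _ e e') !coder_leaf.
- rewrite Delta_iota infmapD inf_leaf (H _ _ _ _ e e').
  rewrite (inf_iota _ _ _ _ _ (esym (addrA n 1 1)) (deg_iota (deg_iota e0 e) e')).
  rewrite -(IH _ _ erefl erefl) sg2 scale1r coder_iota (linearB (coder d V e')) (linearD (coder d V e')).
  rewrite coder_leaf coder_iota.
  rewrite (coder_contr _ _ _ erefl (deg_contract (deg_iota e0 e) e')).
  rewrite (linearB (d V e')) (linearD (d V e')).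
  rewrite (linearB (@tleaf R M _ _ _)) (linearD (@tleaf R M _ _ _)) !opprD opprK !addrA.
  rewrite [LHS](ACl (1*2*4*6*3*5)).
  exact: addrK.
- rewrite Delta_mu infmapD inf_leaf (H _ _ _ _ e e').
  rewrite (inf_mu _ _ _ _ _ _ (esym (addrA n1 1 1)) (esym (addrA n2 1 1))
    (deg_mul (deg_mul e0 e) e') (deg_mur (deg_mur e0 e) e')).
  rewrite -(IH1 _ _ erefl erefl) -(IH2 _ _ erefl erefl) !Teps_Delta.
  rewrite mulrDl mul1r !sgD !sgK !scale1r coder_mu (linBDZ (coder d W e')).
  rewrite coder_leaf !coder_mu (linBDZ (d W e')).
  rewrite (linBDZ (@tleaf R M _ _ _)).
  rewrite (eq_irrelevance (deg_mur (deg_mul e0 e) e') (deg_mul (deg_mur e0 e) e')).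
  rewrite sgS scaleNr scalerBr scalerDr scalerA sgK scale1r !opprD !opprK !addrA.
  rewrite [LHS](ACl (1*2*5*3*7*6*4)).
  exact: addrK.
Qed.

End Coder.

End Coderivations.

(** * Corelations *)

Section Corelations.
Variables (R : realType) (M : topologicalType).
Implicit Types (X Y Z : coll R M) (U V W : opens M) (n m k : int).

(** A spanning condition, so that the weight grading of the quotient need not be constructed. *)
Definition has_weight X V n (w : nat) (z : Tc X V n) : Prop :=
  exists2 s : seq (R * tree X V n), z = comb pgen s & all (fun p => weight p.2 == w) s.

Lemma has_weight_gen X V n (t : tree X V n) : has_weight (weight t) (pgen t : Tc X V n).
Proof. by exists [:: (1, t)]; rewrite /= ?eqxx // /comb big_seq1 scale1r. Qed.

Lemma has_weightD X V n w (x y : Tc X V n) : has_weight w x -> has_weight w y -> has_weight w (x + y).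
Proof.
by move=> [s -> hs] [t -> ht]; exists (s ++ t); rewrite ?comb_cat // all_cat hs.
Qed.

Lemma has_weightZ X V n w a (x : Tc X V n) : has_weight w x -> has_weight w (a *: x).
Proof.
by move=> [s -> hs]; exists (pscale a s); rewrite ?comb_pscale // all_map.
Qed.

Lemma has_weight0 X V n w : has_weight w (0 : Tc X V n).
Proof. by exists [::]; rewrite // /comb big_nil. Qed.

Lemma has_weight_iota X U V n m (h : U `<` V) (e : m = n - 1) w (z : Tc X U n) :
  has_weight w z -> has_weight w.+1 (TIota h e z).
Proof.
move=> [s -> hs]; exists (smap (Iota h e) s); last by rewrite all_map.
rewrite comb_smap -comb_linear; apply: eq_bigr => p _ /=.
by rewrite TIota_gen.
Qed.

Lemma has_weight_mu X U V W n1 n2 m (hd : U `&` V = set0) (hu : W = U `|` V :> set M)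
    (e : m = n1 + n2 - 1) w1 w2 (z : Tc X U n1) (w : Tc X V n2) :
  has_weight w1 z -> has_weight w2 w -> has_weight (w1 + w2).+1 (TMu hd hu e z w).
Proof.
move=> [s -> hs] [s' -> hs'].
elim: s hs => [|p s IH] /=; first by rewrite /comb big_nil TMu0l => _; exact: has_weight0.
move=> /andP[hp /IH{}IH]; rewrite {1}/comb big_cons TMuDl; apply: has_weightD => //.
rewrite TMuZl; apply: has_weightZ; rewrite TMu_combr {IH}.
elim: s' hs' => [|q s' IH] /=; first by rewrite big_nil => _; exact: has_weight0.
move=> /andP[hq /IH{}IH]; rewrite big_cons; apply: has_weightD => //.
apply: has_weightZ; rewrite TMu_gen.
have -> : (w1 + w2).+1 = weight (Mu hd hu e p.2 q.2) by rewrite /= (eqP hp) (eqP hq).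
exact: has_weight_gen.
Qed.

Lemma tmapt_weight X Y (f : hom0 X Y) V n (t : tree X V n) : has_weight (weight t) (tmapt f t).
Proof.
elim: t => {V n} [V n x|U V n m h e t IH|U V W n1 n2 m hd hu e t1 IH1 t2 IH2].
- exact: has_weight_gen.
- exact: has_weight_iota.
- exact: has_weight_mu.
Qed.

Lemma infmapt_weight X Y k (a : hom0 X Y) (b : homd k X Y) V n (t : tree X V n) m
    (e : m = n + k) : has_weight (weight t) (infmapt a b t e).
Proof.
elim: t m e => {V n} [V n x|U V n m h e t IH|U V W n1 n2 m hd hu e t1 IH1 t2 IH2] m' e'.
- exact: has_weight_gen.
- exact/has_weightZ/has_weight_iota.
- apply/has_weightZ/has_weightD; first by apply: has_weight_mu => //; exact: tmapt_weight.
  by apply/has_weightZ/has_weight_mu => //; exact: tmapt_weight.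
Qed.

Lemma toQ_gen Y V n (t : tree Y V n) : toQ V n (pgen t) = pgen t.
Proof. exact: plinE. Qed.

Lemma toQD Y V n (x y : Tc Y V n) : toQ V n (x + y) = toQ V n x + toQ V n y.
Proof. exact: linearD. Qed.

Lemma toQZ Y V n a (x : Tc Y V n) : toQ V n (a *: x) = a *: toQ V n x.
Proof. exact: linearZ. Qed.

Lemma toQ_weight Y V n (t : tree Y V n) : weight t <> 2%N -> pgen t = 0 :> Qc Y V n.
Proof.
move=> H; have := @pgen_compat _ _ (@quotrel R M Y V n) [:: (1, t)].
by rewrite /comb big_seq1 scale1r; apply; exact: quot_weight H _.
Qed.

Lemma toQ_has_weight Y V n w (z : Tc Y V n) : has_weight w z -> w <> 2%N -> toQ V n z = 0.
Proof.
move=> [s -> hs] Hw; elim: s hs => [|p s IH] /=; first by rewrite /comb big_nil linear0.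
move=> /andP[/eqP hp /IH{}IH]; rewrite {1}/comb big_cons linearP IH addr0 toQ_gen.
have -> : pgen p.2 = 0 :> Qc Y V n by apply: toQ_weight; rewrite hp.
exact: scaler0.
Qed.

Section QR.
Variable Y : coll R M.
Implicit Types (UV UW VW T : opens M).

Lemma toQ_iota_iota U V W n n' m (hUV : U `<` V) (hVW : V `<` W)
    (e1 : n' = n - 1) (e2 : m = n' - 1) (x : Y U n) :
  toQ W m (TIota hVW e2 (TIota hUV e1 (tleaf x))) = 0.
Proof.
have := pgen_compat (quot_qR (qR_iota_iota hUV hVW e1 e2 x)).
by rewrite !TIota_gen toQ_gen /comb big_seq1 scale1r.
Qed.

Lemma toQ_mu1_mu2 U V W UV VW T i j k ij jk m
    (hUV : U `&` V = set0) (hVW : V `&` W = set0)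
    (hUVW : UV `&` W = set0) (hUVW' : U `&` VW = set0)
    (eUV : UV = U `|` V :> set M) (eVW : VW = V `|` W :> set M)
    (eT : T = UV `|` W :> set M) (eT' : T = U `|` VW :> set M)
    (e1 : ij = i + j - 1) (e2 : m = ij + k - 1)
    (e3 : jk = j + k - 1) (e4 : m = i + jk - 1)
    (x : Y U i) (y : Y V j) (z : Y W k) :
  toQ T m (TMu hUVW eT e2 (TMu hUV eUV e1 (tleaf x) (tleaf y)) (tleaf z))
  = sg R i *: toQ T m (TMu hUVW' eT' e4 (tleaf x) (TMu hVW eVW e3 (tleaf y) (tleaf z))).
Proof.
have := pgen_compat (quot_qR (qR_mu1_mu2 hUV hVW hUVW hUVW' eUV eVW eT eT' e1 e2 e3 e4 x y z)).
rewrite !TMu_gen !toQ_gen comb2 scale1r scaleNr => /eqP.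
by rewrite subr_eq0 => /eqP.
Qed.

Lemma toQ_mu1_mu1 U V W UV UW T i j k ij ik m
    (hUV : U `&` V = set0) (hUW : U `&` W = set0)
    (hUVW : UV `&` W = set0) (hUWV : UW `&` V = set0)
    (eUV : UV = U `|` V :> set M) (eUW : UW = U `|` W :> set M)
    (eT : T = UV `|` W :> set M) (eT' : T = UW `|` V :> set M)
    (e1 : ij = i + j - 1) (e2 : m = ij + k - 1)
    (e3 : ik = i + k - 1) (e4 : m = ik + j - 1)
    (x : Y U i) (y : Y V j) (z : Y W k) :
  toQ T m (TMu hUVW eT e2 (TMu hUV eUV e1 (tleaf x) (tleaf y)) (tleaf z))
  = sg R (j * k) *: toQ T m (TMu hUWV eT' e4 (TMu hUW eUW e3 (tleaf x) (tleaf z)) (tleaf y)).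
Proof.
have := pgen_compat (quot_qR (qR_mu1_mu1 hUV hUW hUVW hUWV eUV eUW eT eT' e1 e2 e3 e4 x y z)).
rewrite !TMu_gen !toQ_gen comb2 scale1r scaleNr => /eqP.
by rewrite subr_eq0 => /eqP.
Qed.

Lemma toQ_mu1_iota U V W UW VW i j i' ij m
    (hUV : U `<` V) (hVW : V `&` W = set0) (hUW : U `&` W = set0)
    (hUWVW : UW `<` VW) (eUW : UW = U `|` W :> set M)
    (eVW : VW = V `|` W :> set M)
    (e1 : i' = i - 1) (e2 : m = i' + j - 1)
    (e3 : ij = i + j - 1) (e4 : m = ij - 1)
    (x : Y U i) (y : Y W j) :
  toQ VW m (TMu hVW eVW e2 (TIota hUV e1 (tleaf x)) (tleaf y))
  = toQ VW m (TIota hUWVW e4 (TMu hUW eUW e3 (tleaf x) (tleaf y))).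
Proof.
have := pgen_compat (quot_qR (qR_mu1_iota hUV hVW hUW hUWVW eUW eVW e1 e2 e3 e4 x y)).
rewrite TIota_gen !TMu_gen TIota_gen !toQ_gen comb2 scale1r scaleN1r => /eqP.
by rewrite subr_eq0 => /eqP.
Qed.

Lemma toQ_mu2_iota U V W UW UV i j j' ij m
    (hWV : W `<` V) (hUV : U `&` V = set0) (hUW : U `&` W = set0)
    (hUWUV : UW `<` UV) (eUW : UW = U `|` W :> set M)
    (eUV : UV = U `|` V :> set M)
    (e1 : j' = j - 1) (e2 : m = i + j' - 1)
    (e3 : ij = i + j - 1) (e4 : m = ij - 1)
    (x : Y U i) (y : Y W j) :
  toQ UV m (TMu hUV eUV e2 (tleaf x) (TIota hWV e1 (tleaf y)))
  = sg R i *: toQ UV m (TIota hUWUV e4 (TMu hUW eUW e3 (tleaf x) (tleaf y))).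
Proof.
have := pgen_compat (quot_qR (qR_mu2_iota hWV hUV hUW hUWUV eUW eUV e1 e2 e3 e4 x y)).
rewrite TIota_gen !TMu_gen TIota_gen !toQ_gen comb2 scaleN1r => /eqP.
by rewrite subr_eq0 => /eqP <-; rewrite scalerA sgK scale1r.
Qed.

End QR.

Lemma Qmap_compat X Y (f : hom0 X Y) V n :
  compat (@quotrel R M X V n) (fun t => toQ V n (tmapt f t)).
Proof.
move=> r; case=> [hr|t ht ->|].
- by rewrite (comb_linear (toQ V n) (@tmapt R M X Y f V n)) tmapt_compat // linear0.
- by rewrite /comb big_seq1 scale1r (toQ_has_weight (tmapt_weight f t)).
case=> {V n r}.
- by move=> *; rewrite /comb big_seq1 scale1r /= toQ_iota_iota.
- move=> U V W UV VW T i j k ij jk m hUV hVW hUVW hUVW' eUV eVW eT eT' e1 e2 e3 e4 x y z.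
  rewrite comb2 scale1r scaleNr /=.
  by rewrite (toQ_mu1_mu2 hUV hVW hUVW hUVW' eUV eVW eT eT' e1 e2 e3 e4) subrr.
- move=> U V W UV UW T i j k ij ik m hUV hUW hUVW hUWV eUV eUW eT eT' e1 e2 e3 e4 x y z.
  rewrite comb2 scale1r scaleNr /=.
  by rewrite (toQ_mu1_mu1 hUV hUW hUVW hUWV eUV eUW eT eT' e1 e2 e3 e4) subrr.
- move=> U V W UW VW i j i' ij m hUV hVW hUW hUWVW eUW eVW e1 e2 e3 e4 x y.
  rewrite comb2 scale1r scaleN1r /=.
  by rewrite (toQ_mu1_iota hUV hVW hUW hUWVW eUW eVW e1 e2 e3 e4) subrr.
- move=> U V W UW UV i j j' ij m hWV hUV hUW hUWUV eUW eUV e1 e2 e3 e4 x y.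
  rewrite comb2 scaleN1r /=.
  rewrite (toQ_mu2_iota hWV hUV hUW hUWUV eUW eUV e1 e2 e3 e4).
  by rewrite scalerA sgK scale1r subrr.
Qed.

Definition Qmap X Y (f : hom0 X Y) : hom0 (Qc X) (Qc Y) :=
  fun V n => plin (@Qmap_compat X Y f V n).

(** The half difference [r] of the exponents is supplied by hand, which turns an equality of signs
    into an identity for [ring]. *)
Lemma sg_par r p q : p = q + r + r -> sg R p = sg R q.
Proof. by move=> ->; rewrite !sgD -mulrA sgK mulr1. Qed.

(** Acting on one leaf of a corelation gives a corelation of the same shape, so each leaf can be
    treated separately. The content is the comparison of the Koszul signs. *)
Lemma Qinf_compat X Y k (a : hom0 X Y) (b : homd k X Y) V n m (e : m = n + k) :
  compat (@quotrel R M X V n) (fun t => toQ V m (infmapt a b t e)).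
Proof.
move=> r; case=> [hr|t ht ->|hr].
- rewrite (comb_linear (toQ V m) (fun t => infmapt a b t e)).
  by rewrite infmapt_compat // linear0.
- by rewrite /comb big_seq1 scale1r (toQ_has_weight (infmapt_weight a b t e)).
case: hr m e => {V n r}.
- move=> U V W n n' m0 hUV hVW e1 e2 x m e; rewrite /comb big_seq1 scale1r /=.
  by rewrite TIotaZ !toQZ toQ_iota_iota !scaler0.
- move=> U V W UV VW T i j l ij jk m0 hUV hVW hUVW hUVW' eUV eVW eT eT' e1 e2 e3 e4 x y z m e.
  rewrite comb2 scale1r scaleNr /=.
  rewrite !(TMuZl, TMuZr, TMuDl, TMuDr) !(toQZ, toQD).
  rewrite (toQ_mu1_mu2 hUV hVW hUVW hUVW' eUV eVW eT eT' _ _ e3 (deg_mul e4 e)).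
  rewrite (toQ_mu1_mu2 hUV hVW hUVW hUVW' eUV eVW eT eT' _ _ (deg_mul e3 erefl) (deg_mur e4 e)).
  rewrite (toQ_mu1_mu2 hUV hVW hUVW hUVW' eUV eVW eT eT' _ _ (deg_mur e3 erefl) (deg_mur e4 e)).
  rewrite !scalerDr !scalerA; apply/eqP; rewrite subr_eq0; apply/eqP.
  rewrite -[LHS]addrA; congr (_ *: _ + (_ *: _ + _ *: _)); rewrite -!sgD; subst ij.
  + by apply: (@sg_par k); ring.
  + by apply: (@sg_par 0); ring.
  + by apply: (@sg_par (- k)); ring.
- move=> U V W UV UW T i j l ij ik m0 hUV hUW hUVW hUWV eUV eUW eT eT' e1 e2 e3 e4 x y z m e.
  rewrite comb2 scale1r scaleNr /=.
  rewrite !(TMuZl, TMuZr, TMuDl, TMuDr) !(toQZ, toQD).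
  rewrite (toQ_mu1_mu1 hUV hUW hUVW hUWV eUV eUW eT eT' _ _ (deg_mul e3 erefl) (deg_mul e4 e)).
  rewrite (toQ_mu1_mu1 hUV hUW hUVW hUWV eUV eUW eT eT' _ _ e3 (deg_mur e4 e)).
  rewrite (toQ_mu1_mu1 hUV hUW hUVW hUWV eUV eUW eT eT' _ _ (deg_mur e3 erefl) (deg_mul e4 e)).
  rewrite !scalerDr !scalerA; apply/eqP; rewrite subr_eq0; apply/eqP.
  rewrite [LHS]addrAC; congr (_ *: _ + _ *: _ + _ *: _); rewrite -!sgD; subst ij ik.
  + by apply: (@sg_par 0); ring.
  + by apply: (@sg_par (k * j - k)); ring.
  + by apply: (@sg_par k); ring.
- move=> U V W UW VW i j i' ij m0 hUV hVW hUW hUWVW eUW eVW e1 e2 e3 e4 x y m e.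
  rewrite comb2 scale1r scaleN1r /=.
  rewrite !(TMuZl, TMuZr, TMuDl, TMuDr, TIotaD, TIotaZ) !(toQZ, toQD).
  rewrite (toQ_mu1_iota hUV hVW hUW hUWVW eUW eVW _ _ (deg_mul e3 erefl) (deg_iota e4 e)).
  rewrite (toQ_mu1_iota hUV hVW hUW hUWVW eUW eVW _ _ (deg_mur e3 erefl) (deg_iota e4 e)).
  rewrite !scalerDr !scalerA; apply/eqP; rewrite subr_eq0; apply/eqP.
  congr (_ *: _ + _ *: _); rewrite -!sgD; subst i'.
  by apply: (@sg_par (- k)); ring.
- move=> U V W UW UV i j j' ij m0 hWV hUV hUW hUWUV eUW eUV e1 e2 e3 e4 x y m e.
  rewrite comb2 scaleN1r /=.
  rewrite !(TMuZl, TMuZr, TMuDl, TMuDr, TIotaD, TIotaZ) !(toQZ, toQD).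
  rewrite (toQ_mu2_iota hWV hUV hUW hUWUV eUW eUV _ _ (deg_mul e3 erefl) (deg_iota e4 e)).
  rewrite (toQ_mu2_iota hWV hUV hUW hUWUV eUW eUV _ _ (deg_mur e3 erefl) (deg_iota e4 e)).
  rewrite !scalerDr !scalerA; apply/eqP; rewrite subr_eq0; apply/eqP.
  congr (_ *: _ + _ *: _); rewrite -!sgD.
  + by apply: (@sg_par i); ring.
  + by apply: (@sg_par i); ring.
Qed.

Definition Qinf X Y k (a : hom0 X Y) (b : homd k X Y) : homd k (Qc X) (Qc Y) :=
  fun V n m e => plin (@Qinf_compat X Y k a b V n m e).

End Corelations.

Arguments inl0 {R M X Y} V n.
Arguments inlc {R M X Y V n} x.
Arguments inrc {R M X Y V n} y.
Arguments inr_rootQ {R M X} V n.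

(** * Naturality of the projection to the corelations *)

Section CorelMap.
Variables (R : realType) (M : topologicalType).
Implicit Types (X Y Z : coll R M) (U V W : opens M) (n m k : int).

Lemma Qmap_toQ X Y (f : hom0 X Y) V n z :
  Qmap f V n (toQ V n z) = toQ V n (Tmap f V n z).
Proof.
move: z; apply: (lin_ext (f := Qmap f V n \o toQ V n) (g := toQ V n \o Tmap f V n)) => t /=.
by rewrite toQ_gen Tmap_gen; exact: plinE.
Qed.

Lemma Qinf_toQ X Y k (a : hom0 X Y) (b : homd k X Y) V n m (e : m = n + k) z :
  Qinf a b V e (toQ V n z) = toQ V m (infmap a b V e z).
Proof.
move: z; apply: (lin_ext (f := Qinf a b V e \o toQ V n) (g := toQ V m \o infmap a b V e)) => t /=.
by rewrite toQ_gen infmap_gen; exact: plinE.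
Qed.

Lemma Qc_ind Y V n (P : Qc Y V n -> Prop) :
  (forall z, P (toQ V n z)) -> forall q, P q.
Proof.
move=> H q; rewrite -[q]preprK pclass_comb.
have -> : comb pgen (prepr q) = toQ V n (comb pgen (prepr q)) :> Qc Y V n.
  by rewrite -comb_linear; apply: eq_bigr => p _ /=; rewrite toQ_gen.
exact: H.
Qed.

Lemma Qmap_comp X Y Z (c : hom0 Y Z) (a : hom0 X Y) (ca : hom0 X Z) :
  (forall V n x, ca V n x = c V n (a V n x)) ->
  forall V n q, Qmap c V n (Qmap a V n q) = Qmap ca V n q.
Proof.
move=> H V n; apply: Qc_ind => z.
by rewrite !Qmap_toQ (Tmap_comp H).
Qed.

Lemma Qmap_id X (a : hom0 X X) :
  (forall V n x, a V n x = x) -> forall V n q, Qmap a V n q = q.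
Proof. by move=> H V n; apply: Qc_ind => z; rewrite Qmap_toQ Tmap_id. Qed.

Lemma rootQ_Tmap X Y (f : hom0 X Y) V n z :
  rootQ V n (Tmap f V n z) = Qmap (Tmap f) V n (rootQ V n z).
Proof. by rewrite /rootQ /= Delta_nat Qmap_toQ. Qed.

Lemma rootQ_Delta X V n (z : Tc X V n) :
  rootQ V n (Delta V n z) = Qmap (@Delta R M X) V n (rootQ V n z).
Proof. by rewrite /rootQ /= Delta_coassoc Qmap_toQ. Qed.

Lemma corelE X V n (z : Tc X V n) :
  corelmap V n z = inf0 inl0 inr_rootQ V n (Delta V n z).
Proof. by []. Qed.

Definition fstc X Y : hom0 (sumc X Y) X := fun V n => fst.
Definition sndc X Y : hom0 (sumc X Y) Y := fun V n => snd.
Definition inr0 X Y : hom0 Y (sumc X Y) := fun V n => @inrc R M X Y V n.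

Arguments fstc {X Y} V n.
Arguments sndc {X Y} V n.
Arguments inr0 {X Y} V n.

Definition copair X Y Z (f : hom0 X Z) (g : hom0 Y Z) : hom0 (sumc X Y) Z :=
  fun V n => (f V n \o fstc V n) \+ (g V n \o sndc V n).

Lemma copair_inl X Y Z (f : hom0 X Z) (g : hom0 Y Z) V n x :
  copair f g V n (inlc x) = f V n x.
Proof. by rewrite /copair /= linear0 addr0. Qed.

Lemma copair_inr X Y Z (f : hom0 X Z) (g : hom0 Y Z) V n x :
  copair f g V n (inrc x) = g V n x.
Proof. by rewrite /copair /= linear0 add0r. Qed.

Definition smapc X Y X' Y' (f : hom0 X X') (g : hom0 Y Y') : hom0 (sumc X Y) (sumc X' Y') :=
  copair (hcomp inl0 f) (hcomp inr0 g).

Lemma corel_Tmap X Y (f : hom0 X Y) V n z :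
  corelmap V n (Tmap f V n z) = Tmap (smapc (Tmap f) (Qmap (Tmap f))) V n (corelmap V n z).
Proof.
rewrite !corelE Delta_nat.
rewrite (inf0_Tmap (cf := hcomp inl0 (Tmap f)) (df := hcomp inr_rootQ (Tmap f))) //.
rewrite (Tmap_inf0 (fc := hcomp inl0 (Tmap f)) (fd := hcomp inr_rootQ (Tmap f))) //.
- by move=> {z}V {}n x; rewrite [RHS]copair_inl.
- move=> {z}V {}n x; rewrite [RHS]copair_inr /hcomp /= /inr_rootQ /=.
  by congr inrc; exact: rootQ_Tmap.
Qed.

Lemma corel_Delta X V n (z : Tc X V n) :
  corelmap V n (Delta V n z)
  = Tmap (smapc (@Delta R M X) (Qmap (@Delta R M X))) V n (corelmap V n z).
Proof.
rewrite !corelE Delta_coassoc.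
rewrite (inf0_Tmap (cf := hcomp inl0 (@Delta R M X)) (df := hcomp inr_rootQ (@Delta R M X))) //.
rewrite (Tmap_inf0 (fc := hcomp inl0 (@Delta R M X)) (fd := hcomp inr_rootQ (@Delta R M X))) //.
- by move=> {z}V {}n x; rewrite [RHS]copair_inl.
- move=> {z}V {}n x; rewrite [RHS]copair_inr /hcomp /= /inr_rootQ /=.
  by congr inrc; exact: rootQ_Delta.
Qed.

(** A two-vertex piece of a vertex of [Delta x] is a two-vertex piece of [x]. *)
Lemma inf0_corel X V n (z : Tc X V n) :
  inf0 inl0 (hcomp inr0 (@corelmap R M X)) V n (Delta V n z)
  = inf0 (hcomp inl0 (hcomp fstc (@eps R M _))) inr0 V n
      (Delta V n (corelmap V n z)).
Proof.
rewrite [in RHS]corelE Delta_inf0 Delta_coassoc.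
rewrite (inf0_Tmap (cf := hcomp (Tmap inl0) (@Delta R M X)) (df := @corelmap R M X)) //.
apply/esym/inf_inf0.
- move=> V' n' x; rewrite /hcomp /= eps_Tmap eps_Delta.
  by [].
- move=> V' n' m e x.
  by move: e (etrans e (addr0 _)) => /[swap] E; subst m => e; rewrite !homd_of_hom0E.
- move=> V' n' x; rewrite /hcomp /= eps_inf0 /inr_rootQ /=.
  exact: (linear0 (inl0 V' n')).
Qed.

(** By [inf0_corel], marking the corelations inside one upper piece of [Delta z] already gives zero;
    hence so does any map that factors through this marking. *)
Lemma inf_corel X Y k (a : hom0 (Tc X) Y) (c : homd k _ Y) V n m (e : m = n + k) (z : Tc X V n) :
  corelmap V n z = 0 ->
  infmap a (hcompr c (@corelmap R M X)) V e (Delta V n z) = 0.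
Proof.
move=> z0; have := inf0_corel z; rewrite z0 !linear0 => J.
rewrite -(inf_inf0 (c := inl0) (d := hcomp inr0 (@corelmap R M X))
  (a := hcomp a fstc) (b := hcompr c sndc)) ?J ?linear0 //.
by move=> *; rewrite /hcomp /= linear0.
Qed.

End CorelMap.

Arguments fstc {R M X Y} V n.
Arguments sndc {R M X Y} V n.
Arguments inr0 {R M X Y} V n.

(** * Kernels *)

Section Split.
Variables (R : realType).

(** Zorn's lemma on the graphs of partial linear maps from [W] to [V] that are sections of [f]
    wherever they meet its image. The composite of [f] followed by [g] is then an idempotent with
    the same kernel as [f], which is how kernels are split below. *)
Lemma gen_inverse (V W : lmodType R) (f : {linear V -> W}) :
  exists g : {linear W -> V}, forall x, f (g (f x)) = f x.
Proof.
pose P (G : set (W * V)%type) := [/\ forall a p q, G p -> G q -> G (a *: p + q),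
  forall v, G (0, v) -> v = 0 & forall p x, G p -> p.1 = f x -> f p.2 = p.1].
have [F FP Ftot|A [[AD A0 Af] Amax]] := @Zorn_bigcup (W * V)%type P.
  split.
  - move=> a p q [G FG Gp] [H FH Hq].
    have [GH|HG] := Ftot _ _ FG FH.
      by exists H => //; have [+ _ _] := FP _ FH; apply => //; exact: GH.
    by exists G => //; have [+ _ _] := FP _ FG; apply => //; exact: HG.
  - by move=> v [G FG Gv]; have [_ + _] := FP _ FG; apply.
  - by move=> p x [G FG Gp]; have [_ _ +] := FP _ FG; apply.
(* The empty set satisfies [P], so that the origin belongs to [A] has to be drawn from
   maximality. *)
have A00 : A (0, 0).
  apply: contrapT => nA; apply: (Amax [set (0, 0)]).
    split; last by move=> /(_ (0, 0) erefl).
    move=> p Ap; exfalso; apply: nA.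
    by have := AD (-1) _ _ Ap Ap; rewrite scaleN1r addNr.
  split.
  - by move=> a p q -> ->; rewrite scaler0 addr0.
  - by move=> v [->].
  - by move=> p x -> _; rewrite linear0.
have AZ a p : A p -> A (a *: p) by move=> Ap; rewrite -[X in A X]addr0; exact: AD.
have total w : exists v, A (w, v).
  apply: contrapT => /forallNP nA.
  have [v0 Hv0] : exists v0, forall q a x, A q -> q.1 + a *: w = f x ->
      f (q.2 + a *: v0) = q.1 + a *: w.
    (* The value at [w] is forced, up to the kernel of [f], as soon as some translate of [w] by the
       domain of [A] lies in the image of [f]. Otherwise no constraint involves [w], and 0 will
       do. *)
    have [[p [u [Ap pu]]]|none] := pselect (exists p u, A p /\ p.1 + w = f u).
      exists (u - p.2) => q a x Aq qx.
      have Aqp : A (- a *: p + q) by exact: AD.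
      have E : (- a *: p + q).1 = f (x - a *: u).
        rewrite [LHS]/= linearB linearZ -qx -pu [in RHS]/= scalerDr opprD scaleNr.
        by rewrite [RHS]addrACA subrr addr0 addrC.
      have -> : q.2 + a *: (u - p.2) = (- a *: p + q).2 + a *: u.
        by rewrite /= scalerBr scaleNr addrCA addrC [q.2 + _]addrC.
      rewrite linearD (Af _ _ Aqp E) linearZ -pu /= scalerDr scaleNr.
      by rewrite addrA [- _ + _]addrC subrK.
    exists 0 => q a x Aq qx; rewrite scaler0 addr0.
    have [a0|a0] := eqVneq a 0.
      by move: qx; rewrite a0 scale0r addr0; exact: Af.
    exfalso; apply: none; exists (a^-1 *: q), (a^-1 *: x); split; first exact: AZ.
    by rewrite [RHS]linearZ -qx /= scalerDr scalerA mulVf // scale1r.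
  apply: (Amax [set p | exists q a, A q /\ p = q + a *: (w, v0)]).
    split; last first.
      move=> /(_ (w, v0)) AA; apply: (nA v0); apply: AA.
      by exists (0, 0), 1; split=> //; rewrite scale1r add0r.
    by move=> p Ap; exists p, 0; rewrite scale0r addr0.
  split.
  - move=> a _ _ [q [b [Aq ->]]] [q' [b' [Aq' ->]]].
    exists (a *: q + q'), (a * b + b'); split; first exact: AD.
    by rewrite scalerDr scalerA scalerDl addrACA.
  - move=> v [[q1 q2] [a [Aq [/esym q0 vE]]]].
    have [a0|a0] := eqVneq a 0.
      move: q0 vE Aq; rewrite a0 !scale0r !addr0 => -> -> /A0; exact.
    exfalso; apply: (nA (- a^-1 *: q2)).
    suff -> : w = - a^-1 *: q1 by exact: AZ _ _ Aq.
    move/eqP: q0; rewrite addr_eq0 => /eqP ->.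
    by rewrite scalerN scaleNr opprK scalerA mulVf // scale1r.
  - by move=> _ x [q [a [Aq ->]]] /=; exact: Hv0.
have {total}[g Ag] := choice total.
have funA w v v' : A (w, v) -> A (w, v') -> v = v'.
  move=> Av Av'; apply/eqP; rewrite -subr_eq0; apply/eqP/A0.
  have := AD (-1) _ _ Av' Av; rewrite scaleN1r.
  by have -> : - (w, v') + (w, v) = (0, v - v') by rewrite [v - v']addrC -(addNr w).
have glin : linear g.
  by move=> a x y; apply: (funA (a *: x + y)) => //; exact: (AD a (x, g x) (y, g y)).
pose gL : {linear W -> V} := HB.pack g (GRing.isLinear.Build R _ _ _ g glin).
exists gL => x /=.
exact: (Af (f x, g (f x)) x).
Qed.

End Split.

(** * Counting leaves, and kernels of maps applied to all leaves *)

Section TensorKernel.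
Variables (R : realType) (M : topologicalType).
Implicit Types (X Y Z : coll R M) (U V W : opens M) (n m k : int).

Lemma gen_inverse_coll X Y (f : hom0 X Y) :
  exists g : hom0 Y X, forall V n x, f V n (g V n (f V n x)) = f V n x.
Proof.
have H V n := cid (gen_inverse (f V n)).
by exists (fun V n => projT1 (H V n)) => V n; exact: projT2 (H V n).
Qed.

Section Projector.
Variables (X : coll R M) (p q : hom0 X X).
Hypothesis pq : forall V n x, p V n x + q V n x = x.
Hypothesis pp : forall V n x, p V n (p V n x) = p V n x.

Let p_q V n x : p V n (q V n x) = 0.
Proof. by apply: (addrI (p V n (p V n x))); rewrite -linearD pq addr0 pp. Qed.

Let q_p V n x : q V n (p V n x) = 0.
Proof. by apply: (addrI (p V n (p V n x))); rewrite pq addr0 pp. Qed.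

Let q_q V n x : q V n (q V n x) = q V n x.
Proof. by rewrite -[in RHS](pq x) linearD q_p add0r. Qed.

(** [c.2] is an eigenvector of the derivation counting the leaves in the image
    of [q], for the eigenvalue [c.1]. *)
Definition leaf_eigen V n (c : nat * Tc X V n) :=
  inf0 (hid X) q V n c.2 = c.1%:R *: c.2 /\ Tmap p V n c.2 = (c.1 == 0%N)%:R *: c.2.

(** Expanding every leaf [x] as [p x + q x] gives trees whose leaves each lie in one of the two
    images. The eigenvalue is the number of leaves in the image of [q], additive under [TMu]. *)
Lemma leaf_eigen_dec V n (z : Tc X V n) :
  exists2 s : seq (nat * Tc X V n), z = \sum_(c <- s) c.2 & {in s, forall c, leaf_eigen c}.
Proof.
have idX V' n' z' : Tmap (hid X) V' n' z' = z' by apply: Tmap_id.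
move: V n z; apply: Tc_ind => [V n|V n a x y|V n x|U V n m h e z|U V W n1 n2 m hd hu e z w].
- by exists [::]; rewrite ?big_nil.
- move=> [s -> hs] [t -> ht]; exists ([seq (c.1, a *: c.2) | c <- s] ++ t).
    by rewrite big_cat big_map scaler_sumr.
  move=> c; rewrite mem_cat => /orP[/mapP[d /hs[d1 d2] ->]|/ht //].
  by split=> /=; rewrite linearZ /= ?d1 ?d2 !scalerA mulrC.
- exists [:: (0%N, tleaf (p V n x)); (1%N, tleaf (q V n x))].
    by rewrite big_cons big_seq1 /= -tleafD pq.
  move=> c; rewrite !inE => /orP[]/eqP-> ; split; rewrite /= ?inf0_leaf ?Tmap_leaf.
  - by rewrite q_p tleaf0 scale0r.
  - by rewrite pp scale1r.
  - by rewrite q_q scale1r.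
  - by rewrite p_q tleaf0 scale0r.
- move=> [s -> hs]; exists [seq (c.1, TIota h e c.2) | c <- s].
    by rewrite big_map linear_sum.
  move=> c /mapP[d /hs[d1 d2] ->]; split=> /=.
    by rewrite inf0_iota d1 TIotaZ.
  by rewrite Tmap_iota d2 TIotaZ.
- move=> [s -> hs] [t -> ht].
  exists [seq ((c.1 + d.1)%N, TMu hd hu e c.2 d.2) | c <- s, d <- t].
    rewrite big_allpairs_dep /=.
    have -> : \sum_(c <- s) c.2 = comb (fun x => x) [seq (1, c.2) | c <- s].
      by rewrite /comb big_map; apply: eq_bigr => c _; rewrite scale1r.
    rewrite TMu_combl big_map; apply: eq_bigr => c _ /=.
    by rewrite scale1r linear_sum.
  move=> _ /allpairsP[[c d] /= [/hs[c1 c2] /ht[d1 d2] ->]]; split=> /=.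
    by rewrite inf0_mu !idX c1 d1 TMuZl TMuZr -scalerDl natrD.
  rewrite Tmap_mu c2 d2 TMuZl TMuZr scalerA -natrM addn_eq0.
  by case: (c.1 == 0%N); case: (d.1 == 0%N).
Qed.

(** Hence the derivation is semisimple, and [Tmap p] is the projection onto
    its kernel. *)
Lemma Tmap_inf0_ker V n (z : Tc X V n) : inf0 (hid X) q V n z = 0 -> Tmap p V n z = z.
Proof.
have [s zE hs] := leaf_eigen_dec z => Nz.
(* Since the derivation kills [z], each operator [1 - k^-1 N], with [N] the derivation, fixes [z].
   Taking for [ks] the nonzero eigenvalues makes the product vanish on all components but those of
   eigenvalue 0; inverting [k] uses characteristic 0. *)
have claim ks : \sum_(c <- s) (\prod_(k <- ks) (1 - k%:R^-1 * c.1%:R)) *: c.2 = z.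
  elim: ks => [|k ks IH].
    by rewrite [in RHS]zE; apply: eq_bigr => c _; rewrite big_nil scale1r.
  have -> : z = z - k%:R^-1 *: inf0 (hid X) q V n z.
    by rewrite Nz scaler0 subr0.
  rewrite -[in RHS]IH [inf0 _ _ _ _ _]linear_sum scaler_sumr.
  rewrite -sumrB !big_seq; apply: eq_bigr => c /hs[c1 _].
  rewrite big_cons [inf0 _ _ _ _ (_ *: _)]linearZ /= c1 !scalerA -scalerBl; congr (_ *: _).
  by rewrite mulrBl mul1r; congr (_ - _); rewrite mulrAC mulrA.
rewrite -[in RHS](claim [seq c.1 | c <- s & c.1 != 0%N]) [in LHS]zE linear_sum.
rewrite !big_seq; apply: eq_bigr => c cs; have [_ ->] := hs _ cs; congr (_ *: _).
have [c0|c0] := eqVneq c.1 0%N.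
  by rewrite c0 big1 // => k _; rewrite mulr0 subr0.
apply/esym/eqP; rewrite prodf_seq_eq0; apply/hasP; exists c.1.
  by apply/mapP; exists c; rewrite // mem_filter c0.
by rewrite /= mulVf ?subrr // pnatr_eq0.
Qed.

End Projector.

Definition hker X Y (f : hom0 X Y) : coll R M := fun V n => Defs.kernel (f V n).
Definition hkval X Y (f : hom0 X Y) : hom0 (hker f) X := fun V n => @kval _ _ _ _.

(** T^c(E[1]) preserves kernels: it is enough that each leaf separately is killed. *)
Lemma Tc_kernel X Y (f : hom0 X Y) V n (z : Tc X V n) :
  inf0 inl0 (hcomp inr0 f) V n z = 0 -> exists y, Tmap (hkval f) V n y = z.
Proof.
move=> Hz; have [g fgf] := gen_inverse_coll f.
pose q := hcomp g f.
pose p : hom0 X X := fun V n => idfun \- q V n.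
have Hp V' n' (x : X V' n') : p V' n' x = x - g V' n' (f V' n' x) by [].
have fp V' n' (x : X V' n') : p V' n' x \in in_kernel (f V' n').
  by rewrite inE Hp linearB fgf subrr.
pose rho0 V' n' (x : X V' n') : hker f V' n' := Defs.Kernel (fp V' n' x).
have rho_lin V' n' : linear (@rho0 V' n').
  by move=> a x y; apply: val_inj; rewrite [RHS]linearP; exact: (linearP (p V' n')).
pose rho : hom0 X (hker f) := fun V' n' =>
  (HB.pack (@rho0 V' n') (GRing.isLinear.Build R _ _ _ (@rho0 V' n') (rho_lin V' n'))
    : {linear X V' n' -> hker f V' n'}).
exists (Tmap rho V n z); rewrite (Tmap_comp (ca := p)) //.
apply: (@Tmap_inf0_ker _ p q).
- by move=> V' n' x; rewrite Hp subrK.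
- by move=> V' n' x; rewrite !Hp linearB fgf subrr linear0 subr0.
(* Applying [g] to the marked leaf turns the hypothesis into the vanishing of the derivation that
   counts leaves in the image of [q]. *)
have := congr1 (Tmap (copair (hid X) g) V n) Hz; rewrite linear0 => <-.
apply/esym/Tmap_inf0.
- by move=> V' n' x; rewrite [RHS]copair_inl.
- by move=> V' n' x; rewrite [RHS]copair_inr.
Qed.

End TensorKernel.

Lemma kernel0 (R : realType) (V W : lmodType R) (f : {linear V -> W})
    (x : Defs.kernel f) : f (Defs.kval x) = 0.
Proof. by have := Defs.kvalP x; rewrite inE => /eqP. Qed.

Lemma mem_kernel (R : realType) (V W : lmodType R) (f : {linear V -> W}) x :
  f x = 0 -> x \in in_kernel f.
Proof. by move=> fx; rewrite inE fx. Qed.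

(** * The Koszul dual is closed under the comultiplication *)

Section Coproduct.
Variables (R : realType) (M : topologicalType).
Implicit Types (X Y Z : coll R M) (U V W : opens M) (n m k : int).

Lemma coproduct_ex X V n (x : Disj_koszul X V n) : exists y, coproduct x y.
Proof.
have x0 : corelmap V n (Defs.incl V n x) = 0 by exact: (kernel0 x).
have [y yE] : exists y, Tmap (hkval (@corelmap R M X)) V n y = Delta V n (Defs.incl V n x).
  by apply: Tc_kernel; rewrite inf0_corel x0 !linear0.
have y0 : corelmap V n y = 0.
  (* A left inverse [g] of the inclusion of the kernel induces left inverses on trees and on the
     quotient by the corelations. The vanishing can thus be tested after including the leaves in
     [Tc X], where it follows from [corel_Delta]. *)
  have [g Hg] := gen_inverse_coll (hkval (@corelmap R M X)).
  have gK V' n' (u : hker (@corelmap R M X) V' n') : g V' n' (hkval (@corelmap R M X) V' n' u) = u.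
    by apply: val_inj; exact: Hg.
  have gTK V' n' u : Tmap g V' n' (Tmap (hkval (@corelmap R M X)) V' n' u) = u.
    by rewrite (Tmap_comp (ca := hid _)) //; exact: Tmap_id.
  have := corel_Tmap (hkval (@corelmap R M X)) y.
  rewrite yE corel_Delta x0 linear0 => /esym.
  move=> /(congr1 (Tmap (smapc (Tmap g) (Qmap (Tmap g))) V n)); rewrite linear0 => <-.
  rewrite (Tmap_comp (ca := hid _)) ?Tmap_id //.
  move=> V' n' [u v]; rewrite /smapc /copair /= !linearD /= !linear0 !addr0 !add0r.
  rewrite gTK (Qmap_comp (ca := hid _)) ?Qmap_id //.
  by congr (_, _); rewrite /= ?addr0 ?add0r.
by exists (Defs.Kernel (mem_kernel y0)).
Qed.

(** Over a field, a map vanishing on the Koszul dual factors through [corelmap]. *)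
Lemma inf_corel0 X Y k (a : hom0 (Tc X) Y) (c : homd k (Tc X) Y) :
  (forall V n m (e : m = n + k) z, corelmap V n z = 0 -> c V n m e z = 0) ->
  forall V n m (e : m = n + k) z, corelmap V n z = 0 ->
  infmap a c V e (Delta V n z) = 0.
Proof.
move=> Hc V n m e z z0; have [g Hg] := gen_inverse_coll (@corelmap R M X).
rewrite -[RHS](inf_corel a (hcompr c g) e z0); apply: inf_ext => // V' n' m' e' u.
apply/eqP; rewrite -subr_eq0 -linearB; apply/eqP/Hc.
by rewrite (linearB (corelmap V' n')) Hg subrr.
Qed.

Lemma rootQ_corel X V n (z : Tc X V n) : corelmap V n z = 0 -> rootQ V n z = 0.
Proof.
move=> z0; have : sndc V n (eps V n (corelmap V n z)) = 0 by rewrite z0 !linear0.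
by rewrite corelE eps_inf0 eps_Delta.
Qed.

Definition coder_square X (d : homd 1 (Tc X) X) : homd (1 + 1) (Tc X) X :=
  fun V n m e => d V (n + 1) m (etrans e (addrA n 1 1)) \o coder d V erefl.

Lemma coder_squareE X (d : homd 1 (Tc X) X) V n m p (e : m = n + 1) (e' : p = m + 1)
    (e'' : p = n + (1 + 1)) z :
  coder_square d V e'' z = d V m p e' (coder d V e z).
Proof. by subst m; rewrite /coder_square /= (eq_irrelevance e' (etrans e'' (addrA n 1 1))). Qed.

End Coproduct.

(** * The Maurer-Cartan equation *)

Section BinaryAlgebras.
Variables (R : realType) (M : topologicalType).
Implicit Types (X Y Z : coll R M) (U V W UV UW VW T : opens M) (n m k : int).

(** Algebras in graded modules over the operad presented by the generators
    [iota_U^V] and [mu_(U,V)] and the relations of Disj_M. *)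
Record balg X := Balg {
  ia : forall U V n m, U `<` V -> m = n -> {linear X U n -> X V m};
  ma : forall U V W n1 n2 m, U `&` V = set0 -> W = U `|` V :> set M ->
    m = n1 + n2 -> X U n1 -> X V n2 -> X W m;
  ma_linl : forall U V W n1 n2 m hd hu e y, linear (fun x => @ma U V W n1 n2 m hd hu e x y);
  ma_linr : forall U V W n1 n2 m hd hu e x, linear (@ma U V W n1 n2 m hd hu e x);
  ma_flip : forall U V W n1 n2 m hd hd' hu hu' e e' x y,
    @ma U V W n1 n2 m hd hu e x y = sg R (n1 * n2) *: @ma V U W n2 n1 m hd' hu' e' y x;
  ia_ia : forall U V W n n' m (h : U `<` V) (h' : V `<` W) (h'' : U `<` W)
    (e : n' = n) (e' : m = n') (e'' : m = n) (x : X U n),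
    ia h' e' (ia h e x) = ia h'' e'' x;
  ma_ma12 : forall U V W UV VW T i j k ij jk m hUV hVW hUVW hUVW' eUV eVW eT eT' e1 e2 e3 e4 x y z,
    @ma UV W T ij k m hUVW eT e2 (@ma U V UV i j ij hUV eUV e1 x y) z
    = @ma U VW T i jk m hUVW' eT' e4 x (@ma V W VW j k jk hVW eVW e3 y z);
  ma_ma11 : forall U V W UV UW T i j k ij ik m hUV hUW hUVW hUWV eUV eUW eT eT' e1 e2 e3 e4 x y z,
    @ma UV W T ij k m hUVW eT e2 (@ma U V UV i j ij hUV eUV e1 x y) z
    = sg R (j * k) *: @ma UW V T ik j m hUWV eT' e4 (@ma U W UW i k ik hUW eUW e3 x z) y;
  ma_ial : forall U V W UW VW i i' j ij m (hUV : U `<` V) hVW hUW (hUWVW : UW `<` VW)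
      eUW eVW (e1 : i' = i) e2 e3 (e4 : m = ij) (x : X U i) y,
    @ma V W VW i' j m hVW eVW e2 (ia hUV e1 x) y
    = ia hUWVW e4 (@ma U W UW i j ij hUW eUW e3 x y);
  ma_iar : forall U V W UW UV i j j' ij m (hWV : W `<` V) hUV hUW (hUWUV : UW `<` UV)
      eUW eUV (e1 : j' = j) e2 e3 (e4 : m = ij) x (y : X W j),
    @ma U V UV i j' m hUV eUV e2 x (ia hWV e1 y)
    = ia hUWUV e4 (@ma U W UW i j ij hUW eUW e3 x y)
}.

Section Theta.
Variables (X : coll R M) (P : balg X).

Lemma maDl U V W n1 n2 m hd hu e x x' y :
  @ma X P U V W n1 n2 m hd hu e (x + x') y = ma P hd hu e x y + ma P hd hu e x' y.
Proof. by have := ma_linl P hd hu e y 1 x x'; rewrite !scale1r. Qed.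

Lemma ma0l U V W n1 n2 m hd hu e y : @ma X P U V W n1 n2 m hd hu e 0 y = 0.
Proof. by apply: (addrI (ma P hd hu e 0 y)); rewrite -maDl !addr0. Qed.

Lemma maZl U V W n1 n2 m hd hu e a x y :
  @ma X P U V W n1 n2 m hd hu e (a *: x) y = a *: ma P hd hu e x y.
Proof. by have := ma_linl P hd hu e y a x 0; rewrite ma0l !addr0. Qed.

Lemma maDr U V W n1 n2 m hd hu e x y y' :
  @ma X P U V W n1 n2 m hd hu e x (y + y') = ma P hd hu e x y + ma P hd hu e x y'.
Proof. by have := ma_linr P hd hu e x 1 y y'; rewrite !scale1r. Qed.

Lemma ma0r U V W n1 n2 m hd hu e x : @ma X P U V W n1 n2 m hd hu e x 0 = 0.
Proof. by apply: (addrI (ma P hd hu e x 0)); rewrite -maDr !addr0. Qed.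

Lemma maZr U V W n1 n2 m hd hu e a x y :
  @ma X P U V W n1 n2 m hd hu e x (a *: y) = a *: ma P hd hu e x y.
Proof. by have := ma_linr P hd hu e x a y 0; rewrite ma0r !addr0. Qed.

Lemma comb_mal (S : Type) U V W n1 n2 m hd hu e (g : S -> X U n1) y s :
  comb (fun t => @ma X P U V W n1 n2 m hd hu e (g t) y) s = ma P hd hu e (comb g s) y.
Proof.
elim: s => [|p s IH]; rewrite /comb ?big_nil ?ma0l //.
by rewrite !big_cons maDl maZl -IH.
Qed.

Lemma comb_mar (S : Type) U V W n1 n2 m hd hu e x (g : S -> X V n2) s :
  comb (fun t => @ma X P U V W n1 n2 m hd hu e x (g t)) s = ma P hd hu e x (comb g s).
Proof.
elim: s => [|p s IH]; rewrite /comb ?big_nil ?ma0r //.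
by rewrite !big_cons maDr maZr -IH.
Qed.

(** The twisting morphism T^c(E[1]) -> E[1] -> Disj_M, composed with the action. *)
Definition thetat V n (t : tree X V n) : forall m, m = n + 1 -> X V m :=
  match t in tree _ V n return forall m, m = n + 1 -> X V m with
  | Leaf _ _ _ => fun _ _ => 0
  | Iota _ _ _ _ h e0 t1 => fun m e => ia P h (deg_contract e0 e) (epst t1)
  | Mu _ _ _ _ _ _ hd hu e0 t1 t2 => fun m e =>
      ma P hd hu (deg_contract e0 e) (epst t1) (epst t2)
  end.

Lemma thetat_compat V n m (e : m = n + 1) :
  compat (@treerel R M X V n) (fun t => thetat t e).
Proof.
move=> r hr; case: hr m e => {V n r}.
- by move=> V n a x y m e; rewrite comb3 !scaler0 !addr0.
- move=> U V W n1 n2 m hd hd' hu hu' e e' t1 t2 p e''; rewrite comb2 scale1r scaleNr /=.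
  by rewrite (ma_flip P hd hd' hu hu' _ (deg_contract e' e'')) subrr.
- move=> U V n m h e r hr p e'; rewrite comb_smap.
  by rewrite (comb_linear (ia P h (deg_contract e e')) (@epst R M X U n)) epst_compat ?linear0.
- move=> U V W n1 n2 m hd hu e r t2 hr p e'; rewrite comb_smap.
  by rewrite comb_mal epst_compat ?ma0l.
- move=> U V W n1 n2 m hd hu e t1 r hr p e'; rewrite comb_smap.
  by rewrite comb_mar epst_compat ?ma0r.
Qed.

Definition theta : homd 1 (Tc X) X := fun V n m e => plin (@thetat_compat V n m e).

Lemma theta_gen V n m (e : m = n + 1) t : theta V e (pgen t) = thetat t e.
Proof. exact: plinE. Qed.

Lemma theta_leaf V n m (e : m = n + 1) (x : X V n) : theta V e (tleaf x) = 0.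
Proof. exact: plinE. Qed.

Lemma theta_iota U V n m p (h : U `<` V) (e : m = n - 1) (e' : p = m + 1)
    (e'' : p = n) (z : Tc X U n) :
  theta V e' (TIota h e z) = ia P h e'' (eps U n z).
Proof.
move: z; apply: (plin_TIota (f := theta V e') (g := ia P h e'' \o eps U n)) => t.
by rewrite theta_gen /= eps_gen (eq_irrelevance (deg_contract e e') e'').
Qed.

Lemma theta_mu U V W n1 n2 m p (hd : U `&` V = set0) (hu : W = U `|` V :> set M)
    (e : m = n1 + n2 - 1) (e' : p = m + 1) (e'' : p = n1 + n2) (z : Tc X U n1) (w : Tc X V n2) :
  theta W e' (TMu hd hu e z w) = ma P hd hu e'' (eps U n1 z) (eps V n2 w).
Proof.
move: z w; apply: (plin_TMu (f := theta W e')
  (g := fun z w => ma P hd hu e'' (eps U n1 z) (eps V n2 w))).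
- by move=> y a z w; rewrite linearP maDl maZl.
- by move=> y a z w; rewrite linearP maDr maZr.
- by move=> t1 t2; rewrite theta_gen !eps_gen /= (eq_irrelevance (deg_contract e e') e'').
Qed.

Lemma epst_weight V n (t : tree X V n) : weight t <> 0%N -> epst t = 0.
Proof. by case: t. Qed.

Lemma theta_weight V n m (e : m = n + 1) (t : tree X V n) :
  weight t <> 1%N -> theta V e (pgen t) = 0.
Proof.
rewrite theta_gen; case: t m e => {V n} [V n x|U V n p h e0 t|U V W n1 n2 p hd hu e0 t1 t2] m e //= H.
  by rewrite epst_weight ?linear0 // => w0; apply: H; rewrite w0.
have [w1|/eqP w1] := eqVneq (weight t1) 0%N; last by rewrite epst_weight // ma0l.
have [w2|/eqP w2] := eqVneq (weight t2) 0%N; last by rewrite [X in ma _ _ _ _ _ X]epst_weight // ma0r.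
by case: H; rewrite w1 w2.
Qed.

(** The curvature of [theta]: the components of [theta * theta + theta o d] on
    the trees with two vertices. *)
Definition curv := coder_square theta.

Lemma curv_leaf V n m (e : m = n + (1 + 1)) (x : X V n) : curv V e (tleaf x) = 0.
Proof.
by rewrite /curv (coder_squareE _ erefl (etrans e (addrA n 1 1))) coder_leaf theta_leaf.
Qed.

Lemma curv_iota U V n m p q (h : U `<` V) (e : m = n - 1) (e1 : p = m + (1 + 1))
    (e2 : q = n) (e3 : p = q + 1) (e4 : p = n + 1) (z : Tc X U n) :
  curv V e1 (TIota h e z)
  = theta V e3 (contr h e2 z) - ia P h e4 (theta U erefl z).
Proof.
have mq : q = m + 1 by rewrite e2 e subrK.
rewrite (coder_squareE _ mq e3) coder_iota.
rewrite (linearB (theta V _)) (linearD (theta V _)) theta_leaf add0r.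
rewrite (theta_iota _ _ _ e4) eps_coder.
by rewrite (eq_irrelevance (deg_contract e mq) e2).
Qed.

Lemma curv_mu U V W n1 n2 m p (hd : U `&` V = set0) (hu : W = U `|` V :> set M)
    (e : m = n1 + n2 - 1) (e1 : p = m + (1 + 1)) (e2 : p = n1 + 1 + n2)
    (e3 : p = n1 + (n2 + 1)) (z : Tc X U n1) (w : Tc X V n2) :
  curv W e1 (TMu hd hu e z w)
  = - (ma P hd hu e2 (theta U erefl z) (eps V n2 w)
       + sg R n1 *: ma P hd hu e3 (eps U n1 z) (theta V erefl w)).
Proof.
rewrite (coder_squareE _ erefl (etrans e1 (addrA m 1 1))) coder_mu.
rewrite (linBDZ (theta W _)) theta_leaf add0r.
by rewrite (theta_mu _ _ _ _ e2) (theta_mu _ _ _ _ e3) !eps_coder.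
Qed.

Lemma theta_contr U V n m p (h : U `<` V) (e : m = n) (e' : p = m + 1) (t : tree X U n) :
  weight t <> 1%N -> theta V e' (contr h e (pgen t)) = 0.
Proof.
rewrite contr_gen; case: t V m p h e e' => {U n} [U n x|U U' n' n h0 e0 t|U1 U2 U n1 n2 n hd hu e0 t1 t2] V m p h e e' H.
- exact: linear0.
- by apply: theta_weight.
- exact: linear0.
Qed.

Lemma curv_weight V n m (e : m = n + (1 + 1)) (t : tree X V n) :
  weight t <> 2%N -> curv V e (pgen t) = 0.
Proof.
case: t m e => {V n} [V n x|U V n p h e0 t|U V W n1 n2 p hd hu e0 t1 t2] m e H.
- exact: curv_leaf.
- have e2 : m = n + 1 by rewrite e e0 addrA subrK.
  rewrite -TIota_gen (curv_iota _ _ _ (erefl n) e2 e2).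
  have w1 : weight t <> 1%N by move=> w1; apply: H; rewrite /= w1.
  by rewrite (theta_weight _ w1) linear0 subr0 theta_contr.
- have e2 : m = n1 + 1 + n2 by rewrite e e0 addrA subrK addrAC.
  have e3 : m = n1 + (n2 + 1) by rewrite e2 -addrA [1 + _]addrC.
  rewrite -TMu_gen (curv_mu _ _ _ _ e2 e3) !eps_gen.
  have [w1|/eqP w1] := eqVneq (weight t1) 1%N; last first.
    rewrite (theta_weight _ w1) ma0l add0r.
    have [w2|/eqP w2] := eqVneq (weight t2) 1%N; last first.
      by rewrite (theta_weight _ w2) ma0r scaler0 oppr0.
    by rewrite epst_weight ?ma0l ?scaler0 ?oppr0 // => w0; apply: H; rewrite /= w0 w2.
  rewrite (epst_weight (t := t1)) ?w1 // ma0l scaler0 addr0.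
  by rewrite epst_weight ?ma0r ?oppr0 // => w0; apply: H; rewrite /= w0 w1.
Qed.

(** Each corelation in [qR] is killed by one axiom of [balg]. For two consecutive inclusions, the
    linear term of the relation is provided by the contraction in [dphi]. *)
Lemma curv_compat V n m (e : m = n + (1 + 1)) :
  compat (@quotrel R M X V n) (fun t => curv V e (pgen t)).
Proof.
move=> r; case=> [hr|t ht ->|hr].
- by rewrite (comb_linear (curv V e) pgen) pgen_compat ?linear0.
- by rewrite /comb big_seq1 scale1r curv_weight.
case: hr m e => {V n r}.
- move=> U V W n n' m hUV hVW e1 e2 x p e.
  have e3 : p = n' + 1 by rewrite e e2 addrA subrK.
  have e4 : p = n by rewrite e3 e1 subrK.
  have e5 : n' + 1 = n by rewrite e1 subrK.
  rewrite /comb big_seq1 scale1r -!TIota_gen.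
  rewrite (curv_iota _ _ _ (erefl n') e3 e3) contr_iotaE (theta_iota _ _ _ e4).
  rewrite (theta_iota _ _ _ e5) (ia_ia P hUV hVW (subset_proper_trans hUV hVW) e5 e3 e4).
  exact: subrr.
- move=> U V W UV VW T i j k ij jk m hUV hVW hUVW hUVW' eUV eVW eT eT' e1 e2 e3 e4 x y z p e.
  have d1 : ij + 1 = i + j by rewrite e1 subrK.
  have d2 : jk + 1 = j + k by rewrite e3 subrK.
  have d3 : p = ij + 1 + k by rewrite e e2 addrA subrK addrAC.
  have d4 : p = i + (jk + 1) by rewrite d3 d1 d2 addrA.
  have d5 : p = i + 1 + jk by rewrite d4 -addrA [1 + _]addrC.
  have d6 : p = ij + (k + 1) by rewrite d3 -addrA [1 + _]addrC.
  rewrite comb2 -!TMu_gen (curv_mu _ _ _ _ d3 d6) (curv_mu _ _ _ _ d5 d4).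
  rewrite !theta_leaf ma0l ma0r scaler0 addr0 add0r !eps_leaf.
  rewrite (theta_mu _ _ _ _ d1) (theta_mu _ _ _ _ d2) !eps_leaf.
  rewrite (ma_ma12 P hUV hVW hUVW hUVW' eUV eVW eT eT' d1 d3 d2 d4).
  by rewrite scale1r scaleNr scalerN opprK scalerA sgK scale1r addNr.
- move=> U V W UV UW T i j k ij ik m hUV hUW hUVW hUWV eUV eUW eT eT' e1 e2 e3 e4 x y z p e.
  have d1 : ij + 1 = i + j by rewrite e1 subrK.
  have d2 : ik + 1 = i + k by rewrite e3 subrK.
  have d3 : p = ij + 1 + k by rewrite e e2 addrA subrK addrAC.
  have d4 : p = ik + 1 + j by rewrite d3 d1 d2 addrAC.
  have d5 : p = ij + (k + 1) by rewrite d3 -addrA [1 + _]addrC.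
  have d6 : p = ik + (j + 1) by rewrite d4 -addrA [1 + _]addrC.
  rewrite comb2 -!TMu_gen (curv_mu _ _ _ _ d3 d5) (curv_mu _ _ _ _ d4 d6).
  rewrite !theta_leaf !ma0r !scaler0 !addr0 !eps_leaf.
  rewrite (theta_mu _ _ _ _ d1) (theta_mu _ _ _ _ d2) !eps_leaf.
  rewrite (ma_ma11 P hUV hUW hUVW hUWV eUV eUW eT eT' d1 d3 d2 d4).
  by rewrite scale1r scaleNr scalerN opprK addNr.
- move=> U V W UW VW i j i' ij m hUV hVW hUW hUWVW eUW eVW e1 e2 e3 e4 x y p e.
  have d1 : i' + 1 = i by rewrite e1 subrK.
  have d2 : ij + 1 = i + j by rewrite e3 subrK.
  have d3 : p = i' + 1 + j by rewrite e e2 addrA subrK addrAC.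
  have d4 : p = i' + (j + 1) by rewrite d3 -addrA [1 + _]addrC.
  have d5 : p = ij + 1 by rewrite d3 d1 d2.
  rewrite comb2 -!TMu_gen -!TIota_gen -!TMu_gen (curv_mu _ _ _ _ d3 d4).
  rewrite (curv_iota _ _ _ (erefl ij) d5 d5) contr_mu.
  rewrite !theta_leaf !ma0r !scaler0 !addr0 !eps_leaf linear0 add0r.
  rewrite (theta_iota _ _ _ d1) (theta_mu _ _ _ _ d2) !eps_leaf.
  rewrite (ma_ial P hUV hVW hUW hUWVW eUW eVW d1 d3 d2 d5).
  by rewrite scale1r scaleN1r opprK addNr.
- move=> U V W UW UV i j j' ij m hWV hUV hUW hUWUV eUW eUV e1 e2 e3 e4 x y p e.
  have d1 : j' + 1 = j by rewrite e1 subrK.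
  have d2 : ij + 1 = i + j by rewrite e3 subrK.
  have d3 : p = i + (j' + 1) by rewrite e e2 addrA subrK addrA.
  have d4 : p = i + 1 + j' by rewrite d3 -addrA [1 + _]addrC.
  have d5 : p = ij + 1 by rewrite d3 d1 d2.
  rewrite comb2 -!TMu_gen -!TIota_gen -!TMu_gen (curv_mu _ _ _ _ d4 d3).
  rewrite (curv_iota _ _ _ (erefl ij) d5 d5) contr_mu.
  rewrite !theta_leaf !ma0l add0r !eps_leaf linear0 add0r.
  rewrite (theta_iota _ _ _ d1) (theta_mu _ _ _ _ d2) !eps_leaf.
  rewrite (ma_iar P hWV hUV hUW hUWUV eUW eUV d1 d3 d2 d5).
  by rewrite scalerN scalerA sgK scale1r scaleN1r opprK addNr.
Qed.

Definition curvQ : homd (1 + 1) (Qc X) X := fun V n m e => plin (@curv_compat V n m e).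

Lemma curvQ_toQ V n m (e : m = n + (1 + 1)) z : curvQ V e (toQ V n z) = curv V e z.
Proof.
move: z; apply: (lin_ext (f := curvQ V e \o toQ V n) (g := curv V e)) => t /=.
by rewrite toQ_gen; exact: plinE.
Qed.

(** The curvature only sees the two-vertex piece at the root, and the upper pieces only through
    [eps]. *)
Lemma curv_rootQ V n m (e : m = n + (1 + 1)) z :
  curv V e z = curvQ V e (Qmap (@eps R M X) V n (rootQ V n z)).
Proof. by rewrite /rootQ /= Qmap_toQ Teps_Delta curvQ_toQ. Qed.

Lemma curv_corel V n m (e : m = n + (1 + 1)) z : corelmap V n z = 0 -> curv V e z = 0.
Proof. by move=> z0; rewrite curv_rootQ rootQ_corel // !linear0. Qed.

(** The Bianchi identity: [D o D^2 = D^2 o D] for the coderivation [D] with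
    corestriction [theta]. *)
Lemma curv_dphi V n m p (e : m = n + 1) (e' : p = m + (1 + 1)) z :
  corelmap V n z = 0 -> curv V e' (dphi V e z) = 0.
Proof.
move=> z0.
have -> : dphi V e z = coder theta V e z - infmap (@eps R M X) theta V e (Delta V n z).
  by rewrite /coder /= addrK.
(* The subtracted term depends on [z] only through [rootQ V n z], which vanishes on the kernel. *)
rewrite (linearB (curv V e')) -[X in _ - X]curvQ_toQ -Qinf_toQ.
have -> : toQ V n (Delta V n z) = 0 by exact: rootQ_corel.
rewrite !linear0 addr0 (coder_squareE _ erefl (etrans e' (addrA m 1 1))).
have e2 : m + 1 = n + (1 + 1) by rewrite e addrA.
(* The remaining term is [theta] applied to the square of the coderivation; this square extends
   [curv], which vanishes on each upper piece. *)
rewrite (coder_coder (g := curv) _ e erefl e2); last by move=> *; exact: coder_squareE.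
by rewrite (inf_corel0 _ (c := curv)) ?linear0 // => *; exact: curv_corel.
Qed.

End Theta.
End BinaryAlgebras.

Arguments theta {R M X} P V {n m} e.
Arguments curv {R M X} P V {n m} e.

(** * The differential of the cooperad preserves the corelations *)

Section BilinearExtension.
Variables (R : realType) (S1 S2 : Type) (rel1 : seq (R * S1) -> Prop)
  (rel2 : seq (R * S2) -> Prop) (Z : lmodType R).

Lemma bilin_ext (f g : pmod rel1 -> pmod rel2 -> Z) :
  (forall y, linear (f^~ y)) -> (forall x, linear (f x)) ->
  (forall y, linear (g^~ y)) -> (forall x, linear (g x)) ->
  (forall s t, f (pgen s) (pgen t) = g (pgen s) (pgen t)) ->
  forall x y, f x y = g x y.
Proof.
move=> fl fr gl gr H x y.
pose L (h : pmod rel1 -> pmod rel2 -> Z) (hl : forall y, linear (h^~ y)) y :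
  {linear pmod rel1 -> Z} := HB.pack (h^~ y) (GRing.isLinear.Build R _ _ _ (h^~ y) (hl y)).
pose Rr (h : pmod rel1 -> pmod rel2 -> Z) (hr : forall x, linear (h x)) x :
  {linear pmod rel2 -> Z} := HB.pack (h x) (GRing.isLinear.Build R _ _ _ (h x) (hr x)).
apply: (lin_ext (f := L f fl y) (g := L g gl y)) => s.
by apply: (lin_ext (f := Rr f fr (pgen s)) (g := Rr g gr (pgen s))) => t; exact: H.
Qed.

Variable b : S1 -> S2 -> Z.
Hypothesis bl : forall t, compat rel1 (b^~ t).
Hypothesis br : forall s, compat rel2 (b s).

Definition bilin (x : pmod rel1) (y : pmod rel2) : Z := plift (fun s => plin (br s) y) x.

(** The relations of the first variable are only assumed against generators of the second; linearity
    in [y] extends them to all classes. *)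
Lemma bilin_compat y : compat rel1 (fun s => plin (br s) y).
Proof.
move=> r hr.
have glin : linear (fun y => comb (fun s => plin (br s) y) r).
  by move=> a u v; rewrite -combZ -combD /comb; apply: eq_bigr => p _; rewrite linearP.
pose g : {linear pmod rel2 -> Z} := HB.pack (fun y => comb (fun s => plin (br s) y) r)
  (GRing.isLinear.Build R _ _ _ (fun y => comb (fun s => plin (br s) y) r) glin).
apply: (lin_ext (f := g) (g := \0)) => t.
rewrite -[RHS](bl t hr) /comb; apply: eq_bigr => p _.
by rewrite plinE.
Qed.

Lemma bilin_linl y : linear (bilin^~ y).
Proof. exact/plift_is_linear/bilin_compat. Qed.

Lemma bilin_linr x : linear (bilin x).
Proof.
move=> a y z; rewrite /bilin /plift -combZ -combD.
by apply: eq_bigr => p _; rewrite linearP.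
Qed.

Lemma bilin_gen s t : bilin (pgen s) (pgen t) = b s t.
Proof. by rewrite /bilin plift_gen ?plinE //; exact: bilin_compat. Qed.

End BilinearExtension.

(** * A truncated free algebra that detects corelations *)

Section Detection.
Variables (R : realType) (M : topologicalType) (Y : coll R M) (V0 : opens M).
Implicit Types (X : coll R M) (U V W UV UW VW T : opens M) (n m k : int).

Lemma TIota_TMu_deg X U V W T n1 n2 m m' p (h : W `<` T) (hd : U `&` V = set0)
    (hu : W = U `|` V :> set M) (e1 : m = n1 + n2 - 1) (e1' : m' = n1 + n2 - 1)
    (e2 : p = m - 1) (e2' : p = m' - 1) (x : Tc X U n1) (y : Tc X V n2) :
  TIota h e2 (TMu hd hu e1 x y) = TIota h e2' (TMu hd hu e1' x y) :> Tc X T p.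
Proof. by subst m'; subst m; rewrite (eq_irrelevance e2 e2'). Qed.

Definition opensU U W : opens M := Opens (openU (@oset_open M U) (@oset_open M W)).

Lemma opens_eq U V : U = V :> set M -> U = V.
Proof.
case: U V => [U oU] [V oV] /= E; subst V.
by congr Opens; exact: Prop_irrelevance.
Qed.

(** All colours are put together because every [iota] will act as the identity on these elements.
    The original colour stays recorded in the generator, and this is what [pair0] reads; hence
    moving elements along inclusions does not change a product. *)
Definition lin_gen n := {U : opens M & Y U n}.

Inductive lin_rel n : seq (R * lin_gen n) -> Prop :=
| lin_relP U a (x y : Y U n) :
    lin_rel [:: (1, existT (fun U => Y U n : Type) U (a *: x + y));
             (- a, existT (fun U => Y U n : Type) U x); (- 1, existT (fun U => Y U n : Type) U y)].

Lemma deg_pair m n1 n2 : m = n1 + n2 -> m - 1 - 1 = n1 + n2 - 1 - 1.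
Proof. by move=> ->. Qed.

(** The class of [iota o mu] in [Qc Y V0], or 0 when this composite does not exist. *)
Definition pair0 n1 n2 m (e : m = n1 + n2) (s : lin_gen n1) (t : lin_gen n2) : Qc Y V0 (m - 1 - 1) :=
  match pselect (projT1 s `&` projT1 t = set0), pselect (opensU (projT1 s) (projT1 t) `<` V0) with
  | left hd, left h => toQ V0 (m - 1 - 1) (TIota h (deg_pair e)
      (TMu hd (erefl : opensU _ _ = _ :> set M) erefl (tleaf (projT2 s)) (tleaf (projT2 t))))
  | _, _ => 0
  end.

Lemma pair0l n1 n2 m (e : m = n1 + n2) t : compat (@lin_rel n1) (fun s => pair0 e s t).
Proof.
move=> r [U a x y]; rewrite comb3 scale1r !scaleNr scale1r /pair0 /=.
case: pselect => hd; last by rewrite scaler0 subr0 subrr.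
case: pselect => h; last by rewrite scaler0 subr0 subrr.
rewrite tleafD tleafZ TMuDl TMuZl TIotaD TIotaZ toQD toQZ -opprD.
exact: subrr.
Qed.

Lemma pair0r n1 n2 m (e : m = n1 + n2) s : compat (@lin_rel n2) (pair0 e s).
Proof.
move=> r [U a x y]; rewrite comb3 scale1r !scaleNr scale1r /pair0 /=.
case: pselect => hd; last by rewrite scaler0 subr0 subrr.
case: pselect => h; last by rewrite scaler0 subr0 subrr.
rewrite tleafD tleafZ TMuDr TMuZr TIotaD TIotaZ toQD toQZ -opprD.
exact: subrr.
Qed.

Definition pairQ n1 n2 m (e : m = n1 + n2) := bilin (rel1 := @lin_rel n1) (Z := Qc Y V0 (m - 1 - 1)) (pair0r e).

Lemma pair0_flip n1 n2 m (e : m = n1 + n2) (e' : m = n2 + n1) s t :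
  pair0 e s t = sg R (n1 * n2) *: pair0 e' t s.
Proof.
case: s t => [U x] [W y]; rewrite /pair0 /=.
case: (pselect (U `&` W = set0)) => [hd|nd];
  case: (pselect (W `&` U = set0)) => [hd'|nd']; rewrite ?scaler0 //.
- have E : opensU U W = opensU W U by apply: (@opens_eq (opensU U W) (opensU W U)); rewrite /= setUC.
  case: (pselect (opensU U W `<` V0)) => [h|nh];
    case: (pselect (opensU W U `<` V0)) => [h'|nh']; rewrite ?scaler0 //.
  (* The two unions are equal opens but not convertible; abstracting them as [T] and [T'] allows the
     substitution of one for the other. *)
  + suff gen T T' (hT : T = U `|` W :> set M) (hT' : T' = W `|` U :> set M)
        (hh : T `<` V0) (hh' : T' `<` V0) : T = T' ->
        toQ V0 (m - 1 - 1) (TIota hh (deg_pair e) (TMu hd hT erefl (tleaf x) (tleaf y)))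
        = sg R (n1 * n2) *: toQ V0 (m - 1 - 1) (TIota hh' (deg_pair e')
            (TMu hd' hT' erefl (tleaf y) (tleaf x))) by exact: gen.
    move=> {h h'} ET; subst T'; move: hh hh' => h h'.
    rewrite -toQZ -TIotaZ (Prop_irrelevance h' h); congr (toQ _ _ _).
    have d : n1 + n2 - 1 = n2 + n1 - 1 by rewrite (addrC n1).
    rewrite (TMu_flip hd hd' hT hT' erefl d) !TIotaZ; congr (_ *: _).
    exact: TIota_TMu_deg.
  + by case: nh'; rewrite -E.
  + by case: nh; rewrite E.
- by case: nd'; rewrite setIC.
- by case: nd; rewrite setIC.
Qed.

Lemma pairQ_flip n1 n2 m (e : m = n1 + n2) (e' : m = n2 + n1) x y :
  pairQ e x y = sg R (n1 * n2) *: pairQ e' y x.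
Proof.
move: x y; apply: (bilin_ext (f := fun x y => pairQ e x y)
  (g := fun x y => sg R (n1 * n2) *: pairQ e' y x)).
- exact/bilin_linl/pair0l.
- exact: bilin_linr.
- by move=> y a x x'; rewrite [pairQ _ _ _]bilin_linr scalerDr !scalerA mulrC.
- move=> x a y y'; rewrite [pairQ e' _ x](bilin_linl (pair0l e') (pair0r e') x a y y').
  by rewrite scalerDr !scalerA mulrC.
- move=> s t; rewrite /pairQ !bilin_gen; [exact: pair0_flip|exact: pair0l|exact: pair0l].
Qed.

(** A product of degree [n] is recorded by a tree of degree [n - 1 - 1], since [iota] and [mu] have
    degree -1 in E[1]. *)
Definition Pcoll : coll R M := fun V n => (pmod (@lin_rel n) * Qc Y V0 (n - 1 - 1))%type : lmodType R.

Definition pcast U V n m (e : m = n) : {linear Pcoll U n -> Pcoll V m} :=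
  ecast z {linear Pcoll U n -> Pcoll V z} (esym e) (idfun : {linear Pcoll U n -> Pcoll U n}).

Lemma pcastE U V n (e : n = n) x : pcast U V e x = x.
Proof. by rewrite /pcast (eq_irrelevance (esym e) erefl). Qed.

Lemma pairQ0l n1 n2 m (e : m = n1 + n2) y : pairQ e 0 y = 0.
Proof.
have /(_ 1 0 0) := bilin_linl (pair0l e) (pair0r e) y.
by rewrite !scale1r !addr0 -[LHS]addr0 => /addrI/esym.
Qed.

Lemma pairQ0r n1 n2 m (e : m = n1 + n2) x : pairQ e x 0 = 0.
Proof.
have /(_ 1 0 0) := bilin_linr (pair0r e) x.
by rewrite !scale1r !addr0 -[LHS]addr0 => /addrI/esym.
Qed.

(** The free [balg] on [Y], truncated to products of at most two elements, of
    which only the part relevant at [V0] is kept. *)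
Definition Palg : balg Pcoll.
Proof.
refine (@Balg R M Pcoll (fun U V n m _ e => pcast U V e)
  (fun U V W n1 n2 m _ _ e x y => (0, pairQ e x.1 y.1)) _ _ _ _ _ _ _ _).
- move=> U V W n1 n2 m hd hu e y a x x'; congr (_, _); rewrite /= ?scaler0 ?addr0 //.
  exact: (bilin_linl (pair0l e) (pair0r e) y.1 a x.1 x'.1).
- move=> U V W n1 n2 m hd hu e x a y y'; congr (_, _); rewrite /= ?scaler0 ?addr0 //.
  exact: (bilin_linr (pair0r e) x.1 a y.1 y'.1).
- move=> U V W n1 n2 m hd hd' hu hu' e e' x y; congr (_, _); rewrite /= ?scaler0 //.
  exact: pairQ_flip.
- move=> U V W n n' m _ _ _ e e' e'' x; subst n' m.
  by rewrite !pcastE.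
(* A product has zero first component, and [pairQ] only reads first components: all triple products
   vanish. *)
- by move=> *; rewrite pairQ0l pairQ0r.
- by move=> *; rewrite !pairQ0l scaler0.
- move=> U V W UW VW i i' j ij m _ _ _ _ _ _ e1 e2 e3 e4 x y; subst i' ij m.
  by rewrite !pcastE; congr (_, pairQ _ _ _); exact: eq_irrelevance.
- move=> U V W UW UV i j j' ij m _ _ _ _ _ _ e1 e2 e3 e4 x y; subst j' ij m.
  by rewrite !pcastE; congr (_, pairQ _ _ _); exact: eq_irrelevance.
Defined.

End Detection.

(** * Detection applied to [dphi], and coderivations on the Koszul dual *)

Section Detect.
Variables (R : realType) (M : topologicalType).
Implicit Types (X Y : coll R M) (U V W T : opens M) (n m k : int).

Definition eta0 Y V0 V n (y : Y V n) : Pcoll Y V0 V n :=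
  (pgen (existT (fun U => Y U n : Type) V y), 0).

Lemma eta_linear Y V0 V n : linear (@eta0 Y V0 V n).
Proof.
move=> a x y; congr (_, _); rewrite /= ?scaler0 ?addr0 //.
have := pgen_compat (lin_relP a x y); rewrite comb3 scale1r !scaleNr scale1r.
by rewrite -opprD => /eqP; rewrite subr_eq0 => /eqP.
Qed.

Definition eta Y V0 : hom0 Y (Pcoll Y V0) := fun V n =>
  (HB.pack (@eta0 Y V0 V n) (GRing.isLinear.Build R _ _ _ (@eta0 Y V0 V n) (@eta_linear Y V0 V n))
    : {linear Y V n -> Pcoll Y V0 V n}).

Arguments eta {Y} V0 V n.

(** Triple products vanish in [Palg], so its curvature is blind to trees made of two [mu]. The
    restriction is harmless because [dphi] only produces trees with an [iota], by
    [iota_comb_dphi]. *)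
Fixpoint hasiota X V n (t : tree X V n) : bool :=
  match t with
  | Leaf _ _ _ => false
  | Iota _ _ _ _ _ _ _ => true
  | Mu _ _ _ _ _ _ _ _ _ t1 t2 => hasiota t1 || hasiota t2
  end.

Lemma hasiota0 X V n (t : tree X V n) : weight t = 0%N -> hasiota t = false.
Proof. by case: t. Qed.

Lemma hasiota_add0 X U V n m (t : tree X U n) (t' : tree X V m) :
  (weight t + weight t')%N = 0%N -> hasiota t || hasiota t' = false.
Proof. by move/eqP; rewrite addn_eq0 => /andP[/eqP/hasiota0-> /eqP/hasiota0]. Qed.

Definition iota_comb X V n (z : Tc X V n) : Prop :=
  exists2 s : seq (R * tree X V n), z = comb pgen s & all (fun p => hasiota p.2) s.

Lemma iota_combD X V n (x y : Tc X V n) : iota_comb x -> iota_comb y -> iota_comb (x + y).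
Proof.
by move=> [s -> hs] [t -> ht]; exists (s ++ t); rewrite ?comb_cat // all_cat hs.
Qed.

Lemma iota_combZ X V n a (x : Tc X V n) : iota_comb x -> iota_comb (a *: x).
Proof.
by move=> [s -> hs]; exists (pscale a s); rewrite ?comb_pscale // all_map.
Qed.

Lemma iota_comb0 X V n : iota_comb (0 : Tc X V n).
Proof. by exists [::]; rewrite // /comb big_nil. Qed.

Lemma iota_comb_iota X U V n m (h : U `<` V) (e : m = n - 1) (z : Tc X U n) : iota_comb (TIota h e z).
Proof.
rewrite -[z]preprK pclass_comb -comb_linear.
exists (smap (Iota h e) (prepr z)); last by rewrite all_map; elim: (prepr z).
by rewrite comb_smap; apply: eq_bigr => p _ /=; rewrite TIota_gen.
Qed.

Lemma iota_comb_mul X U V W n1 n2 m (hd : U `&` V = set0) (hu : W = U `|` V :> set M)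
    (e : m = n1 + n2 - 1) (z : Tc X U n1) (w : Tc X V n2) :
  iota_comb z -> iota_comb (TMu hd hu e z w).
Proof.
move=> [s -> hs]; rewrite -[w]preprK pclass_comb.
elim: s hs => [|p s IH] /=; first by rewrite /comb big_nil TMu0l => _; exact: iota_comb0.
move=> /andP[hp /IH{}IH]; rewrite {1}/comb big_cons TMuDl; apply: iota_combD => //.
rewrite TMuZl; apply: iota_combZ; rewrite TMu_combr {IH}.
elim: (prepr w) => [|q s' IH] /=; first by rewrite big_nil; exact: iota_comb0.
rewrite big_cons; apply: iota_combD => //; apply: iota_combZ; rewrite TMu_gen.
by exists [:: (1, Mu hd hu e p.2 q.2)]; rewrite /= ?hp // /comb big_seq1 scale1r.
Qed.

Lemma iota_comb_mur X U V W n1 n2 m (hd : U `&` V = set0) (hu : W = U `|` V :> set M)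
    (e : m = n1 + n2 - 1) (z : Tc X U n1) (w : Tc X V n2) :
  iota_comb w -> iota_comb (TMu hd hu e z w).
Proof.
have hd' : V `&` U = set0 by rewrite setIC.
have hu' : W = V `|` U :> set M by rewrite setUC.
have e' : m = n2 + n1 - 1 by rewrite e (addrC n1).
by move=> hw; rewrite (TMu_flip hd hd' hu hu' e e'); apply/iota_combZ/iota_comb_mul.
Qed.

Lemma iota_comb_contr X U V n m (h : U `<` V) (e : m = n) (z : Tc X U n) : iota_comb (contr h e z).
Proof.
move: U n z h e.
apply: Tc_ind => [U n|U n s x y hx hy|U n x|U0 U n0 n h0 e0 z _|U1 U2 U n1 n2 n hd hu e0 z w _ _] h e.
- by rewrite !linear0; exact: iota_comb0.
- by rewrite linearP; apply: iota_combD => //; exact: iota_combZ.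
- by rewrite contr_leaf; exact: iota_comb0.
- by rewrite contr_iotaE; exact: iota_comb_iota.
- by rewrite contr_mu; exact: iota_comb0.
Qed.

Lemma iota_comb_dphi X V n m (e : m = n + 1) (z : Tc X V n) : iota_comb (dphi V e z).
Proof.
move: V n z m e.
apply: Tc_ind => [V n|V n s x y hx hy|V n x|U V n p h e0 z IH|U V W n1 n2 p hd hu e0 z w IH1 IH2] m e.
- by rewrite linear0; exact: iota_comb0.
- by rewrite linearP; apply: iota_combD => //; exact: iota_combZ.
- by rewrite dphi_leaf; exact: iota_comb0.
- rewrite dphi_iotaE -scaleN1r; apply: iota_combD; first exact: iota_comb_contr.
  by apply: iota_combZ; exact: iota_comb_iota.
- rewrite dphi_muE -scaleN1r; apply: iota_combZ; apply: iota_combD; first exact: iota_comb_mul.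
  by apply: iota_combZ; exact: iota_comb_mur.
Qed.

Definition tcast X V V' n n' (EV : V = V') (En : n = n') (t : tree X V n) : tree X V' n' :=
  ecast z (tree X V' z) En (ecast x (tree X x n) EV t).

Lemma disj_sub U V W : U `<` V -> V `&` W = set0 -> U `&` W = set0.
Proof.
move=> [UV _] VW; apply/seteqP; split=> // x [/UV Vx Wx].
by rewrite -VW.
Qed.

Lemma proper_setU U V W T : U `<` V -> V `&` W = set0 -> T = V `|` W :> set M ->
  U `|` W `<` T.
Proof.
move=> [UV nVU] VW ->; split; first by move=> x [/UV|]; [left|right].
move=> H; apply: nVU => x Vx; have [//|Wx] := H x (or_introl Vx).
by have : (V `&` W) x by []; rewrite VW.
Qed.

Section Gen.
Variables (Y : coll R M) (V0 : opens M).

Lemma pairQ_eta U W n1 n2 m (e : m = n1 + n2) (hd : U `&` W = set0) T (h : T `<` V0)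
    (hu : T = U `|` W :> set M) p (e1 : p = n1 + n2 - 1) (e2 : m - 1 - 1 = p - 1)
    (x : Y U n1) (y : Y W n2) :
  pairQ V0 e (eta V0 U n1 x).1 (eta V0 W n2 y).1
  = toQ V0 (m - 1 - 1) (TIota h e2 (TMu hd hu e1 (tleaf x) (tleaf y))).
Proof.
rewrite /pairQ bilin_gen; last exact: pair0l.
rewrite /pair0 /=; case: (pselect (U `&` W = set0)) => [hd'|//].
have ET : T = opensU U W by apply: (@opens_eq M T (opensU U W)).
subst T; case: (pselect (opensU U W `<` V0)) => [h'|//].
rewrite (Prop_irrelevance h h') (Prop_irrelevance hd hd') (Prop_irrelevance hu erefl).
by congr (toQ _ _ _); exact: TIota_TMu_deg.
Qed.

Lemma pcast_pair U V n1 n2 n m (e : m = n) (d : n = n1 + n2) x y :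
  @pcast R M Y V0 U V n m e (0, pairQ V0 d x y) = (0, pairQ V0 (etrans e d) x y).
Proof. by subst m; rewrite pcastE; congr (_, pairQ _ _ _ _); exact: eq_irrelevance. Qed.

(** The contraction kills a tree with root [mu], so only the term [- ia (theta z)] of [curv_iota]
    remains, and [pairQ_eta] reads the tree back from it. *)
Lemma curv_detect_iota_mu U W T n1 n2 m p (e : m = m - 1 - 1 + (1 + 1)) (h : T `<` V0)
    (hd : U `&` W = set0) (hu : T = U `|` W :> set M) (e1 : p = n1 + n2 - 1)
    (e2 : m - 1 - 1 = p - 1) (x : Y U n1) (y : Y W n2) :
  (curv (Palg Y V0) V0 e (Tmap (eta V0) V0 (m - 1 - 1)
    (TIota h e2 (TMu hd hu e1 (tleaf x) (tleaf y))))).2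
  = - toQ V0 (m - 1 - 1) (TIota h e2 (TMu hd hu e1 (tleaf x) (tleaf y))).
Proof.
have d1 : p + 1 = n1 + n2 by rewrite e1 subrK.
have d2 : m = p + 1 by rewrite [LHS]e e2 addrA subrK.
rewrite Tmap_iota Tmap_mu !Tmap_leaf (curv_iota _ _ _ _ (erefl p) d2 d2).
rewrite contr_mu linear0 add0r (theta_mu _ _ _ _ _ d1) !eps_leaf.
by rewrite [ma _ _ _ _ _ _]/= pcast_pair /= (pairQ_eta _ hd h hu e1 e2).
Qed.

End Gen.

(** Up to sign, [curv] for [Palg] is the identity on the part of [Qc Y V0] spanned by
    the trees with an [iota]. *)
Lemma curv_detect Y V n (t : tree Y V n) V0 m (EV : V = V0) (En : n = m - 1 - 1)
    (e : m = n + (1 + 1)) : hasiota t ->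
  (curv (Palg Y V0) V e (Tmap (eta V0) V n (pgen t))).2
  = - (pgen (tcast EV En t) : Qc Y V0 (m - 1 - 1)).
Proof.
have [w2|/eqP w2] := eqVneq (weight t) 2%N; last first.
  move=> _; rewrite -curvQ_toQ -Qmap_toQ toQ_gen toQ_weight // !linear0.
  by rewrite toQ_weight ?oppr0 //; subst V0; subst n.
case: t EV En e w2 => {V n} [V n x|U V n p h e0 t|U V W n1 n2 p hd hu e0 t1 t2] EV En e w2 hi.
- by [].
- have {w2 hi}w1 : weight t = 1%N by case: w2.
  subst V; move: e0; subst p => e0; rewrite -toQ_gen -curvQ_toQ -Qmap_toQ [tcast _ _ _]/tcast.
  move: h e0 w1; case: t => {U n} [//|U' U n p h' e1 t|U W T n1 n2 p hd hu e1 t1 t2] h e0 w1.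
    have {}w1 : weight t = 0%N by case: w1.
    move: h' e1 w1; case: t => {U' n} [U' n x|//|//] h' e1 _.
    by rewrite -!TIota_gen toQ_iota_iota !linear0 ?oppr0.
  have {w1}[w1 w2] : weight t1 = 0%N /\ weight t2 = 0%N.
    by case: w1 => /eqP; rewrite addn_eq0 => /andP[/eqP-> /eqP->].
  move: hd e1 hu w1 w2.
  case: t1 => {U n1} [U n1 x|//|//]; case: t2 => {W n2} [W n2 y|//|//] hd e1 hu _ _.
  by rewrite -TIota_gen -TMu_gen Qmap_toQ curvQ_toQ curv_detect_iota_mu.
- have {}w2 : (weight t1 + weight t2 = 1)%N by case: w2.
  have {}hi : hasiota t1 || hasiota t2 by [].
  subst W; move: e0; subst p => e0; rewrite -toQ_gen -curvQ_toQ -Qmap_toQ [tcast _ _ _]/tcast.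
  have h0 : U `|` V `<=` V0 by rewrite -hu.
  move: hd hu e0 w2 hi h0.
  case: t1 => {U n1} [U n1 x|U' U n p h' e1 t1|U1 U2 U n m1 n1 hd1 hu1 e1 s1 s2]; last first.
  - move=> hd hu e0 /= [] /eqP; rewrite addn_eq0 => /andP[/eqP w1 /eqP w2].
    by rewrite (hasiota_add0 w1) (hasiota0 w2).
  - case: t2 => {V n2} [V n2 y|? ? ? ? ? ? ?|? ? ? ? ? ? ? ? ? ? ?] hd hu e0 w2 _ _.
    + have {w2}w1 : weight t1 = 0%N by case: w2; rewrite addn0.
      move: h' e1 w1; case: t1 => {U' n} [U' n x|//|//] h' e1 _.
      have hdU : U' `&` V = set0 by rewrite (disj_sub h').
      have hU : U' `|` V `<` V0 by exact: (proper_setU h').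
      have e2 : m - 1 - 1 = n + n2 - 1 - 1 by rewrite e0 e1 (addrAC n).
      rewrite -TMu_gen -TIota_gen.
      (* Modulo [qR], a tree with one [iota] and one [mu] can be brought, up to sign, to the form
         with [iota] at the root, which is the case already computed. *)
      rewrite (toQ_mu1_iota h' hd hdU (hU : opensU U' V `<` V0) erefl hu e1 e0 erefl e2).
      by rewrite Qmap_toQ curvQ_toQ curv_detect_iota_mu.
    + by move: w2; rewrite addnS.
    + by move: w2; rewrite addnS.
  - case: t2 => {V n2} [//|U' V n p h' e1 t2|U1 U2 V m1 n2 p hd1 hu1 e1 s1 s2] hd hu e0 w2 hi _; last first.
      by move: hi; rewrite /= hasiota_add0 //; case: w2.
    have {w2 hi}w1 : weight t2 = 0%N by case: w2.
    move: h' e1 w1; case: t2 => {U' n} [U' n y|//|//] h' e1 _.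
    have hdU : U `&` U' = set0 by rewrite setIC (disj_sub h') // setIC.
    have hU : U `|` U' `<` V0.
      by rewrite setUC; apply: (proper_setU h'); rewrite 1?setIC // setUC.
    have e2 : m - 1 - 1 = n1 + n - 1 - 1 by rewrite e0 e1 addrA.
    rewrite -TMu_gen -TIota_gen.
    rewrite (toQ_mu2_iota h' hd hdU (hU : opensU U U' `<` V0) erefl hu e1 e0 erefl e2).
    by rewrite !linearZ /= Qmap_toQ curvQ_toQ curv_detect_iota_mu scalerN.
Qed.

Lemma toQ_detect Y V0 m (e : m = m - 1 - 1 + (1 + 1)) (w : Tc Y V0 (m - 1 - 1)) :
  iota_comb w -> curv (Palg Y V0) V0 e (Tmap (eta V0) V0 (m - 1 - 1) w) = 0 ->
  toQ V0 (m - 1 - 1) w = 0.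
Proof.
move=> [s -> hs] H.
pose g : {linear Tc Y V0 (m - 1 - 1) -> Qc Y V0 (m - 1 - 1)} :=
  snd \o (curv (Palg Y V0) V0 e \o Tmap (eta V0) V0 (m - 1 - 1)).
have : g (comb pgen s) = - toQ V0 (m - 1 - 1) (comb pgen s).
  elim: s hs {H} => [_|p s IH /andP[hp /IH{}IH]].
    by rewrite /comb big_nil (linear0 g) (linear0 (toQ _ _)) oppr0.
  rewrite {1 2}/comb big_cons -[\sum_(_ <- s) _]/(comb pgen s) (linearP g) IH.
  rewrite toQD toQZ opprD -scalerN; congr (_ *: _ + _).
  by rewrite toQ_gen; exact: (curv_detect erefl erefl e hp).
have -> : g (comb pgen s) = 0 by exact: (congr1 snd H).
by move=> /esym/eqP; rewrite oppr_eq0 => /eqP.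
Qed.

(** The tree of trees [Delta z] is mapped into [Palg]. It stays in the kernel by naturality of
    [corelmap], so [curv_dphi] applies, and [toQ_detect] turns the vanishing curvature into the
    vanishing of the class. *)
Lemma toQ_dphi X V n p (e : p = n + 1) z :
  corelmap V n z = 0 -> toQ V p (dphi V e (Delta V n z)) = 0 :> Qc (Tc X) V p.
Proof.
(* Detection is stated in degrees of the form [m - 1 - 1], where [m] is the target degree of the
   curvature. *)
move=> z0; have E : p = p + (1 + 1) - 1 - 1 by rewrite addrA !addrK.
move: e; move: (p + (1 + 1)) E => m E; subst p => e.
have e2 : m = m - 1 - 1 + (1 + 1) by rewrite addrA !subrK.
apply: (toQ_detect (e := e2)); first exact: iota_comb_dphi.
rewrite -dphi_Tmap; apply: curv_dphi.
by rewrite corel_Tmap corel_Delta z0 !linear0.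
Qed.

(** [D'] acts as the coderivation on unmarked pieces and as the map it induces on marked ones. It
    commutes with the marking except for [f], and [f] vanishes on the kernel by [toQ_dphi]. *)
Lemma corel_coder X (d : homd 1 (Tc X) X) V n m (e : m = n + 1) z :
  corelmap V n z = 0 -> corelmap V m (coder d V e z) = 0.
Proof.
move=> z0; rewrite corelE Delta_coder linearD -dphi_inf0 -corelE z0 linear0 add0r.
pose D' : homd 1 (sumc (Tc X) (Qc (Tc X))) (sumc (Tc X) (Qc (Tc X))) := fun V n m e =>
  (inl0 V m \o (coder d V e \o fstc V n)) \+ (inr0 V m \o (Qinf (hid (Tc X)) (coder d) V e \o sndc V n)).
(* In [Delta_coder] only the [dphi] term changes the vertices of the root piece; the other term acts
   on one of its leaves and is accounted for by [Qinf]. *)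
pose f : homd 1 (Tc X) (sumc (Tc X) (Qc (Tc X))) := fun V n m e =>
  inr0 V m \o (toQ V m \o (dphi V e \o Delta V n)).
rewrite (inf0_inf (c' := D') (f := f)).
- rewrite -corelE z0 linear0 add0r; apply: inf_corel0 => // V' n' m' e' w w0.
  by rewrite /f /= toQ_dphi ?linear0.
- move=> V' n' m' e' x.
  have -> : D' V' n' m' e' (inl0 V' n' x)
    = inlc (coder d V' e' x) + inrc (Qinf (hid (Tc X)) (coder d) V' e' 0) by [].
  by rewrite (linear0 (Qinf _ _ _ _)) (linear0 (inr0 V' m')) addr0.
- move=> V' n' m' e' x.
  have -> : D' V' n' m' e' (inr_rootQ V' n' x)
    = inlc (coder d V' e' 0) + inrc (Qinf (hid (Tc X)) (coder d) V' e' (rootQ V' n' x)) by [].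
  rewrite (linear0 (coder _ _ _)) (linear0 (inl0 V' m')) add0r.
  have -> : inr_rootQ V' m' (coder d V' e' x) = inrc (rootQ V' m' (coder d V' e' x)) by [].
  rewrite -(linearB (inr0 V' m')); congr inrc.
  have -> : rootQ V' m' (coder d V' e' x) = toQ V' m' (Delta V' m' (coder d V' e' x)) by [].
  by rewrite Delta_coder toQD Qinf_toQ addrK.
Qed.

End Detect.

(** * Structures on the cofree coalgebra *)

Section Restriction.
Variables (R : realType) (V W V' W' : lmodType R) (f : {linear V -> W}) (f' : {linear V' -> W'}).
Variables (g : {linear V -> V'}) (H : forall x, f x = 0 -> f' (g x) = 0).

Definition krestr0 (x : Defs.kernel f) : Defs.kernel f' :=
  Defs.Kernel (mem_kernel (H (kernel0 x))).

Lemma krestr_linear : linear krestr0.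
Proof.
by move=> a x y; apply: val_inj; rewrite [RHS]linearP /= -[in RHS]linearP; congr (g _); rewrite -[LHS]/(val _) linearP.
Qed.

Definition krestr : {linear Defs.kernel f -> Defs.kernel f'} :=
  HB.pack krestr0 (GRing.isLinear.Build R _ _ _ krestr0 krestr_linear).

End Restriction.

(** * Codifferentials and infinity-morphisms from their corestrictions *)

Section Builders.
Variables (R : realType) (M : topologicalType).
Implicit Types (A B : opens M -> complex R) (V : opens M) (n m : int).

Lemma corel_incl (X : coll R M) V n (x : Disj_koszul X V n) :
  corelmap V n (Defs.incl V n x) = 0.
Proof. exact: (kernel0 x). Qed.

Section HoDisj.
Variables (A : opens M -> complex R).
Variable d : homd 1 (Tc (underlying A)) (underlying A).
Hypothesis d_leaf : forall V n m (e : m = n + 1) (x : A V n),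
  d V e (tleaf (x : underlying A V n)) = cdiff (A V) e x.
Hypothesis dd : forall V n m (e : m = n + (1 + 1)) z, corelmap V n z = 0 -> coder_square d V e z = 0.

Definition hoD : homd 1 (Disj_koszul (underlying A)) (Disj_koszul (underlying A)) :=
  fun V n m e => krestr (corel_coder d e (V := V) (n := n)).

Lemma incl_hoD V n m (e : m = n + 1) x :
  Defs.incl V m (hoD V e x) = coder d V e (Defs.incl V n x).
Proof. by []. Qed.

(** Kept transparent, since the codifferentials it produces are later identified with [coder] by
    conversion. *)
Definition hoDisj_of : hoDisj_alg A.
Proof.
refine (@HoDisjAlg R M A hoD _ _ _).
- move=> V n m p e e' x; apply: val_inj.
  have e2 : p = n + (1 + 1) by rewrite e' e addrA.
  change (coder d V e' (coder d V e (Defs.incl V n x)) = 0).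
  rewrite (coder_coder (g := coder_square d) _ e e' e2); last by move=> *; exact: coder_squareE.
  by apply: inf_corel0; [exact: dd|exact: corel_incl].
- move=> V n m e x; have [y xy] := coproduct_ex x; exists y => //.
  rewrite incl_hoD Delta_coder -xy linearD dphi_Tmap; congr (_ + _).
  rewrite (inf_Tmap (ac := Defs.incl) (bc := hcompl Defs.incl hoD)) //.
  exact/esym/Tmap_inf.
- move=> V n m e x; apply: val_inj.
  change (coder d V e (tleaf (x : underlying A V n)) = tleaf (cdiff (A V) e x : underlying A V m)).
  by rewrite coder_leaf d_leaf.
Defined.

End HoDisj.

Section Morphism.
Variables (B A : opens M -> complex R) (DB : hoDisj_alg B) (DA : hoDisj_alg A).
Variables (dB : homd 1 (Tc (underlying B)) (underlying B)) (dA : homd 1 (Tc (underlying A)) (underlying A)).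
Hypothesis DBE : forall V n m (e : m = n + 1) x,
  Defs.incl V m (ho_D DB V e x) = coder dB V e (Defs.incl V n x).
Hypothesis DAE : forall V n m (e : m = n + 1) x,
  Defs.incl V m (ho_D DA V e x) = coder dA V e (Defs.incl V n x).
Variable f : hom0 (Tc (underlying B)) (underlying A).
Hypothesis fd : forall V n m (e : m = n + 1) z, corelmap V n z = 0 ->
  f V m (coder dB V e z) = dA V e (Tmap f V n (Delta V n z)).

Lemma corel_Tmap_Delta V n z : corelmap V n z = 0 ->
  corelmap V n ((Tmap f V n \o Delta V n) z) = 0.
Proof.
move=> z0; change (corelmap V n (Tmap f V n (Delta V n z)) = 0).
by rewrite corel_Tmap corel_Delta z0 !linear0.
Qed.

Definition infF : hom0 (Disj_koszul (underlying B)) (Disj_koszul (underlying A)) :=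
  fun V n => krestr (@corel_Tmap_Delta V n).

Lemma incl_infF V n x :
  Defs.incl V n (infF V n x) = Tmap f V n (Delta V n (Defs.incl V n x)).
Proof. by []. Qed.

(** The [dphi] parts match by naturality. The rest is an infinitesimal composite of [c], the
    difference of the two corestrictions; [fd] says that [c] vanishes on the Koszul dual, and
    [inf_corel0] makes this enough. *)
Lemma infF_D V n m (e : m = n + 1) x :
  infF V m (ho_D DB V e x) = ho_D DA V e (infF V n x).
Proof.
apply: val_inj.
change (Defs.incl V m (infF V m (ho_D DB V e x)) = Defs.incl V m (ho_D DA V e (infF V n x))).
rewrite DAE !incl_infF DBE Delta_coder linearD /coder /= -dphi_Tmap; congr (_ + _).
rewrite Delta_nat Delta_coassoc.
rewrite (Tmap_inf (ca := f) (cb := hcompl f (coder dB))) //.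
rewrite (Tmap_comp (ca := hcomp (Tmap f) (@Delta R M _))) //.
rewrite (inf_Tmap (ac := f) (bc := hcompr dA (hcomp (Tmap f) (@Delta R M _)))) //; last first.
  by move=> V' n' z; rewrite /hcomp /= eps_Tmap eps_Delta.
apply/eqP; rewrite -subr_eq0; apply/eqP.
pose c : homd 1 (Tc (underlying B)) (underlying A) := fun V n m e =>
  hcompl f (coder dB) V e \- hcompr dA (hcomp (Tmap f) (@Delta R M _)) V e.
transitivity (infmap f c V e (Delta V n (Defs.incl V n x))).
  have cE V' n' m' (e' : m' = n' + 1) u : c V' n' m' e' u
    = (-1) *: hcompr dA (hcomp (Tmap f) (@Delta R M _)) V' e' u
      + hcompl f (coder dB) V' e' u by rewrite scaleN1r addrC.
  by rewrite (inf_lin f cE) scaleN1r addrC.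
apply: inf_corel0; last exact: corel_incl.
by move=> V' n' m' e' u u0; rewrite /c /= /hcompl /hcompr /hcomp /= -(fd e' u0) subrr.
Qed.

Definition infty_of : infty_morphism DB DA.
Proof.
refine (@InftyMorphism R M B A DB DA infF infF_D _).
move=> V n x; have [y xy] := coproduct_ex x; exists y => //.
have y0 : corelmap V n (Tmap infF V n (Defs.incl V n y)) = 0.
  by rewrite corel_Tmap corel_incl linear0.
exists (Defs.Kernel (mem_kernel y0)) => //.
rewrite /coproduct incl_infF.
change (Tmap Defs.incl V n (Tmap infF V n (Defs.incl V n y))
  = Delta V n (Tmap f V n (Delta V n (Defs.incl V n x)))).
rewrite Delta_nat Delta_coassoc -xy.
rewrite [X in Tmap (Tmap f) V n X](Tmap_comp (ca := hcomp (@Delta R M _) Defs.incl)) //.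
by rewrite !(Tmap_comp (ca := hcomp (hcomp (Tmap f) (@Delta R M _)) Defs.incl)).
Defined.

End Morphism.

End Builders.

(** * Homotopy transfer *)

Section PrefactBalg.
Variables (R : realType) (M : topologicalType) (A : prefact_alg R M).
Implicit Types (U V W UV UW VW T : opens M) (n m i j k : int).

Definition pf_elt U n (x : A U n) : elt A := Elt x.

Lemma operable_1 U V n m (x : A U n) : U `<=` V -> m = n -> operable V m [:: pf_elt x].
Proof.
move=> h ->; split=> //=; first by rewrite andbT; exact/asboolP.
by rewrite /totdeg big_seq1.
Qed.

Lemma operable_2 U V W n1 n2 m (x : A U n1) (y : A V n2) : U `&` V = set0 ->
  U `|` V `<=` W -> m = n1 + n2 -> operable W m [:: pf_elt x; pf_elt y].
Proof.
move=> hd hu ->; split=> //=.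
- by rewrite andbT; apply/andP; split; apply/asboolP => z hz; apply: hu; [left|right].
- by rewrite !andbT; exact/asboolP.
- by rewrite /totdeg big_cons big_seq1.
Qed.

Lemma operable_3 U V W T i j k m (x : A U i) (y : A V j) (z : A W k) :
  U `&` V = set0 -> U `&` W = set0 -> V `&` W = set0 ->
  U `<=` T -> V `<=` T -> W `<=` T -> m = i + j + k -> operable T m [:: pf_elt x; pf_elt y; pf_elt z].
Proof.
move=> h1 h2 h3 hU hV hW ->; split=> //=.
- by rewrite andbT; apply/and3P; split; exact/asboolP.
- by rewrite !andbT; apply/andP; split; [apply/andP; split|]; exact/asboolP.
- by rewrite /totdeg !big_cons big_nil /= addr0 addrA.
Qed.

Lemma pf_ia_linear U V n m (h : U `<` V) (e : m = n) :
  linear (fun x : A U n => pf_m V m [:: pf_elt x] : A V m).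
Proof.
move=> a x y; apply: (@pf_linear R M A V m U n [::] [::] a x y).
by apply: operable_1 => //; case: h.
Qed.

Definition pf_ia U V n m (h : U `<` V) (e : m = n) : {linear A U n -> A V m} :=
  HB.pack (fun x : A U n => pf_m V m [:: pf_elt x] : A V m)
    (GRing.isLinear.Build R _ _ _ (fun x : A U n => pf_m V m [:: pf_elt x] : A V m) (pf_ia_linear h e)).

Definition pf_ma U V W n1 n2 m (hd : U `&` V = set0) (hu : W = U `|` V :> set M)
  (e : m = n1 + n2) (x : A U n1) (y : A V n2) : A W m := pf_m W m [:: pf_elt x; pf_elt y].

Lemma pf_comp_l U V W n1 n2 m s (y : A V n2) :
  operable U n1 s -> operable W m [:: pf_elt (pf_m U n1 s : A U n1); pf_elt y] ->
  pf_m W m [:: pf_elt (pf_m U n1 s : A U n1); pf_elt y] = pf_m W m (s ++ [:: pf_elt y]) :> A W m.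
Proof. by move=> h1 h2; exact: (@pf_comp R M A W m U n1 [::] s [:: pf_elt y]). Qed.

Lemma pf_comp_r U V W n1 n2 m s (x : A U n1) :
  operable V n2 s -> operable W m [:: pf_elt x; pf_elt (pf_m V n2 s : A V n2)] ->
  pf_m W m [:: pf_elt x; pf_elt (pf_m V n2 s : A V n2)] = pf_m W m (pf_elt x :: s) :> A W m.
Proof.
by move=> h1 h2; have := @pf_comp R M A W m V n2 [:: pf_elt x] s [::] h1 h2; rewrite /= cats0.
Qed.

Lemma pf_comp_1 U V n m s : operable U n s -> operable V m [:: pf_elt (pf_m U n s : A U n)] ->
  pf_m V m [:: pf_elt (pf_m U n s : A U n)] = pf_m V m s :> A V m.
Proof.
by move=> h1 h2; have := @pf_comp R M A V m U n [::] s [::] h1 h2; rewrite /= cats0.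
Qed.

Lemma setU_disj U V W UV : UV = U `|` V :> set M -> UV `&` W = set0 ->
  U `&` W = set0 /\ V `&` W = set0.
Proof.
move=> -> H; split; apply/seteqP; split=> // x [ux wx]; rewrite -H.
  by split=> //; left.
by split=> //; right.
Qed.

(** Both composites equal the single operation on [x], [y], [z] with values in [A T]. *)
Lemma pf_ma12 U V W UV VW T i j k ij jk m (hUV : U `&` V = set0) (hVW : V `&` W = set0)
  (hUVW : UV `&` W = set0) (hUVW' : U `&` VW = set0) (eUV : UV = U `|` V :> set M)
  (eVW : VW = V `|` W :> set M) (eT : T = UV `|` W :> set M) (eT' : T = U `|` VW :> set M)
  (e1 : ij = i + j) (e2 : m = ij + k) (e3 : jk = j + k) (e4 : m = i + jk) x y z :
  pf_ma hUVW eT e2 (@pf_ma U V UV i j ij hUV eUV e1 x y) z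
  = pf_ma hUVW' eT' e4 x (@pf_ma V W VW j k jk hVW eVW e3 y z).
Proof.
rewrite /pf_ma pf_comp_l; first 1 last.
- by apply: operable_2 => //; rewrite eUV.
- by apply: operable_2 => //; rewrite eT.
rewrite pf_comp_r //; first by apply: operable_2 => //; rewrite eVW.
by apply: operable_2 => //; rewrite eT'.
Qed.

Lemma pf_ma11 U V W UV UW T i j k ij ik m (hUV : U `&` V = set0) (hUW : U `&` W = set0)
  (hUVW : UV `&` W = set0) (hUWV : UW `&` V = set0) (eUV : UV = U `|` V :> set M)
  (eUW : UW = U `|` W :> set M) (eT : T = UV `|` W :> set M) (eT' : T = UW `|` V :> set M)
  (e1 : ij = i + j) (e2 : m = ij + k) (e3 : ik = i + k) (e4 : m = ik + j) x y z :
  pf_ma hUVW eT e2 (@pf_ma U V UV i j ij hUV eUV e1 x y) z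
  = sg R (j * k) *: pf_ma hUWV eT' e4 (@pf_ma U W UW i k ik hUW eUW e3 x z) y.
Proof.
rewrite /pf_ma pf_comp_l; first 1 last.
- by apply: operable_2 => //; rewrite eUV.
- by apply: operable_2 => //; rewrite eT.
rewrite pf_comp_l; first 1 last.
- by apply: operable_2 => //; rewrite eUW.
- by apply: operable_2 => //; rewrite eT'.
have [_ hVW] := setU_disj eUV hUVW.
apply: (@pf_sym R M A T m [:: pf_elt x] (pf_elt y) (pf_elt z) [::]).
apply: operable_3 => //; last by rewrite e2 e1.
- by rewrite eT eUV => t tU; left; left.
- by rewrite eT eUV => t tU; left; right.
- by rewrite eT => t tU; right.
Qed.

Definition pf_balg : balg (underlying A).
Proof.
refine (@Balg R M (underlying A) pf_ia pf_ma _ _ _ _ pf_ma12 pf_ma11 _ _).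
- move=> U V W n1 n2 m hd hu e y a x x'.
  apply: (@pf_linear R M A W m U n1 [::] [:: pf_elt y] a x x').
  by apply: operable_2 => //; rewrite hu.
- move=> U V W n1 n2 m hd hu e x a y y'.
  apply: (@pf_linear R M A W m V n2 [:: pf_elt x] [::] a y y').
  by apply: operable_2 => //; rewrite hu.
- move=> U V W n1 n2 m hd hd' hu hu' e e' x y.
  apply: (@pf_sym R M A W m [::] (pf_elt x) (pf_elt y) [::]).
  by apply: operable_2 => //; rewrite hu.
- move=> U V W n n' m h h' h'' e e' e'' x.
  by apply: pf_comp_1; apply: operable_1 => //; [case: h|case: h'].
- move=> U V W UW VW i i' j ij m hUV hVW hUW hUWVW eUW eVW e1 e2 e3 e4 x y.
  transitivity (pf_m VW m [:: pf_elt x; pf_elt y] : A VW m).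
    apply: (@pf_comp_l V W VW i' j m [:: pf_elt x] y); first by apply: operable_1 => //; case: hUV.
    by apply: operable_2 => //; rewrite eVW.
  apply/esym/pf_comp_1; first by apply: operable_2 => //; rewrite eUW.
  by apply: operable_1 => //; case: hUWVW.
- move=> U V W UW UV i j j' ij m hWV hUV hUW hUWUV eUW eUV e1 e2 e3 e4 x y.
  transitivity (pf_m UV m [:: pf_elt x; pf_elt y] : A UV m).
    apply: (@pf_comp_r U V UV i j' m [:: pf_elt y] x); first by apply: operable_1 => //; case: hWV.
    by apply: operable_2 => //; rewrite eUV.
  apply/esym/pf_comp_1; first by apply: operable_2 => //; rewrite eUW.
  by apply: operable_1 => //; case: hUWUV.
Defined.

Lemma pf_d_ia U V n m n' m' (h : U `<` V) (e : m = n) (e' : m' = n') (en : n' = n + 1)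
    (em : m' = m + 1) (x : A U n) :
  cdiff (A V) em (ia pf_balg h e (x : underlying A U n))
  = ia pf_balg h e' (cdiff (A U) en x : underlying A U n').
Proof.
move: e'; subst n' => e'; transitivity (leibniz (pf_m V m') [::] [:: pf_elt x] : A V m').
  by apply: pf_cochain; apply: operable_1 => //; case: h.
by rewrite /= addr0 /totdeg big_nil [sg R 0]expr0z scale1r.
Qed.

Lemma pf_d_ma U V W n1 n2 m n1' n2' m' (hd : U `&` V = set0) (hu : W = U `|` V :> set M)
    (e : m = n1 + n2) (em : m' = m + 1) (en1 : n1' = n1 + 1) (en2 : n2' = n2 + 1)
    (e1 : m' = n1' + n2) (e2 : m' = n1 + n2') (x : A U n1) (y : A V n2) :
  cdiff (A W) em (ma pf_balg hd hu e (x : underlying A U n1) (y : underlying A V n2))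
  = ma pf_balg hd hu e1 (cdiff (A U) en1 x : underlying A U n1') (y : underlying A V n2)
    + sg R n1 *: ma pf_balg hd hu e2 (x : underlying A U n1) (cdiff (A V) en2 y : underlying A V n2').
Proof.
subst n1' n2'; transitivity (leibniz (pf_m W m') [::] [:: pf_elt x; pf_elt y] : A W m').
  by apply: pf_cochain; apply: operable_2 => //; rewrite hu.
by rewrite /= addr0 /totdeg big_nil [sg R 0]expr0z scale1r big_seq1.
Qed.

(** This links the map [twist] of [pf_induced], defined by cases on trees, to the map [theta] for
    which curvature is computed. *)
Lemma twistE V n m (e : m = n + 1) z :
  twist A V e z = cdiff (A V) e (eps V n z) + theta pf_balg V e z.
Proof.
move: z; apply: (lin_ext (f := twist A V e)
  (g := (cdiff (A V) e \o eps V n) \+ theta pf_balg V e)) => t.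
transitivity (cdiff (A V) e (epst t) + thetat pf_balg t e); last first.
  by rewrite /= eps_gen theta_gen.
rewrite [LHS]plinE; case: t m e => {V n} [V n x|U V n p h e0 t|U V W n1 n2 p hd hu e0 t1 t2] m e.
- by rewrite /= addr0.
- by rewrite [epst _]/= linear0 add0r; case: t h e0 => * //; apply/esym; exact: (linear0 (pf_ia _ _)).
- rewrite [epst _]/= linear0 add0r; case: t1 hd hu e0 => [? ? x|? ? ? ? ? ? ?|? ? ? ? ? ? ? ? ? ? ?] hd hu e0; last 2 first.
  + by apply/esym; exact: (ma0l pf_balg).
  + by apply/esym; exact: (ma0l pf_balg).
  by case: t2 hd hu e0 => * //; apply/esym; exact: (ma0r pf_balg).
Qed.

End PrefactBalg.

Lemma inf0D (R : realType) (M : topologicalType) (X Y : coll R M) (a b : hom0 X Y) V n x y :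
  inf0 a b V n (x + y) = inf0 a b V n x + inf0 a b V n y.
Proof. exact: linearD. Qed.

(** * Sums over trees for a retraction *)

Section Transfer.
Variables (R : realType) (M : topologicalType) (A B : opens M -> complex R).
Variable P : balg (underlying A).
Implicit Types (U V W : opens M) (n m : int).
Hypothesis d_ia : forall U V n m n' m' (h : U `<` V) (e : m = n) (e' : m' = n')
    (en : n' = n + 1) (em : m' = m + 1) (x : A U n),
  cdiff (A V) em (ia P h e (x : underlying A U n))
  = ia P h e' (cdiff (A U) en x : underlying A U n').
Hypothesis d_ma : forall U V W n1 n2 m n1' n2' m' (hd : U `&` V = set0)
    (hu : W = U `|` V :> set M) (e : m = n1 + n2) (em : m' = m + 1) (en1 : n1' = n1 + 1)
    (en2 : n2' = n2 + 1) (e1 : m' = n1' + n2) (e2 : m' = n1 + n2') (x : A U n1) (y : A V n2),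
  cdiff (A W) em (ma P hd hu e (x : underlying A U n1) (y : underlying A V n2))
  = ma P hd hu e1 (cdiff (A U) en1 x : underlying A U n1') (y : underlying A V n2)
    + sg R n1 *: ma P hd hu e2 (x : underlying A U n1) (cdiff (A V) en2 y : underlying A V n2').
Variable r : forall U, retraction (A U) (B U).

Notation XA := (underlying A).
Notation XB := (underlying B).

(** The component of the infinity-morphism on a tree: the vertices act on [A],
    with [- h] below each of them and [i] at the leaves. *)
Fixpoint transt V n (t : tree XB V n) : XA V n :=
  match t in tree _ V n return XA V n with
  | Leaf V n x => ret_i (r V) n x
  | Iota _ V n m h e t1 => - ret_h (r V) e (ia P h (erefl n) (transt t1) : A V n)
  | Mu _ _ W n1 n2 m hd hu e t1 t2 =>
      - ret_h (r W) e (ma P hd hu (erefl (n1 + n2)) (transt t1) (transt t2) : A W (n1 + n2))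
  end.

(** [transt] fixes the intermediate degree to be [n1 + n2], whereas [root_act] produces it as a
    successor; the value after [h] is the same. *)
Lemma h_ma_deg U V W n1 n2 m q q' (hd : U `&` V = set0) (hu : W = U `|` V :> set M)
    (d : q = n1 + n2) (d' : q' = n1 + n2) (e : m = q - 1) (e' : m = q' - 1)
    (x : XA U n1) (y : XA V n2) :
  ret_h (r W) e (ma P hd hu d x y) = ret_h (r W) e' (ma P hd hu d' x y).
Proof.
by subst q'; subst q; rewrite (eq_irrelevance e e').
Qed.

Lemma h_ia_deg U V n m q q' (h : U `<` V) (d : q = n) (d' : q' = n) (e : m = q - 1)
    (e' : m = q' - 1) (x : XA U n) :
  ret_h (r V) e (ia P h d x) = ret_h (r V) e' (ia P h d' x).
Proof. by subst q'; subst q; rewrite (eq_irrelevance e e'). Qed.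

Lemma transt_compat V n : compat (@treerel R M XB V n) (@transt V n).
Proof.
move=> s; elim=> {V n s}.
- move=> V n a x y; rewrite comb3 scale1r !scaleNr scale1r /= linearP.
  by rewrite -opprD subrr.
- move=> U V W n1 n2 m hd hd' hu hu' e e' t1 t2; rewrite comb2 scale1r scaleNr /=.
  have e3 : n1 + n2 = n2 + n1 by rewrite addrC.
  rewrite (ma_flip P hd hd' hu hu' _ e3) linearZ /= scalerN opprK.
  by rewrite (h_ma_deg hd' hu' e3 erefl e e') addNr.
- move=> U V n m h e s hs IH; rewrite comb_smap.
  rewrite (comb_linear (\- (ret_h (r V) e \o ia P h (erefl n))) (@transt U n)) IH.
  exact: linear0.
- move=> U V W n1 n2 m hd hu e s t2 hs IH; rewrite comb_smap.
  rewrite (comb_linear (\- ret_h (r W) e)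
    (fun t1 => ma P hd hu (erefl (n1 + n2)) (transt t1) (transt t2))).
  by rewrite comb_mal IH ma0l; exact: linear0.
- move=> U V W n1 n2 m hd hu e t1 s hs IH; rewrite comb_smap.
  rewrite (comb_linear (\- ret_h (r W) e)
    (fun t2 => ma P hd hu (erefl (n1 + n2)) (transt t1) (transt t2))).
  by rewrite comb_mar IH ma0r; exact: linear0.
Qed.

Definition trans : hom0 (Tc XB) XA := fun V n => plin (@transt_compat V n).

Lemma trans_gen V n t : trans V n (pgen t) = transt t.
Proof. exact: plinE. Qed.

Lemma trans_leaf V n (x : XB V n) : trans V n (tleaf x) = ret_i (r V) n x.
Proof. exact: plinE. Qed.

Lemma trans_iota U V n m (h : U `<` V) (e : m = n - 1) z :
  trans V m (TIota h e z) = - ret_h (r V) e (ia P h (erefl n) (trans U n z)).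
Proof.
move: z; apply: (plin_TIota (f := trans V m)
  (g := \- (ret_h (r V) e \o (ia P h (erefl n) \o trans U n)))) => t.
by rewrite /= !trans_gen.
Qed.

Lemma trans_mu U V W n1 n2 m (hd : U `&` V = set0) (hu : W = U `|` V :> set M)
    (e : m = n1 + n2 - 1) z w :
  trans W m (TMu hd hu e z w)
  = - ret_h (r W) e (ma P hd hu (erefl (n1 + n2)) (trans U n1 z) (trans V n2 w)).
Proof.
move: z w; apply: (plin_TMu (f := trans W m)
  (g := fun z w => - ret_h (r W) e (ma P hd hu (erefl (n1 + n2)) (trans U n1 z) (trans V n2 w)))).
- by move=> y a z w; rewrite [trans _ _ (_ + _)]linearP maDl maZl linearP opprD scalerN.
- by move=> y a z w; rewrite [trans _ _ (_ + _)]linearP maDr maZr linearP opprD scalerN.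
- by move=> t1 t2; rewrite !trans_gen.
Qed.

Definition root_act : homd 1 (Tc XB) XA := fun V n m e =>
  theta P V e \o (Tmap trans V n \o Delta V n).

Lemma root_actE V n m (e : m = n + 1) z : root_act V e z = theta P V e (Tmap trans V n (Delta V n z)).
Proof. by []. Qed.

Lemma root_act_leaf V n m (e : m = n + 1) x : root_act V e (tleaf x) = 0.
Proof. by rewrite root_actE Delta_leaf Tmap_leaf theta_leaf. Qed.

Lemma root_act_iota U V n m p (h : U `<` V) (e : m = n - 1) (e' : p = m + 1) (e'' : p = n) z :
  root_act V e' (TIota h e z) = ia P h e'' (trans U n z).
Proof.
rewrite root_actE Delta_iota (linearD (Tmap trans V m)) Tmap_leaf Tmap_iota.
rewrite (linearD (theta P V e')) theta_leaf add0r (theta_iota _ _ _ _ e'').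
by rewrite eps_Tmap eps_Delta.
Qed.

Lemma root_act_mu U V W n1 n2 m p (hd : U `&` V = set0) (hu : W = U `|` V :> set M)
    (e : m = n1 + n2 - 1) (e' : p = m + 1) (e'' : p = n1 + n2) z w :
  root_act W e' (TMu hd hu e z w) = ma P hd hu e'' (trans U n1 z) (trans V n2 w).
Proof.
rewrite root_actE Delta_mu (linearD (Tmap trans W m)) Tmap_leaf Tmap_mu.
rewrite (linearD (theta P W e')) theta_leaf add0r (theta_mu _ _ _ _ _ e'').
by rewrite !eps_Tmap !eps_Delta.
Qed.

Lemma transE V n m (e : m = n + 1) (e' : n = m - 1) z :
  trans V n z = ret_i (r V) n (eps V n z) - ret_h (r V) e' (root_act V e z).
Proof.
move: V n z m e e'; apply: Tc_ind => [V n|V n a x y hx hy|V n x|U V n p h e0 z _|U V W n1 n2 p hd hu e0 z w _ _] m e e'.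
- by rewrite !linear0 ?subr0 ?addr0.
- rewrite (linearP (trans V n)) (hx _ e e') (hy _ e e').
  exact: (esym (linearP ((ret_i (r V) n \o eps V n) \- (ret_h (r V) e' \o root_act V e)) a x y)).
- by rewrite trans_leaf eps_leaf root_act_leaf linear0 subr0.
- have E : m = n by rewrite e e0 subrK.
  rewrite eps_iota linear0 add0r trans_iota (root_act_iota _ _ _ E).
  by rewrite (h_ia_deg h E (erefl n) e' e0).
- have E : m = n1 + n2 by rewrite e e0 subrK.
  rewrite eps_mu linear0 add0r trans_mu (root_act_mu _ _ _ _ E).
  by rewrite (h_ma_deg hd hu E erefl e' e0).
Qed.

Definition dtrans : homd 1 (Tc XB) XB := fun V n m e =>
  (cdiff (B V) e \o eps V n) \+ (ret_p (r V) m \o root_act V e).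

Lemma dtransE V n m (e : m = n + 1) z :
  dtrans V e z = cdiff (B V) e (eps V n z) + ret_p (r V) m (root_act V e z) :> B V m.
Proof. by []. Qed.

(** The failure of [root_act] to commute with the differentials; it vanishes on the
    Koszul dual, and [trans] is an infinity-morphism up to [h] of it. *)
Definition defect V n m p (e : m = n + 1) (e' : p = m + 1) z : A V p :=
  root_act V e' (coder dtrans V e z) + cdiff (A V) e' (root_act V e z : A V m).

(** After [transE] on both sides, the retraction identity for [root_act V e z] replaces the
    composite of [p] and [i] by homotopy terms. The two terms in [h] combine into [h] of the
    defect. *)
Lemma trans_coder V n m p (e : m = n + 1) (e' : p = m + 1) (e'' : m = p - 1) z :
  trans V m (coder dtrans V e z)
  = cdiff (A V) e (trans V n z) + root_act V e z - ret_h (r V) e'' (defect e e' z) :> A V m.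
Proof.
have e3 : n = m - 1 by rewrite e addrK.
rewrite (transE e' e'') eps_coder dtransE (transE e e3) /defect.
rewrite (linearD (ret_i (r V) m)) ret_id.
have H := ret_ip (r V) e3 e e' e'' (root_act V e z).
have -> : ret_i (r V) m (ret_p (r V) m (root_act V e z))
  = root_act V e z - (cdiff (A V) e (ret_h (r V) e3 (root_act V e z)) + ret_h (r V) e'' (cdiff (A V) e' (root_act V e z))).
  by rewrite -H opprB addrC subrK.
rewrite (linearD (ret_h (r V) e'')) (linearB (cdiff (A V) e)) !opprD !addrA.
by rewrite [LHS](ACl (1*3*2*5*4)).
Qed.

Lemma degh n : n + 1 = n + (1 + 1) - 1.
Proof. by rewrite addrA addrK. Qed.

Lemma degi (n m p : int) : m = n - 1 -> p = m + (1 + 1) -> p = n + 1.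
Proof. by move=> -> ->; rewrite addrA subrK. Qed.

Lemma degm1 (n1 n2 m p : int) : m = n1 + n2 - 1 -> p = m + (1 + 1) -> p = n1 + 1 + n2.
Proof. by move=> -> ->; rewrite addrA subrK addrAC. Qed.

Lemma degm2 (n1 n2 m p : int) : m = n1 + n2 - 1 -> p = m + (1 + 1) -> p = n1 + (n2 + 1).
Proof. by move=> -> ->; rewrite addrA subrK addrA. Qed.

Lemma defect_leaf V n m p (e : m = n + 1) (e' : p = m + 1) x : defect e e' (tleaf x : Tc XB V n) = 0.
Proof. by rewrite /defect coder_leaf !root_act_leaf linear0 addr0. Qed.

(** With [trans_coder] on the subtree, the terms in [cdiff] cancel by the Leibniz rule [d_ia]. What
    is left is the curvature at the root and the defect of the subtree carried through [h]. *)
Lemma defect_iota U V n m0 m p (h : U `<` V) (e0 : m0 = n - 1) (e : m = m0 + 1) (e' : p = m + 1)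
    (e2 : p = m0 + (1 + 1)) (e3 : n + 1 + 1 = n + (1 + 1)) z :
  defect e e' (TIota h e0 z) = curv P V e2 (Tmap trans V m0 (Delta V m0 (TIota h e0 z)))
    + ia P h (degi e0 e2) (ret_h (r U) (degh n) (defect (erefl (n + 1)) (esym e3) z)).
Proof.
have Em : m = n by rewrite e e0 subrK.
rewrite Delta_iota (linearD (Tmap trans V m0)) Tmap_leaf Tmap_iota.
rewrite (linearD (curv P V e2)) curv_leaf add0r.
rewrite (curv_iota _ _ _ _ Em e' (degi e0 e2)).
rewrite {1}/defect coder_iota (linearB (root_act V e')) (linearD (root_act V e')) root_act_leaf add0r.
rewrite (root_act_iota _ _ _ (degi e0 e2)) (root_act_iota _ _ _ Em).
rewrite (d_ia h Em (degi e0 e2) erefl e').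
rewrite (trans_coder erefl (esym e3) (degh n)).
rewrite (linearB (ia P h _)) (linearD (ia P h _)) opprB opprD.
have -> : root_act V e' (contr h (deg_contract e0 e) z)
    = theta P V e' (contr h Em (Tmap trans U n (Delta U n z))).
  rewrite root_actE Delta_contr (linearD (Tmap trans V m)) Tmap_leaf (linearD (theta P V e')) theta_leaf.
  by rewrite add0r -contr_Tmap (eq_irrelevance (deg_contract e0 e) Em).
rewrite -[theta P U erefl _]/(root_act U erefl z) !addrA [LHS](ACl (1*4*2*5*3)).
exact: addrK.
Qed.

Lemma defect_mu U V W n1 n2 m0 m p (hd : U `&` V = set0) (hu : W = U `|` V :> set M)
    (e0 : m0 = n1 + n2 - 1) (e : m = m0 + 1) (e' : p = m + 1)
    (e2 : p = m0 + (1 + 1)) (e3 : n1 + 1 + 1 = n1 + (1 + 1)) (e4 : n2 + 1 + 1 = n2 + (1 + 1)) z w :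
  defect e e' (TMu hd hu e0 z w)
  = curv P W e2 (Tmap trans W m0 (Delta W m0 (TMu hd hu e0 z w)))
    + (ma P hd hu (degm1 e0 e2) (ret_h (r U) (degh n1) (defect (erefl (n1 + 1)) (esym e3) z)) (trans V n2 w)
    + sg R n1 *: ma P hd hu (degm2 e0 e2) (trans U n1 z)
        (ret_h (r V) (degh n2) (defect (erefl (n2 + 1)) (esym e4) w))).
Proof.
have Em : m = n1 + n2 by rewrite e e0 subrK.
rewrite Delta_mu (linearD (Tmap trans W m0)) Tmap_leaf Tmap_mu.
rewrite (linearD (curv P W e2)) curv_leaf add0r.
rewrite (curv_mu _ _ _ _ _ (degm1 e0 e2) (degm2 e0 e2)).
rewrite {1}/defect coder_mu (linBDZ (root_act W e')) root_act_leaf add0r.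
rewrite (root_act_mu _ _ _ _ (degm1 e0 e2)) (root_act_mu _ _ _ _ (degm2 e0 e2)) (root_act_mu _ _ _ _ Em).
rewrite (d_ma hd hu Em e' erefl erefl (degm1 e0 e2) (degm2 e0 e2)).
rewrite (trans_coder erefl (esym e3) (degh n1)) (trans_coder erefl (esym e4) (degh n2)).
rewrite !eps_Tmap !eps_Delta -[theta P U erefl _]/(root_act U erefl z) -[theta P V erefl _]/(root_act V erefl w).
rewrite -[X in ma P hd hu (degm1 e0 e2) (_ - X)]scale1r -[X in ma P hd hu (degm2 e0 e2) _ (_ - X)]scale1r.
rewrite -!scaleNr !(maDl, maDr, maZl, maZr) !scaleN1r !scalerDr !scalerN !opprD !opprK !addrA.
rewrite [LHS](ACl (2*5*3*6*7*1*8*4)).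
refine (etrans (addrK _ _) _); rewrite [RHS]addrA.
exact: addrK.
Qed.

Notation XS := (sumc (Tc XB) (Qc (Tc XB))).

Definition unmarked_eval : hom0 (Tc XS) XA := hcomp trans (Tmap (hcomp (@eps R M XB) fstc)).

(** The evaluation of a tree with one two-vertex piece marked: [curv] acts on
    the marked piece, and the other vertices as in [transt]. *)
Fixpoint marked_evalt V n (t : tree XS V n) : forall m, m = n + (1 + 1) -> XA V m :=
  match t in tree _ V n return forall m, m = n + (1 + 1) -> XA V m with
  | Leaf V n x => fun m e => curvQ P V e (Qmap trans V n (sndc V n (x : XS V n)))
  | Iota U _ n _ h e0 t1 => fun m e =>
      ia P h (degi e0 e) (ret_h (r U) (degh n) (marked_evalt t1 erefl))
  | Mu U V _ n1 n2 _ hd hu e0 t1 t2 => fun m e =>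
      ma P hd hu (degm1 e0 e) (ret_h (r U) (degh n1) (marked_evalt t1 erefl)) (unmarked_eval V n2 (pgen t2))
      + sg R n1 *: ma P hd hu (degm2 e0 e) (unmarked_eval U n1 (pgen t1))
          (ret_h (r V) (degh n2) (marked_evalt t2 erefl))
  end.

Lemma marked_evalt_compat V n m (e : m = n + (1 + 1)) :
  compat (@treerel R M XS V n) (fun t => marked_evalt t e).
Proof.
move=> s hs; elim: hs m e => {V n s}.
- move=> V n a x y m e; rewrite comb3 scale1r !scaleNr scale1r /= !linearP.
  by rewrite -opprD subrr.
- move=> U V W n1 n2 m hd hd' hu hu' e e' t1 t2 m' e''; rewrite comb2 scale1r scaleNr /=.
  rewrite (ma_flip P hd hd' hu hu' _ (degm2 e' e'')).
  rewrite (ma_flip P hd hd' hu hu' _ (degm1 e' e'')) !scalerA.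
  rewrite [X in _ - X]scalerDr scalerA addrC.
  have -> : sg R n1 * sg R (n1 * (n2 + 1)) = sg R (n1 * n2).
    by rewrite mulrDr mulr1 sgD mulrCA sgK mulr1.
  have -> : sg R ((n1 + 1) * n2) = sg R (n1 * n2) * sg R n2.
    by rewrite mulrDl mul1r sgD.
  by rewrite [X in _ + X]addrC; exact: addNr.
- move=> U V n m h e s hs IH m' e'; rewrite comb_smap.
  rewrite (comb_linear (ia P h (degi e e') \o ret_h (r U) (degh n)) (fun t => marked_evalt t erefl)) IH.
  exact: linear0.
- move=> U V W n1 n2 m hd hu e s t2 hs IH m' e'; rewrite comb_smap.
  rewrite (combD (fun t => ma P hd hu (degm1 e e') _ _)) combZ !comb_mal.
  rewrite (comb_linear (ret_h (r U) (degh n1)) (fun t => marked_evalt t erefl)) IH linear0.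
  by rewrite (comb_linear (unmarked_eval U n1) pgen) pgen_compat // linear0 !ma0l scaler0 addr0.
- move=> U V W n1 n2 m hd hu e t1 s hs IH m' e'; rewrite comb_smap.
  rewrite (combD (fun t => ma P hd hu (degm1 e e') _ _)) combZ !comb_mar.
  rewrite (comb_linear (ret_h (r V) (degh n2)) (fun t => marked_evalt t erefl)) IH linear0.
  by rewrite (comb_linear (unmarked_eval V n2) pgen) pgen_compat // linear0 !ma0r scaler0 addr0.
Qed.

Definition marked_eval : homd (1 + 1) (Tc XS) XA := fun V n m e => plin (@marked_evalt_compat V n m e).

Lemma marked_eval_gen V n m (e : m = n + (1 + 1)) t : marked_eval V e (pgen t) = marked_evalt t e.
Proof. exact: plinE. Qed.

Lemma marked_eval_leaf V n m (e : m = n + (1 + 1)) (x : XS V n) :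
  marked_eval V e (tleaf x) = curvQ P V e (Qmap trans V n (sndc V n x)).
Proof. exact: plinE. Qed.

Lemma marked_eval_iota U V n m m' (h : U `<` V) (e0 : m = n - 1) (e : m' = m + (1 + 1)) z :
  marked_eval V e (TIota h e0 z) = ia P h (degi e0 e) (ret_h (r U) (degh n) (marked_eval U erefl z)).
Proof.
move: z; apply: (plin_TIota (f := marked_eval V e)
  (g := ia P h (degi e0 e) \o (ret_h (r U) (degh n) \o marked_eval U erefl))) => t.
by rewrite marked_eval_gen [RHS]/= marked_eval_gen.
Qed.

Lemma marked_eval_mu U V W n1 n2 m m' (hd : U `&` V = set0) (hu : W = U `|` V :> set M)
    (e0 : m = n1 + n2 - 1) (e : m' = m + (1 + 1)) z w :
  marked_eval W e (TMu hd hu e0 z w)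
  = ma P hd hu (degm1 e0 e) (ret_h (r U) (degh n1) (marked_eval U erefl z)) (unmarked_eval V n2 w)
    + sg R n1 *: ma P hd hu (degm2 e0 e) (unmarked_eval U n1 z) (ret_h (r V) (degh n2) (marked_eval V erefl w)).
Proof.
move: z w; apply: (plin_TMu (f := marked_eval W e) (g := fun z w =>
  ma P hd hu (degm1 e0 e) (ret_h (r U) (degh n1) (marked_eval U erefl z)) (unmarked_eval V n2 w)
    + sg R n1 *: ma P hd hu (degm2 e0 e) (unmarked_eval U n1 z) (ret_h (r V) (degh n2) (marked_eval V erefl w)))).
- move=> y a z w; rewrite (linearP (marked_eval U erefl)) (linearP (ret_h (r U) _)) (linearP (unmarked_eval U n1)).
  by rewrite !(maDl, maZl) !scalerDr !scalerA (mulrC a) addrACA.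
- move=> y a z w; rewrite (linearP (marked_eval V erefl)) (linearP (ret_h (r V) _)) (linearP (unmarked_eval V n2)).
  by rewrite !(maDr, maZr) !scalerDr !scalerA (mulrC a) addrACA.
- by move=> t1 t2; rewrite marked_eval_gen [LHS]/= !marked_eval_gen.
Qed.

(** Needed because a [mu] evaluates marks in both branches: the branch without a mark must
    contribute nothing. *)
Lemma marked_eval_inl V n m (e : m = n + (1 + 1)) (z : Tc (Tc XB) V n) : marked_eval V e (Tmap inl0 V n z) = 0.
Proof.
move: V n z m e.
apply: Tc_ind => [V n|V n a x y hx hy|V n x|U V n p h e0 z IH|U V W n1 n2 p hd hu e0 z w IH1 IH2] m e.
- by rewrite !linear0.
- by rewrite (linearP (Tmap inl0 V n)) (linearP (marked_eval V e)) hx hy scaler0 addr0.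
- by rewrite Tmap_leaf marked_eval_leaf (linear0 (Qmap trans V n)) linear0.
- by rewrite Tmap_iota marked_eval_iota IH !linear0.
- by rewrite Tmap_mu marked_eval_mu IH1 IH2 !linear0 ma0l ma0r scaler0 addr0.
Qed.

Lemma unmarked_eval_inl V n (z : Tc XB V n) : unmarked_eval V n (Tmap inl0 V n (Delta V n z)) = trans V n z.
Proof.
rewrite /unmarked_eval /hcomp [LHS]/=; congr (trans V n _).
by rewrite (Tmap_comp (ca := @eps R M XB)) // Teps_Delta.
Qed.

(** Both sides obey the same recursion: a mark on a piece at the root gives the curvature there, and
    a mark higher up gives the defect of the subtree. Hence the defect factors through
    [corelmap]. *)
Lemma defect_corel V n m p (e : m = n + 1) (e' : p = m + 1) (e2 : p = n + (1 + 1)) z :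
  defect e e' z = marked_eval V e2 (corelmap V n z).
Proof.
move: V n z m p e e' e2.
apply: Tc_ind => [V n|V n a x y hx hy|V n x|U V n q h e0 z IH|U V W n1 n2 q hd hu e0 z w IH1 IH2] m p e e' e2.
- by rewrite /defect !linear0 addr0.
- rewrite (linearP (corelmap V n)) (linearP (marked_eval V e2)) -(hx m p e e') -(hy m p e e').
  rewrite /defect (linearP (coder dtrans V e)) (linearP (root_act V e')) (linearP (root_act V e)) (linearP (cdiff (A V) e')).
  by rewrite scalerDr addrACA.
- by rewrite defect_leaf corelmap_leaf linear0.
- rewrite (defect_iota _ _ _ _ e2 (esym (addrA n 1 1))) (IH _ _ _ _ erefl).
  rewrite [corelmap V q _]corelE Delta_iota inf0D inf0_leaf inf0_iota -corelE.
  rewrite (linearD (marked_eval V e2)) marked_eval_leaf marked_eval_iota; congr (_ + _).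
  rewrite -curvQ_toQ -Qmap_toQ -Delta_iota; congr (curvQ _ _ _ (Qmap _ _ _ _)).
- rewrite (defect_mu _ _ _ _ _ e2 (esym (addrA n1 1 1)) (esym (addrA n2 1 1))).
  rewrite (IH1 _ _ _ _ erefl) (IH2 _ _ _ _ erefl).
  rewrite [corelmap W q _]corelE Delta_mu inf0D inf0_leaf inf0_mu -!corelE.
  rewrite (linearD (marked_eval W e2)) marked_eval_leaf (linearD (marked_eval W e2)) !marked_eval_mu !unmarked_eval_inl !marked_eval_inl.
  rewrite !linear0 ma0l ma0r scaler0 addr0 add0r; congr (_ + _).
  by rewrite -curvQ_toQ -Qmap_toQ -Delta_mu; congr (curvQ _ _ _ (Qmap _ _ _ _)).
Qed.

Lemma defect0 V n m p (e : m = n + 1) (e' : p = m + 1) z : corelmap V n z = 0 -> defect e e' z = 0.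
Proof.
have e2 : p = n + (1 + 1) by rewrite e' e addrA.
by move=> z0; rewrite (defect_corel e e' e2) z0 linear0.
Qed.

Lemma dtrans_leaf V n m (e : m = n + 1) (x : B V n) :
  dtrans V e (tleaf (x : XB V n)) = cdiff (B V) e x.
Proof. by rewrite dtransE eps_leaf root_act_leaf linear0 addr0. Qed.

(** The square of the differential of B vanishes, and the remaining terms are [p] of the defect,
    because [p] is a cochain map. *)
Lemma dtrans_sq V n m (e : m = n + (1 + 1)) z : corelmap V n z = 0 -> coder_square dtrans V e z = 0.
Proof.
move=> z0; rewrite (coder_squareE _ erefl (etrans e (addrA n 1 1))) dtransE eps_coder dtransE.
have K0 := defect0 erefl (etrans e (addrA n 1 1)) z0.
rewrite linearD cdiffK add0r -ret_pd -linearD.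
move: K0; rewrite /defect => K0.
by rewrite [X in ret_p _ _ X](etrans (addrC _ _) K0); exact: linear0.
Qed.

Lemma trans_dtrans V n m (e : m = n + 1) z : corelmap V n z = 0 ->
  trans V m (coder dtrans V e z)
  = cdiff (A V) e (eps V n (Tmap trans V n (Delta V n z)))
    + theta P V e (Tmap trans V n (Delta V n z)) :> A V m.
Proof.
move=> z0; have e' : m = m + 1 - 1 by rewrite addrK.
rewrite (trans_coder e erefl e') defect0 // linear0 subr0 eps_Tmap eps_Delta.
by [].
Qed.

End Transfer.

(** The structure of [A] itself is transferred along this retraction. *)
Definition triv_retraction (R : realType) (A : complex R) : retraction A A.
Proof.
refine (@Retraction R A A (fun n => idfun) (fun n => idfun) (fun n m e => \0) _ _ _ _) => //.
by move=> n m m' e1 e2 e3 e4 x /=; rewrite linear0 addr0 subrr.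
Defined.

(** With [h = 0], [transE] reduces [trans] to [eps], so the root vertex acts directly on the leaves
    and transfer returns the original structure. *)
Lemma dtrans_triv (R : realType) (M : topologicalType) (A : prefact_alg R M) V n m
    (e : m = n + 1) z :
  dtrans (pf_balg A) (fun U => triv_retraction (A U)) V e z
  = cdiff (A V) e (eps V n z) + theta (pf_balg A) V e z.
Proof.
rewrite dtransE root_actE; congr (_ + theta _ _ _ _).
rewrite (Tmap_ext (b := @eps R M (underlying A))) ?Teps_Delta // => V' n' u.
have e1 : n' = n' + 1 - 1 by rewrite addrK.
by rewrite (transE _ _ erefl e1) /= subr0.
Qed.

Theorem theorem3 (R : realType) (d : nat) (M : topologicalType)
    (hM : manifold R d M) (A : prefact_alg R M) (B : opens M -> complex R)
    (r : forall U : opens M, retraction (A U) (B U)) :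
  exists (DA : hoDisj_alg A) (DB : hoDisj_alg B) (F : infty_morphism DB DA),
    pf_induced DA /\ inf_extends F (fun U => ret_i (r U)).
Proof.
pose P := pf_balg A; pose rA U := triv_retraction (A U).
have d_ia := @pf_d_ia R M A; have d_ma := @pf_d_ma R M A.
pose DA := hoDisj_of (dtrans_leaf P rA) (@dtrans_sq R M A A P d_ia d_ma rA).
pose DB := hoDisj_of (dtrans_leaf P r) (@dtrans_sq R M A B P d_ia d_ma r).
have DAE V n m (e : m = n + 1) x :
  Defs.incl V m (ho_D DA V e x) = coder (dtrans P rA) V e (Defs.incl V n x) by [].
have DBE V n m (e : m = n + 1) x :
  Defs.incl V m (ho_D DB V e x) = coder (dtrans P r) V e (Defs.incl V n x) by [].
have fd V n m (e : m = n + 1) z : corelmap V n z = 0 ->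
    trans P r V m (coder (dtrans P r) V e z)
    = dtrans P rA V e (Tmap (trans P r) V n (Delta V n z)).
  by move=> z0; rewrite dtrans_triv; exact: trans_dtrans.
exists DA, DB, (infty_of DBE DAE fd); split.
- by move=> V n m e x; rewrite DAE eps_coder dtrans_triv twistE.
(* Composing the morphism with [eps] recovers its corestriction [trans], whose value on a single
   leaf is [i]. *)
- move=> V n b; rewrite -(trans_leaf P r b).
  change (eps V n (Tmap (trans P r) V n (Delta V n (tleaf (b : underlying B V n))))
    = trans P r V n (tleaf b)).
  by rewrite eps_Tmap eps_Delta.
Qed.
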